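(* Let $d\ge 1$ be an integer and for each positive integer $n$ let $H(n)=\prod_{p\mid n}\gcd(p^d-1,n^d-1)$, the product being over the distinct primes $p$ dividing $n$. Then, as $x\to\infty$, $$\frac{1}{x}\sum_{n\le x}\log H(n)=c_3\log\log x+O(d^4),$$ with an absolute implied constant, where $$c_3=c_3(d)=\sum_{d_1\mid d}\ \sum_{\substack{s\ge 1\\ \gcd(\lambda(s),d)=d_1}} f(s,d_1)^2\,\frac{\Lambda(s)}{s\,\phi(s)}.$$
   Context: $\Lambda$ is the von Mangoldt function, $\phi$ is Euler's function, and $\lambda(s)$ is the Carmichael function (the exponent of the group $(\mathbb{Z}/s\mathbb{Z})^*$). For a prime power $s$ and $d_1\mid\lambda(s)$, $f(s,d_1)$ denotes the number of $y\in(\mathbb{Z}/s\mathbb{Z})^*$ with $y^{d_1}=1$; thus $f(s,d_1)=d_1$, except if $s=2^a$ with $a\ge 3$ and $d_1\ge 2$, in which case $f(s,d_1)=2d_1$. (Only prime powers $s$ contribute to $c_3$, since $\Lambda(s)=0$ otherwise.) *)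

(* Defs.v *)
From HB Require Import structures.
From mathcomp Require Import all_boot all_order all_algebra fingroup abelian.
From mathcomp Require Import reals ereal normedtype sequences exp.

Set Implicit Arguments.
Unset Strict Implicit.
Unset Printing Implicit Defensive.

Import Order.TTheory GRing.Theory Num.Theory.

Local Open Scope ring_scope.

(* The von Mangoldt function: s is a prime power p ^ k with 0 < k exactly when
   1 < s and s is a power of its least prime factor, which is then p. *)
Definition mangoldt (R : realType) (s : nat) : R :=
  if (1 < s)%N && (pdiv s).-nat s then ln (pdiv s)%:R else 0.

(* The library reads 'Z_1 as 'Z_2, but the unit group is trivial in both, so
   carmichael and nb_roots take the right values for every s >= 1. *)
Definition carmichael (s : nat) : nat := exponent (units_Zp s).

Definition nb_roots (s d1 : nat) : nat :=
  #|[set y : {unit 'Z_s} | (y ^+ d1 == 1)%g]|.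

Definition Hfun (d n : nat) : nat :=
  (\prod_(p <- primes n) gcdn (p ^ d - 1) (n ^ d - 1))%N.

(* The terms are nonnegative, so the series always has a value in \bar R. *)
Definition c3_const (R : realType) (d : nat) : \bar R :=
  (\sum_(d1 <- divisors d)
     \sum_(1 <= s <oo | gcdn (carmichael s) d == d1)
       ((nb_roots s d1)%:R ^+ 2 * mangoldt R s /
          (s%:R * (totient s)%:R))%:E)%E.

(* Main.v *)
Require Import Defs.
From HB Require Import structures.
From mathcomp Require Import all_boot all_order all_algebra fingroup abelian.
From mathcomp Require Import boolp classical_sets reals ereal normedtype sequences exp.
From mathcomp Require Import ring lra zify.
From mathcomp.real_closed Require Import complex.
From mathcomp Require Import perm morphism automorphism zmodp gproduct cyclic pgroup.
From mathcomp Require Import extremal separable algC cyclotomic classfun character.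

(* Write f(s) for nb_roots s d.  Expanding each log gcd(p^d-1, n^d-1) as the
   sum of Lambda(s) over its divisors s turns the sum of log H(n) into a sum,
   over primes p and s with p^d = 1 mod s, of Lambda(s) times the number of
   m <= x/p with m^d = 1 mod s.  That number is f(s) x/(ps) + O(f(s)), and by
   Chebyshev's bound and f(s) <= 2d the errors add up to O(d^2 x).  What is
   left is the sum of 1/p over p <= x with p^d = 1 mod s, which is
   f(s) log log x / phi(s) up to an error that must remain summable against
   f(s) Lambda(s)/s.  The p <= s are summed over s first; for p > s one needs,
   uniformly in the prime power s and in a,
     sum_{p <= N, p = a mod s} log p/p = log N/phi(s) + O(log^9 s),
   since partial summation above exp(2 sqrt s), and the trivial bound below it,
   then give an error O(log^9 s/sqrt s) for the sum of 1/p.  This Mertens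
   estimate comes from L(1,chi) sum Lambda(n) chi(n)/n = O(log^2 s) together
   with lower bounds for |L(1,chi)|: log^(-7) s for complex chi, from the
   3-4-1 inequality, and 1/s for real chi, from Monsky's Lambert series.  The
   second bound is poor, but a prime power modulus has at most 4 real
   characters, so after division by phi(s) it costs only a constant. *)

Set Implicit Arguments.
Unset Strict Implicit.
Unset Printing Implicit Defensive.

Import Order.TTheory GRing.Theory Num.Theory.

Local Open Scope ring_scope.

(** The moduli s run up to about x^d, far beyond the primes being counted, so each estimate must
    hold for every prime power s with an error that decays in s. This is why p <= s is split off: a
    residue class may have a very small representative, for which 1/p is not O(1/s). For those p the
    roles change: the s with p^d = 1 mod s are the divisors of p^d - 1, their Lambda(s) add up to at
    most d log p, and 1/s <= 1/p, which leaves the convergent sum of d^2 log p/p^2. The threshold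
    exp(2 sqrt s) balances two errors: below it log N/s is at most 2/sqrt s, above it the Mertens
    error is divided by log p >= 2 sqrt s. The range of s is cut at a free M > N^d. Enlarging M does
    not change the sum of log H, so an estimate uniform in M passes to the whole series c_3 while x
    stays fixed. The double sum defining c_3 collapses beforehand, since f(s,d_1) = f(s,d) for d_1 =
    gcd(lambda(s),d). *)

(** * Sums over divisors and multiples *)

Lemma big_divisors (V : nmodType) (F : nat -> V) n N :
  (0 < n <= N)%N ->
  \sum_(d <- divisors n) F d = \sum_(1 <= d < N.+1 | (d %| n)%N) F d.
Proof.
move=> /andP[n0 nN]; rewrite -[RHS]big_filter; apply: perm_big.
apply: uniq_perm; rewrite ?divisors_uniq ?filter_uniq ?iota_uniq// => d.
rewrite mem_filter mem_index_iota -dvdn_divisors// ltnS.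
case: (boolP (d %| n)%N) => //= dn.
by rewrite (dvdn_gt0 n0 dn) (leq_trans (dvdn_leq n0 dn)).
Qed.

Lemma big_multiples (V : nmodType) (G : nat -> V) m N : (0 < m)%N ->
  \sum_(1 <= n < N.+1 | (m %| n)%N) G (n %/ m)%N =
  \sum_(1 <= k < (N %/ m).+1) G k.
Proof.
move=> m0; elim: N => [|N IH]; first by rewrite div0n !big_nil.
rewrite big_mkcond big_nat_recr//= -big_mkcond IH divnS//.
case: (m %| N.+1)%N; last by rewrite addr0.
by rewrite [RHS]big_nat_recr.
Qed.

(** Every n is written as m k and the sum regrouped by m. This rearrangement is used for log N!, for
    the twisted sum of log n/n, and for the Lambert series. *)
Lemma sum_dirichlet (V : nmodType) (F : nat -> nat -> V) N :
  \sum_(1 <= n < N.+1) \sum_(m <- divisors n) F m (n %/ m)%N =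
  \sum_(1 <= m < N.+1) \sum_(1 <= k < (N %/ m).+1) F m k.
Proof.
transitivity (\sum_(1 <= n < N.+1) \sum_(1 <= m < N.+1 | (m %| n)%N) F m (n %/ m)%N).
  by apply: eq_big_nat => n nN; rewrite (@big_divisors _ _ _ N).
rewrite (exchange_big_dep_nat xpredT)//=.
by apply: eq_big_nat => m /andP[m0 _]; rewrite -(@big_multiples _ (F m)).
Qed.

Lemma big_divisors_coprime (V : nmodType) (F : nat -> V) m n :
  (0 < m)%N -> (0 < n)%N -> coprime m n ->
  \sum_(d <- divisors (m * n)) F d =
  \sum_(d <- divisors m) \sum_(e <- divisors n) F (d * e)%N.
Proof.
move=> m0 n0 mn.
transitivity (\sum_(i <- [seq (d * e)%N | d <- divisors m, e <- divisors n]) F i);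
  last by rewrite big_allpairs_dep.
apply: perm_big; apply: uniq_perm; rewrite ?divisors_uniq//.
  apply: allpairs_uniq; rewrite ?divisors_uniq// => -[d e] [d' e'] /=.
  case/allpairsP=> -[x y] /= []; rewrite -!dvdn_divisors// => xm yn [-> ->].
  case/allpairsP=> -[x' y'] /= []; rewrite -!dvdn_divisors// => xm' yn' [-> ->].
  move=> E; have g a b : (a %| m)%N -> (b %| n)%N -> gcdn (a * b) m = a.
    move=> am bn; rewrite -[m in LHS](divnK am) [(_ %/ _ * _)%N]mulnC -muln_gcdr.
    suff /eqP -> : coprime b (m %/ a) by rewrite muln1.
    apply: (coprime_dvdl bn); rewrite coprime_sym.
    exact: (coprime_dvdl (dvdn_div am)).
  have xx : x = x' by rewrite -(g x y)// E g.
  move: E; rewrite xx => /eqP; rewrite eqn_pmul2l ?(dvdn_gt0 m0 xm')//.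
  by move=> /eqP ->.
move=> d; rewrite -dvdn_divisors ?muln_gt0 ?m0//; apply/idP/idP.
  move=> dmn; apply/allpairsP; exists (gcdn d m, gcdn d n).
  rewrite /= -!dvdn_divisors// !dvdn_gcdr; split=> //.
  apply/eqP; rewrite eqn_dvd; apply/andP; split.
    by rewrite muln_gcdr !muln_gcdl !dvdn_gcd dmn dvdn_mulr// dvdn_mull// dvdn_mulr.
  rewrite Gauss_dvd ?dvdn_gcdl// (coprime_dvdl (dvdn_gcdr d m))//.
  exact: (coprime_dvdr (dvdn_gcdr d n)).
case/allpairsP=> -[x y] /= []; rewrite -!dvdn_divisors// => xm yn ->.
exact: dvdn_mul.
Qed.

Lemma big_divisors_pfactor (V : nmodType) (F : nat -> V) p v : prime p ->
  \sum_(d <- divisors (p ^ v)) F d = \sum_(0 <= i < v.+1) F (p ^ i)%N.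
Proof.
move=> pp; transitivity (\sum_(d <- [seq (p ^ i)%N | i <- index_iota 0 v.+1]) F d);
  last by rewrite big_map.
apply: perm_big; apply: uniq_perm; rewrite ?divisors_uniq//.
  rewrite map_inj_in_uniq ?iota_uniq// => i j _ _ /eqP.
  by rewrite eqn_exp2l ?prime_gt1// => /eqP.
move=> d; rewrite -dvdn_divisors ?expn_gt0 ?prime_gt0//.
apply/(dvdn_pfactor _ _ pp)/mapP => -[j].
  by move=> jv ->; exists j; rewrite // mem_index_iota ltnS.
by rewrite mem_index_iota ltnS => jv ->; exists j.
Qed.

(** * The von Mangoldt function *)

Section Mangoldt.
Variable R : realType.
Implicit Types n m p k : nat.
Local Notation Lam := (mangoldt R).

Lemma mangoldt_ge0 n : 0 <= Lam n.
Proof.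
rewrite /mangoldt; case: ifP => // /andP[n1 _].
by rewrite ln_ge0// ler1n prime_gt0// pdiv_prime.
Qed.

Lemma mangoldt_pfactor p k : prime p -> (0 < k)%N -> Lam (p ^ k)%N = ln p%:R.
Proof.
move=> pp; case: k => // k _.
rewrite /mangoldt pdiv_pfactor// pnatX pnat_id//= andbT.
by rewrite -(expn0 p) ltn_exp2l ?prime_gt1.
Qed.

Lemma mangoldt_prime p : prime p -> Lam p = ln p%:R.
Proof. by move=> pp; rewrite -[p in LHS]expn1 mangoldt_pfactor. Qed.

Lemma mangoldt_neq0 n : Lam n != 0 ->
  exists p k, [/\ prime p, (0 < k)%N & n = (p ^ k)%N].
Proof.
rewrite /mangoldt; case: ifP => [/andP[n1 nn] _|]; last by rewrite eqxx.
exists (pdiv n), (logn (pdiv n) n); rewrite pdiv_prime//; split=> //.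
  by rewrite logn_gt0 mem_primes pdiv_prime//= pdiv_dvd andbT (ltn_trans _ n1).
by rewrite -p_part part_pnat_id.
Qed.

Lemma mangoldt1 : Lam 1 = 0.
Proof. by rewrite /mangoldt ltnn. Qed.

Lemma mangoldt_coprimeM m n : (1 < m)%N -> (1 < n)%N -> coprime m n ->
  Lam (m * n)%N = 0.
Proof.
move=> m1 n1 mn; apply/eqP/contraT => /mangoldt_neq0[p [k [pp k0 E]]].
have d a : (1 < a)%N -> (a %| m * n)%N -> (p %| a)%N.
  move=> a1; rewrite E => /(dvdn_pfactor _ _ pp)[i _ ai]; move: a1; rewrite ai.
  by case: i {ai} => // i _; rewrite expnS dvdn_mulr.
have: (p %| gcdn m n)%N.
  rewrite dvdn_gcd; apply/andP; split; apply: d => //.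
    exact: dvdn_mulr.
  exact: dvdn_mull.
by rewrite (eqP mn) dvdn1 => /eqP p1; rewrite p1 in pp.
Qed.

(** Split off the full power p^v of the least prime: n = p^v m. Among the divisors p^i e with e
    dividing m, those with i > 0 and e > 1 are not prime powers; i = 0 gives log m by induction, and
    e = 1 gives v log p. *)
Lemma sum_mangoldt_divisors n : (0 < n)%N ->
  \sum_(d <- divisors n) Lam d = ln n%:R.
Proof.
elim/ltn_ind: n => n IH n0.
have [n1|n1] := leqP n 1.
  have -> : n = 1%N by apply/eqP; rewrite eqn_leq n1 n0.
  by rewrite [divisors 1]/= big_seq1 mangoldt1 ln1.
have pp := pdiv_prime n1; set p := pdiv n in pp *.
have [m pm nE] := pfactor_coprime pp n0.
have v0 : (0 < logn p n)%N by rewrite logn_gt0 mem_primes pp n0 pdiv_dvd.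
have m0 : (0 < m)%N by move: n0; rewrite nE muln_gt0 => /andP[].
have p0 : (0 < p)%N by apply: prime_gt0.
have mn : (m < n)%N.
  by rewrite [X in (_ < X)%N]nE -[X in (X < _)%N]muln1 ltn_pmul2l// -(expn0 p) ltn_exp2l ?prime_gt1.
rewrite nE mulnC big_divisors_coprime ?expn_gt0 ?p0// ?coprimeXl//.
rewrite big_divisors_pfactor// big_nat_recl//.
rewrite (eq_bigr Lam) => [|e _]; last by rewrite expn0 mul1n.
rewrite IH// natrM lnM ?posrE ?ltr0n ?expn_gt0 ?p0// [RHS]addrC; congr (_ + _).
transitivity (\sum_(0 <= i < logn p n) ln (p%:R : R)); last first.
  by rewrite sumr_const_nat subn0 natrX lnXn ?ltr0n.
apply: eq_big_nat => i _; rewrite (bigD1_seq 1%N) ?divisors_uniq ?divisor1//=.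
rewrite muln1 mangoldt_pfactor// big1_seq ?addr0// => e /andP[e1].
rewrite -dvdn_divisors// => em; apply: mangoldt_coprimeM.
- by rewrite -(expn0 p) ltn_exp2l ?prime_gt1.
- by case: e e1 em => [|[|e]]// _; rewrite dvd0n => /eqP m00; rewrite m00 in m0.
- by apply: coprimeXl; apply: coprime_dvdr em pm.
Qed.

End Mangoldt.

(** * Elementary sums *)

Section RealEstimates.
Variable R : realType.
Implicit Types n m p k N : nat.
Local Notation Lam := (mangoldt R).

Lemma ln_succ_le n : (0 < n)%N -> ln n.+1%:R - ln n%:R <= n%:R^-1 :> R.
Proof.
move=> n0; rewrite -ln_div ?posrE ?ltr0n// -natr1 mulrDl mul1r divff ?pnatr_eq0 -?lt0n//.
by rewrite le_ln1Dx// (lt_trans (ltrN10 _))// invr_gt0 ltr0n.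
Qed.

Lemma ln_succ_ge n : (0 < n)%N -> n.+1%:R^-1 <= ln n.+1%:R - ln n%:R :> R.
Proof.
move=> n0; rewrite -lerN2 opprB -ln_div ?posrE ?ltr0n//.
have -> : n%:R / n.+1%:R = 1 + - n.+1%:R^-1 :> R.
  have : n.+1%:R != 0 :> R by rewrite pnatr_eq0.
  by rewrite -natr1 => h; field.
by rewrite le_ln1Dx// ltrN2 invf_lt1 ?ltr0n// ltr1n.
Qed.

Lemma sum_inv_le N : (0 < N)%N ->
  \sum_(1 <= k < N.+1) k%:R^-1 <= 1 + ln N%:R :> R.
Proof.
elim: N => // -[_ _|N IH _]; first by rewrite big_nat1 invr1 ln1 addr0.
rewrite big_nat_recr//=; have := IH isT; have := @ln_succ_ge N.+1 isT.
by move: (N.+2%:R^-1) => a; lra.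
Qed.

Lemma ln_nat_le n : ln n%:R <= n%:R :> R.
Proof.
case: n => [|n]; first by rewrite ln0.
by rewrite ltW// ln_sublinear// ltr0n.
Qed.

Lemma ln_nat_ge0 n : 0 <= ln n%:R :> R.
Proof. by case: n => [|n]; [rewrite ln0 | rewrite ln_ge0// ler1n]. Qed.

Lemma powR_natE n (x : R) : (0 < n)%N -> n%:R `^ x = expR (x * ln n%:R).
Proof. by move=> n0; rewrite /powR pnatr_eq0 gtn_eqF. Qed.

(** Discrete form of the derivative of n^(-eta), from exp v >= 1 + v. Telescoping it bounds the
    tails of the zeta series at 1 + eta. *)
Lemma powR_diff_ge (eta : R) n : 0 < eta -> (0 < n)%N ->
  eta * n.+1%:R `^ (- (1 + eta)) <= n%:R `^ (- eta) - n.+1%:R `^ (- eta).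
Proof.
move=> e0 n0; have n1 : n.+1%:R != 0 :> R by rewrite pnatr_eq0.
rewrite opprD powRD ?n1 ?implybT// powR_inv1 ?ler0n//.
have -> : n%:R `^ (- eta) = n.+1%:R `^ (- eta) * expR (eta * (ln n.+1%:R - ln n%:R)) :> R.
  by rewrite !powR_natE// -expRD; congr expR; ring.
have P := @powR_ge0 R n.+1%:R (- eta).
have E := expR_ge1Dx (eta * (ln n.+1%:R - ln n%:R) : R).
have L : eta * n.+1%:R^-1 <= eta * (ln n.+1%:R - ln n%:R) :> R.
  by rewrite ler_pM2l// ln_succ_ge.
move: P E L; move: (n.+1%:R `^ (- eta)) (n.+1%:R^-1) => A u A0 E L.
move: E L; move: (ln _ - ln _) => v; move: (expR _) => X E L.
have : A * (1 + eta * u) <= A * X by apply: ler_wpM2l => //; lra.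
lra.
Qed.

Lemma powR_diff_le (eta : R) n : 0 < eta -> (0 < n)%N ->
  n%:R `^ (- eta) - n.+1%:R `^ (- eta) <= eta / n%:R.
Proof.
move=> e0 n0.
have -> : n.+1%:R `^ (- eta) = n%:R `^ (- eta) * expR (- (eta * (ln n.+1%:R - ln n%:R))) :> R.
  by rewrite !powR_natE// -expRD; congr expR; ring.
have P := @powR_ge0 R n%:R (- eta).
have P1 : n%:R `^ (- eta) <= 1 :> R.
  by rewrite powRN invf_le1 ?powR_gt0 ?ltr0n// -[leLHS](powRr0 n%:R) ler_powR ?ler1n// ltW.
have E := expR_ge1Dx (- (eta * (ln n.+1%:R - ln n%:R)) : R).
have L : eta * (ln n.+1%:R - ln n%:R) <= eta / n%:R :> R.
  by rewrite ler_pM2l// ln_succ_le.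
have u0 : 0 <= eta / n%:R by rewrite divr_ge0 ?ler0n// ltW.
move: P P1 E L u0; move: (n%:R `^ (- eta)) (eta / n%:R) => A u A0 A1 E L u0.
move: E L; move: (ln _ - ln _) => v; move: (expR _) => X E L.
have : A * (1 - u) <= A * X by apply: ler_wpM2l => //; lra.
have : A * u <= 1 * u by apply: ler_wpM2r.
lra.
Qed.

Lemma sum_powR_tail (eta : R) M N : 0 < eta -> (0 < M)%N ->
  \sum_(M.+1 <= n < N) n%:R `^ (- (1 + eta)) <= M%:R `^ (- eta) / eta.
Proof.
move=> e0 M0; rewrite ler_pdivlMr// mulrC.
have [NM|MN] := leqP N M.
  by rewrite big_geq ?mulr0 ?powR_ge0// ltnW.
apply: (@le_trans _ _ (M%:R `^ (- eta) - N.-1%:R `^ (- eta))); last first.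
  by rewrite gerBl powR_ge0.
elim: N MN => // N IH; rewrite ltnS leq_eqVlt => /predU1P[<-|MN].
  by rewrite big_geq// mulr0/= subrr.
rewrite big_nat_recr//= mulrDr.
have := IH MN; case: N MN {IH} => // N MN /=.
have := @powR_diff_ge eta N e0 (leq_trans M0 MN); lra.
Qed.

Lemma sum_powR_le (eta : R) N : 0 < eta ->
  \sum_(1 <= n < N) n%:R `^ (- (1 + eta)) <= 1 + eta^-1.
Proof.
move=> e0; have [N1|N1] := leqP N 1.
  by rewrite big_geq// addr_ge0// invr_ge0 ltW.
rewrite big_ltn// powR1 lerD2l (le_trans (@sum_powR_tail eta 1 N e0 isT))//.
by rewrite powR1 mul1r.
Qed.

(** Since k/e >= 1, 1 + t <= (k/e) (1 + e t/k) <= (k/e) exp(e t/k); then raise to the power k. *)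
Lemma poly_le_expR k (e t : R) : 0 < e -> e <= k%:R -> 0 <= t ->
  (1 + t) ^+ k <= (k%:R / e) ^+ k * expR (e * t).
Proof.
move=> e0 ek t0; have k0 : 0 < k%:R :> R by lra.
have -> : e * t = k%:R * (e / k%:R * t) by field; rewrite gt_eqF.
rewrite expRM_natl -exprMn lerXn2r ?nnegrE; try lra.
  by rewrite mulr_ge0// ?expR_ge0// divr_ge0// ltW.
have E := expR_ge1Dx (e / k%:R * t).
have : k%:R / e * (1 + e / k%:R * t) <= k%:R / e * expR (e / k%:R * t).
  by rewrite ler_wpM2l// divr_ge0// ltW.
have -> : k%:R / e * (1 + e / k%:R * t) = k%:R / e + t by field; rewrite !gt_eqF.
have : 1 <= k%:R / e by rewrite ler_pdivlMr// mul1r.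
lra.
Qed.

Lemma logpow_le k (e : R) : 0 < e -> e <= k%:R -> exists2 C, 0 < C &
  forall n, (0 < n)%N -> (1 + ln n%:R) ^+ k <= C * n%:R `^ e.
Proof.
move=> e0 ek; exists ((k%:R / e) ^+ k).
  by rewrite exprn_gt0// divr_gt0//; lra.
move=> n n0; rewrite powR_natE// poly_le_expR//.
exact: ln_nat_ge0.
Qed.

(** The power of the logarithm is absorbed by n^(1/4), which leaves the convergent sum of n^(-5/4).
    This is the series that makes the errors summable over the moduli. *)
Lemma sum_logpow_bounded k : exists2 C : R, 0 < C & forall N,
  \sum_(1 <= n < N) (1 + ln n%:R) ^+ k.+1 / (n%:R * Num.sqrt n%:R) <= C.
Proof.
have [C C0 HC] : exists2 C : R, 0 < C & forall n, (0 < n)%N ->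
    (1 + ln n%:R) ^+ k.+1 <= C * n%:R `^ 4^-1.
  apply: logpow_le; first lra.
  have : 1 <= k.+1%:R :> R by rewrite ler1n.
  lra.
exists (C * (1 + 4^-1^-1)); first by rewrite mulr_gt0//; lra.
move=> N; apply: (@le_trans _ _ (C * \sum_(1 <= n < N) n%:R `^ (- (1 + 4^-1)))); last first.
  by apply: ler_wpM2l; [exact: ltW | apply: sum_powR_le; lra].
rewrite big_distrr/= ler_sum_nat// => n /andP[n0 _].
have n0' : 0 < n%:R :> R by rewrite ltr0n.
rewrite ler_pdivrMr ?mulr_gt0 ?sqrtr_gt0//.
rewrite -powR12_sqrt ?ler0n// -[X in _ * (X * _)]powRr1 ?ler0n//.
have ne : n%:R != 0 :> R by rewrite gt_eqF.
rewrite -powRD ?ne ?implybT// -mulrA -powRD ?ne ?implybT//.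
apply: le_trans (HC n n0) _; rewrite ler_pM2l// ler_powR ?ler1n//; lra.
Qed.

Lemma sum_ln_sqr_bounded : exists2 C : R, 0 < C & forall N,
  \sum_(1 <= n < N) ln n%:R / n%:R ^+ 2 <= C.
Proof.
have [C C0 HC] := sum_logpow_bounded 0; exists C => // N.
apply: le_trans (HC N); rewrite ler_sum_nat// => n /andP[n0 _].
have n0' : 0 < n%:R :> R by rewrite ltr0n.
have n1 : 1 <= n%:R :> R by rewrite ler1n.
have s0 : 0 < Num.sqrt n%:R :> R by rewrite sqrtr_gt0.
have sn : Num.sqrt n%:R <= n%:R :> R.
  rewrite -[leRHS]sqr_sqrtr ?ler0n// expr2 ler_peMl ?(ltW s0)//.
  by rewrite -[leLHS]sqrtr1 ler_wsqrtr.
rewrite expr1 ler_pM ?ln_nat_ge0 ?invr_ge0 ?exprn_ge0 ?ler0n//; first lra.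
by rewrite lef_pV2 ?posrE ?mulr_gt0// expr2 ler_pM2l.
Qed.

End RealEstimates.

(** * Chebyshev and Mertens estimates *)

Section Chebyshev.
Variable R : realType.
Implicit Types n m p k N : nat.
Local Notation Lam := (mangoldt R).

Lemma ln_fact N : ln N`!%:R = \sum_(1 <= n < N.+1) ln n%:R :> R.
Proof.
elim: N => [|N IH]; first by rewrite big_geq// fact0 ln1.
rewrite factS natrM lnM ?posrE ?ltr0n ?fact_gt0// IH [RHS]big_nat_recr//=.
by rewrite addrC.
Qed.

Lemma ln_fact_mangoldt N :
  ln N`!%:R = \sum_(1 <= m < N.+1) Lam m * (N %/ m)%:R.
Proof.
rewrite ln_fact -[RHS](eq_big_nat _ _ (F1 := fun m => \sum_(1 <= k < (N %/ m).+1) Lam m)).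
  by rewrite -(sum_dirichlet (fun m _ => Lam m)); apply: eq_big_nat => n /andP[n0 _];
    rewrite sum_mangoldt_divisors.
by move=> m _; rewrite sumr_const_nat subn1/= mulr_natr.
Qed.

Lemma ln_fact_ge N : N%:R * ln N%:R - N%:R <= ln N`!%:R :> R.
Proof.
elim: N => [|N IH]; first by rewrite mul0r subr0 fact0 ln1.
rewrite factS natrM lnM ?posrE ?ltr0n ?fact_gt0//.
have [->|N0] := posnP N; first by rewrite fact0 ln1; lra.
have : N%:R * (ln N.+1%:R - ln N%:R) <= 1 :> R.
  by rewrite -ler_pdivlMl ?ltr0n// mulr1 ln_succ_le.
move: IH; move: (ln N%:R) (ln N.+1%:R) (ln N`!%:R) => a b c.
by rewrite -[N.+1%:R]natr1; lra.
Qed.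

Lemma ln_fact_le N : ln N`!%:R <= N%:R * ln N%:R :> R.
Proof.
have [->|N0] := posnP N; first by rewrite mul0r fact0 ln1.
rewrite ln_fact mulr_natl -[leRHS](_ : \sum_(1 <= n < N.+1) ln N%:R = _); last first.
  by rewrite sumr_const_nat subn1.
rewrite ler_sum_nat// => n /andP[n0 nN].
by rewrite ler_ln ?posrE ?ltr0n// ler_nat -ltnS.
Qed.

Definition chebyshev_psi N : R := \sum_(1 <= n < N.+1) Lam n.
Local Notation psi := chebyshev_psi.

(** The logarithm of the central binomial coefficient is the sum of Lambda(m) ([2n/m] - 2 [n/m]).
    The brackets are nonnegative and at least 1 for n < m <= 2n, while the coefficient is at most
    4^n; the crude log 4 <= 4 suffices. *)
Lemma chebyshev_psi_double n : psi n.*2 - psi n <= n%:R * 4.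
Proof.
have E : ln 'C(n.*2, n)%:R = ln n.*2`!%:R - ln n`!%:R *+ 2 :> R.
  have := @bin_fact n.*2 n; rewrite -addnn leq_addr addnK => /(_ isT) <-.
  rewrite !natrM !lnM ?posrE ?ltr0n ?muln_gt0 ?fact_gt0 ?bin_gt0 ?leq_addr//.
  by rewrite mulr2n; ring.
have U : ln 'C(n.*2, n)%:R <= n%:R * 4 :> R.
  have : 'C(n.*2, n)%:R <= 4 ^+ n :> R.
    rewrite -natrX ler_nat; apply: (@leq_trans (2 ^ n.*2)); last by rewrite -muln2 mulnC expnM.
    rewrite -[2%N]/(1 + 1)%N expnDn; under eq_bigr do rewrite !exp1n !muln1.
    have nn : (n < n.*2.+1)%N by rewrite ltnS -addnn leq_addr.
    by rewrite (bigD1 (Ordinal nn))//= leq_addr.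
  rewrite -ler_ln ?posrE ?exprn_gt0 ?ltr0n ?bin_gt0// -?addnn ?leq_addr//.
  move=> /le_trans; apply; rewrite lnXn// -[_ *+ n]mulr_natl.
  by apply: ler_wpM2l => //; exact: ln_nat_le.
apply: le_trans U; rewrite E !ln_fact_mangoldt /psi.
have n2 : (n <= n.*2)%N by rewrite -addnn leq_addr.
have split_sum (F : nat -> R) : \sum_(1 <= m < n.*2.+1) F m =
    \sum_(1 <= m < n.+1) F m + \sum_(n.+1 <= m < n.*2.+1) F m.
  by rewrite (@big_cat_nat _ _ _ n.+1).
rewrite !split_sum [leLHS]addrAC subrr add0r [leRHS]addrAC ler_wpDl//.
  rewrite subr_ge0 -sumrMnl ler_sum_nat// => m /andP[m0 _].
  rewrite -mulrnAr ler_wpM2l ?mangoldt_ge0// -mulrnA ler_nat.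
  by rewrite leq_divRL// -muln2 mulnAC leq_mul2r leq_trunc_div orbT.
rewrite ler_sum_nat// => m /andP[m0 mn].
by rewrite ler_peMr ?mangoldt_ge0// ler1n divn_gt0 ?(leq_ltn_trans _ m0).
Qed.

Lemma mangoldt_le n : Lam n <= ln n%:R.
Proof.
have [->|n0] := posnP n; first by rewrite /mangoldt /= ln0.
rewrite -(sum_mangoldt_divisors R n0) (bigD1_seq n) ?divisors_uniq//= -?dvdn_divisors//.
by rewrite lerDl sumr_ge0// => d _; exact: mangoldt_ge0.
Qed.

(** Halving: psi(2n) <= 6n + 4n, and for 2n + 1 the additional term is at most log(2n + 1) <= 2n.
    The total 12n is what fixes the constant 6. *)
Lemma chebyshev_psi_le N : psi N <= 6 * N%:R.
Proof.
elim/ltn_ind: N => N IH.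
have [N1|N1] := leqP N 1.
  case: N N1 {IH} => [_|[_|]]//; first by rewrite /psi big_geq// mulr0.
  by rewrite /psi big_nat1 mangoldt1 mulr1.
set n := N./2.
have nN : (n < N)%N by rewrite /n; lia.
have := IH n nN; have := chebyshev_psi_double n.
have n0 : (0 < n)%N by rewrite /n; lia.
have n1 : 1 <= n%:R :> R by rewrite ler1n.
have := odd_double_half N; rewrite -/n; case: (odd N) => /= NE; last first.
  by rewrite -NE add0n -addnn natrD; lra.
have : psi N = psi n.*2 + Lam N by rewrite -NE add1n /psi [LHS]big_nat_recr.
have := mangoldt_le N.
have : ln N%:R <= n.*2%:R :> R.
  rewrite -NE natrD le_ln1Dx// (lt_le_trans (ltrN10 _))// ler0n.
have -> : N%:R = 1 + n%:R + n%:R :> R by rewrite -NE -addnn !natrD addrA.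
by rewrite -addnn natrD; lra.
Qed.

(** Compare log N!, the sum of Lambda(m) [N/m], with N times the sum of Lambda(m)/m: dropping the
    integer parts costs at most psi(N) <= 6N. *)
Lemma mertens1 N : (0 < N)%N ->
  `| \sum_(1 <= n < N.+1) Lam n / n%:R - ln N%:R | <= 6.
Proof.
move=> N0; have N0' : 0 < N%:R :> R by rewrite ltr0n.
set S := \sum_(_ <= _ < _) _.
have lo : ln N`!%:R <= N%:R * S.
  rewrite ln_fact_mangoldt big_distrr/= ler_sum_nat// => m /andP[m0 _].
  rewrite mulrCA ler_wpM2l ?mangoldt_ge0// ler_pdivlMr ?ltr0n//.
  by rewrite -natrM ler_nat leq_trunc_div.
have hi : N%:R * S <= ln N`!%:R + psi N.
  rewrite ln_fact_mangoldt /psi -big_split big_distrr/= ler_sum_nat// => m /andP[m0 _].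
  rewrite mulrCA -[X in _ + X]mulr1 -mulrDr ler_wpM2l ?mangoldt_ge0//.
  by rewrite ler_pdivrMr ?ltr0n// natr1 -natrM ler_nat ltnW// ltn_ceil.
have := chebyshev_psi_le N; have := ln_fact_le N; have := ln_fact_ge N => A B D.
rewrite ler_norml; apply/andP; split; rewrite -(ler_pM2l N0'); lra.
Qed.

(** The proper powers of p contribute log p times a geometric series starting at p^(-2). *)
Lemma sum_mangoldt_nonprime_bounded : exists2 C : R, 0 < C & forall N,
  \sum_(1 <= n < N.+1 | ~~ prime n) Lam n / n%:R <= C.
Proof.
have [C C0 HC] := sum_ln_sqr_bounded R.
exists (2 * C); first by lra.
move=> N; pose T p k := ln p%:R / (p ^ k)%:R : R.
have T0 p k : 0 <= T p k by rewrite divr_ge0 ?ln_nat_ge0.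
apply: (@le_trans _ _ (\sum_(1 <= n < N.+1) \sum_(2 <= p < N.+1) \sum_(2 <= k < N.+1 | (p ^ k == n)%N) T p k)).
  rewrite big_mkcond ler_sum_nat// => n /andP[n0 nN].
  have S0 : 0 <= \sum_(2 <= p < N.+1) \sum_(2 <= k < N.+1 | (p ^ k == n)%N) T p k.
    by do 2!(apply: sumr_ge0 => ? _).
  case: ifP => // np; have [->|] := eqVneq (Lam n) 0; first by rewrite mul0r.
  case/mangoldt_neq0 => p [k [pp k0 nE]].
  have p1 := prime_gt1 pp.
  have k2 : (1 < k)%N.
    by case: k k0 nE => [|[|]]// _; rewrite expn1 => nE; rewrite nE pp in np.
  have kn : (k < n)%N by rewrite nE ltn_expl.
  have pn : (p <= n)%N by rewrite nE -{1}(expn1 p) leq_exp2l.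
  rewrite (bigD1_seq p) ?iota_uniq//=; last by rewrite mem_index_iota p1/= (leq_ltn_trans pn).
  rewrite (big_rem k)/=; last by rewrite mem_index_iota k2/= (ltn_trans kn).
  rewrite nE eqxx mangoldt_pfactor// -addrA lerDl addr_ge0//; first exact: sumr_ge0.
  by do 2!(apply: sumr_ge0 => ? _).
rewrite exchange_big/=.
apply: (@le_trans _ _ (\sum_(2 <= p < N.+1) 2 * (ln p%:R / p%:R ^+ 2))); last first.
  rewrite -big_distrr/= ler_pM2l// (le_trans _ (HC N.+1))//.
  have [N0|N0] := leqP N 0; first by rewrite !big_geq// ltnS (leq_trans N0).
  by rewrite [leRHS]big_ltn// ln1 mul0r add0r.
rewrite ler_sum_nat// => p /andP[p1 _].
apply: (@le_trans _ _ (\sum_(2 <= k < N.+1) T p k)).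
  rewrite (exchange_big_dep_nat xpredT)//= ler_sum_nat// => k _.
  rewrite big_mkcond -[leRHS]mulr1.
  have [kN|kN] := boolP (p ^ k \in index_iota 1 N.+1)%N.
    rewrite (bigD1_seq (p ^ k)%N) ?iota_uniq//= eqxx big1 ?addr0 ?mulr1// => i ik.
    by rewrite eq_sym (negbTE ik).
  rewrite big1_seq ?mulr1// => i /andP[_ iN]; case: eqP => // E; rewrite -E in iN.
  by rewrite iN in kN.
have p0 : 0 < p%:R :> R by rewrite ltr0n (ltn_trans _ p1).
have p2 : 2 <= p%:R :> R by rewrite ler_nat.
(* The subtracted term makes the induction close: 1/p^M <= 2/p^M - 2/p^(M+1) because p >= 2. *)
have G M : (2 <= M)%N -> \sum_(2 <= k < M) (p ^ k)%:R^-1 <= 2 / p%:R ^+ 2 - 2 / p%:R ^+ M :> R.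
  elim: M => // M IH; rewrite ltnS leq_eqVlt => /predU1P[<-|M2].
    by rewrite big_geq// subrr.
  rewrite big_nat_recr//=; have := IH M2; rewrite natrX [_ ^+ M.+1]exprS [(_ * _ ^+ M)^-1]invfM.
  have : 0 < (p%:R ^+ M)^-1 :> R by rewrite invr_gt0 exprn_gt0.
  have : p%:R^-1 <= 2^-1 :> R by rewrite lef_pV2 ?posrE.
  move: (\sum_(_ <= _ < _) _) (2 / p%:R ^+ 2) (p%:R^-1) => S c a.
  by move: (_ ^+ M)^-1 => b; nra.
have [N2|N2] := leqP N.+1 2.
  by rewrite big_geq// mulr_ge0// divr_ge0 ?ln_nat_ge0// exprn_ge0 ?ltW.
rewrite -big_distrr/= mulrCA ler_wpM2l ?ln_nat_ge0// (le_trans (G _ (ltnW N2)))//.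
by rewrite gerBl divr_ge0// exprn_ge0 ?ltW.
Qed.

End Chebyshev.

(** * Complex numbers over a realType *)

Section ComplexModulus.
Variable R : realType.
Local Notation C := R[i].

(* The norm of [R[i]] takes its values in [R[i]]; [cmod] takes them in [R]. *)
Definition cmod (z : C) : R := Normc.normc z.

Definition toC (x : R) : C := real_complex R x.

Lemma toC_is_additive : additive toC.
Proof. exact: (raddfB (real_complex R)). Qed.

Lemma toC_is_multiplicative : multiplicative toC.
Proof. by split; [exact: (rmorphM (real_complex R)) | exact: (rmorph1 (real_complex R))]. Qed.

HB.instance Definition _ := GRing.isAdditive.Build R C toC toC_is_additive.
HB.instance Definition _ := GRing.isMultiplicative.Build R C toC toC_is_multiplicative.

Lemma cmod_ge0 z : 0 <= cmod z.
Proof. by case: z => a b; exact: sqrtr_ge0. Qed.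

Lemma cmod0 : cmod 0 = 0.
Proof. exact: Normc.normc0. Qed.

Lemma cmod1 : cmod 1 = 1.
Proof. exact: Normc.normc1. Qed.

Lemma cmodM z w : cmod (z * w) = cmod z * cmod w.
Proof. exact: Normc.normcM. Qed.

Lemma cmodD z w : cmod (z + w) <= cmod z + cmod w.
Proof. exact: le_normcD. Qed.

Lemma cmodN z : cmod (- z) = cmod z.
Proof. exact: normcN. Qed.

Lemma cmodB z w : cmod (z - w) <= cmod z + cmod w.
Proof. by rewrite -[cmod w]cmodN cmodD. Qed.

Lemma cmodX z n : cmod (z ^+ n) = cmod z ^+ n.
Proof. by elim: n => [|n IH]; rewrite ?expr0 ?cmod1// !exprS cmodM IH. Qed.

Lemma cmod_toC (x : R) : cmod (toC x) = `|x|.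
Proof. by rewrite /cmod/= expr0n/= addr0 sqrtr_sqr. Qed.

Lemma cmod_toCM (x : R) (z : C) : cmod (toC x * z) = `|x| * cmod z.
Proof. by rewrite cmodM cmod_toC. Qed.

Lemma cmod_sum (I : Type) (r : seq I) (P : pred I) (F : I -> C) :
  cmod (\sum_(i <- r | P i) F i) <= \sum_(i <- r | P i) cmod (F i).
Proof.
apply: (big_ind2 (fun z x => cmod z <= x)) => //; first by rewrite cmod0.
by move=> z x w y zx wy; apply: le_trans (cmodD _ _) (lerD zx wy).
Qed.

Lemma cmod_prod (I : Type) (r : seq I) (P : pred I) (F : I -> C) :
  cmod (\prod_(i <- r | P i) F i) = \prod_(i <- r | P i) cmod (F i).
Proof. exact: (big_morph cmod cmodM cmod1). Qed.

Lemma Re_le_cmod (z : C) : `|complex.Re z| <= cmod z.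
Proof. by case: z => a b; rewrite /= -sqrtr_sqr ler_wsqrtr// lerDl sqr_ge0. Qed.

Lemma Im_le_cmod (z : C) : `|complex.Im z| <= cmod z.
Proof. by case: z => a b; rewrite /= -sqrtr_sqr ler_wsqrtr// lerDr sqr_ge0. Qed.

Lemma cmod_le_ReIm (z : C) : cmod z <= `|complex.Re z| + `|complex.Im z|.
Proof.
case: z => a b /=.
rewrite -[leRHS]ger0_norm ?addr_ge0// -sqrtr_sqr ler_wsqrtr//.
rewrite sqrrD !real_normK ?num_real// -addrA [X in _ <= _ + X]addrC addrA.
by rewrite lerDl mulrn_wge0// mulr_ge0.
Qed.

(** Any two of the intervals of radius [e n] around [u n] meet, so the supremum of the left
    endpoints lies in all of them. The limit comes with its rate, as the later arguments require. *)
Lemma nested_intervals (u e : nat -> R) :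
  (forall n m, (n <= m)%N -> `|u m - u n| <= e n) ->
  exists L, forall n, `|u n - L| <= e n.
Proof.
move=> ue; have cross n m : u n - e n <= u m + e m.
  have [nm|mn] := leqP n m.
    have := ue _ _ nm; have := ue _ _ (leqnn m); rewrite subrr normr0.
    by rewrite ler_norml => ? /andP[? _]; lra.
  have := ue _ _ (ltnW mn); have := ue _ _ (leqnn n); rewrite subrr normr0.
  by rewrite ler_norml => ? /andP[_ ?]; lra.
pose A := [set x | exists n, x = u n - e n]%classic.
have A0 : (A !=set0)%classic by exists (u 0%N - e 0%N), 0%N.
have Aub m : ubound A (u m + e m) by move=> _ [n ->].
exists (sup A) => n; rewrite ler_norml; apply/andP; split.
  have : sup A <= u n + e n by apply: ge_sup.
  lra.
have : u n - e n <= sup A by apply: ub_le_sup; [exists (u 0%N + e 0%N) | exists n].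
lra.
Qed.

Lemma complex_nested (u : nat -> C) (e : nat -> R) :
  (forall n m, (n <= m)%N -> cmod (u m - u n) <= e n) ->
  exists L, forall n, cmod (u n - L) <= 2 * e n.
Proof.
move=> ue.
have [a Ha] : exists a, forall n, `|complex.Re (u n) - a| <= e n.
  apply: nested_intervals => n m nm; apply: le_trans (ue _ _ nm).
  by apply: le_trans (Re_le_cmod _); case: (u m) (u n) => [? ?] [].
have [b Hb] : exists a, forall n, `|complex.Im (u n) - a| <= e n.
  apply: nested_intervals => n m nm; apply: le_trans (ue _ _ nm).
  by apply: le_trans (Im_le_cmod _); case: (u m) (u n) => [? ?] [].
exists (Complex a b) => n; apply: le_trans (cmod_le_ReIm _) _.
have := Ha n; have := Hb n; case: (u n) => x y /=; lra.
Qed.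

(** The form in which N tends to infinity throughout: truncation errors are kept as explicit
    multiples of 1/N. *)
Lemma le_add_inv (x a b : R) : 0 <= b ->
  (forall N, (0 < N)%N -> x <= a + b / N%:R) -> x <= a.
Proof.
move=> b0 H; rewrite leNgt; apply/negP => ax.
have xa : 0 < x - a by rewrite subr_gt0.
have := H (Num.truncn (b / (x - a))).+1 isT; apply/negP; rewrite -ltNge.
rewrite -ltrBrDl ltr_pdivrMr ?ltr0n// mulrC -ltr_pdivrMr//.
exact: truncnS_gt.
Qed.

End ComplexModulus.

Arguments cmod {R} z : simpl never.
Arguments toC {R} x : simpl never.

(** * Dirichlet L-series near 1 *)

Section LSeries.
Variable R : realType.
Local Notation C := R[i].
Local Notation Lam := (mangoldt R).

Lemma abel_identity (z : nat -> C) (a : nat -> R) M N : (M <= N)%N ->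
  \sum_(M <= n < N) toC (a n) * z n =
  toC (a N) * \sum_(M <= n < N) z n +
  \sum_(M <= n < N) toC (a n - a n.+1) * \sum_(M <= k < n.+1) z k.
Proof.
elim: N => [|N IH].
  by rewrite leqn0 => /eqP ->; rewrite !big_geq// mulr0 addr0.
rewrite leq_eqVlt => /predU1P[<-|]; first by rewrite !big_geq// mulr0 addr0.
rewrite ltnS => MN; rewrite ![\sum_(M <= _ < N.+1) _]big_nat_recr//= IH//.
rewrite (rmorphB (@toC R) (a N)); ring.
Qed.

(** The weights decrease to a nonnegative value, so their total variation [a M - a N] and the
    boundary weight [a N] add up to [a M]. *)
Lemma abel_bound (z : nat -> C) (a : nat -> R) (A : R) M N :
  (forall n, (M <= n)%N -> 0 <= a n.+1 <= a n) ->
  (forall n, cmod (\sum_(M <= k < n) z k) <= A) -> 0 <= a M ->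
  cmod (\sum_(M <= n < N) toC (a n) * z n) <= A * a M.
Proof.
move=> Ha HA aM.
have A0 : 0 <= A by apply: le_trans (cmod_ge0 _) (HA 0%N).
have [NM|MN] := leqP N M; first by rewrite big_geq// cmod0 mulr_ge0.
have a0 n : (M <= n)%N -> 0 <= a n.
  case: n => [|n]; first by rewrite leqn0 => /eqP <-.
  by rewrite leq_eqVlt => /predU1P[<-//|]; rewrite ltnS => /Ha/andP[].
rewrite abel_identity 1?ltnW//.
apply: le_trans (cmodD _ _) _.
apply: (@le_trans _ _ (a N * A + \sum_(M <= n < N) (a n - a n.+1) * A)).
  apply: lerD.
    by rewrite cmod_toCM ger0_norm ?a0 1?ltnW// ler_wpM2l ?a0// ltnW.
  apply: le_trans (cmod_sum _ _ _) _.
  rewrite ler_sum_nat// => n /andP[Mn _]; rewrite cmod_toCM.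
  have /andP[_ h] := Ha n Mn.
  by rewrite ger0_norm ?subr_ge0// ler_wpM2l ?subr_ge0.
rewrite -big_distrl/= -mulrDl.
rewrite (eq_bigr (fun n => - a n.+1 - - a n)) => [|n _]; last by rewrite opprK addrC.
by rewrite (telescope_sumr (fun n => - a n)) ?(ltnW MN)// opprK addrA subrr add0r mulrC.
Qed.

(** The properties of a nonprincipal character modulo s on which the analytic part rests. An
    interval sum is a difference of two initial sums, each at most s in modulus, hence the bound
    2s. *)
Definition almost_periodic (s : nat) (chi : nat -> C) :=
  [/\ chi 1%N = 1, (forall m n, chi (m * n)%N = chi m * chi n),
      (forall n, cmod (chi n) <= 1) &
      (forall a b, cmod (\sum_(a <= n < b) chi n) <= 2 * s%:R)].

Definition L_partial (chi : nat -> C) (eta : R) (N : nat) : C :=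
  \sum_(1 <= n < N.+1) toC (n%:R `^ (- (1 + eta))) * chi n.

(* [L] is the value at [1 + eta]; stating convergence with this explicit rate
   makes all later limits in [n] elementary. *)
Definition is_L (s : nat) (chi : nat -> C) (eta : R) (L : C) :=
  forall n, cmod (L_partial chi eta n - L) <= 4 * s%:R / n.+1%:R.

Definition mangoldt_twist (chi : nat -> C) (N : nat) : C :=
  \sum_(1 <= n < N.+1) toC (Lam n / n%:R) * chi n.

Section FixedCharacter.
Variables (s : nat) (chi : nat -> C).
Hypothesis s0 : (0 < s)%N.
Hypothesis Hchi : almost_periodic s chi.
Local Notation l := (1 + ln s%:R : R).

Let l1 : 1 <= l. Proof. by rewrite lerDl ln_nat_ge0. Qed.
Let s0' : 0 < s%:R :> R. Proof. by rewrite ltr0n. Qed.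

Lemma powR_le_inv (eta : R) n : 0 <= eta -> (0 < n)%N ->
  n%:R `^ (- (1 + eta)) <= n%:R^-1.
Proof.
move=> e0 n0; rewrite -powR_inv1 ?ler0n// ler_powR ?ler1n//; lra.
Qed.

Lemma chi_tail_inv (eta : R) n N : 0 <= eta -> (0 < n)%N ->
  cmod (\sum_(n <= k < N) toC (k%:R `^ (- (1 + eta))) * chi k) <= 2 * s%:R / n%:R.
Proof.
move=> e0 n0; have [_ _ _ HS] := Hchi.
apply: le_trans (@abel_bound chi (fun k => k%:R `^ (- (1 + eta))) (2 * s%:R) n N _ _ _) _.
- move=> m nm; rewrite powR_ge0/= !powRN lef_pV2 ?posrE ?powR_gt0 ?ltr0n ?(leq_trans n0) ?leqW//.
  by rewrite ge0_ler_powR ?nnegrE ?ler0n ?ler_nat//; lra.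
- by move=> m; exact: HS.
- exact: powR_ge0.
by apply: ler_wpM2l; [rewrite mulr_ge0 ?ler0n | exact: powR_le_inv].
Qed.

(** Up to s the terms are bounded trivially by a harmonic sum; only beyond s is the cancellation
    used. This replaces s by log s. *)
Lemma chi_tail_log (eta : R) n N : 0 <= eta -> (0 < n)%N ->
  cmod (\sum_(n <= k < N) toC (k%:R `^ (- (1 + eta))) * chi k) <= l + 2.
Proof.
move=> e0 n0; have [_ _ chi1 _] := Hchi.
have short M : (M <= s.+1)%N ->
    cmod (\sum_(n <= k < M) toC (k%:R `^ (- (1 + eta))) * chi k) <= l.
  move=> Ms; apply: le_trans (cmod_sum _ _ _) _.
  apply: (@le_trans _ _ (\sum_(n <= k < M) k%:R^-1)).
    rewrite ler_sum_nat// => k /andP[nk _]; rewrite cmod_toCM ger0_norm ?powR_ge0//.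
    have := powR_le_inv e0 (leq_trans n0 nk); apply: le_trans.
    by rewrite ler_piMr ?powR_ge0.
  apply: le_trans (sum_inv_le R s0).
  have [Mn|nM] := leqP M n; first by rewrite big_geq// sumr_ge0// => k _; rewrite invr_ge0 ler0n.
  rewrite [leRHS](@big_cat_nat _ _ _ n)//=; last by rewrite (leq_trans (ltnW nM)).
  rewrite [X in _ <= _ + X](@big_cat_nat _ _ _ M)//=; last exact: ltnW.
  rewrite addrCA lerDl addr_ge0// sumr_ge0// => k _; rewrite invr_ge0 ler0n//.
have [Ns|sN] := leqP N s.+1; first by apply: le_trans (short _ Ns) _; move: l1; lra.
have [sn|ns] := leqP s n.
  apply: le_trans (chi_tail_inv N e0 n0) _.
  have : 2 * s%:R / n%:R <= 2 :> R.
    by rewrite ler_pdivrMr ?ltr0n// ler_pM2l// ler_nat.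
  by move: l1; lra.
rewrite (@big_cat_nat _ _ _ s.+1)//= 1?ltnW//; last exact: leqW.
apply: le_trans (cmodD _ _) (lerD (short _ (leqnn _)) _).
apply: le_trans (chi_tail_inv N e0 _) _ => //.
by rewrite ler_pdivrMr ?ltr0n// ler_pM2l// ler_nat leqW.
Qed.

Lemma L_exists (eta : R) : 0 <= eta -> exists L, is_L s chi eta L.
Proof.
move=> e0; have [|L HL] := @complex_nested R (L_partial chi eta) (fun n => 2 * s%:R / n.+1%:R).
  move=> n m nm; rewrite /L_partial [X in cmod (X - _)](@big_cat_nat _ _ _ n.+1)//=.
  by rewrite [X in cmod X]addrAC subrr add0r chi_tail_inv.
exists L => n; apply: le_trans (HL n) _; rewrite mulrA mulrA.
by have -> : 2 * 2 = 4 :> R by ring.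
Qed.

Lemma cmod_L_le (eta : R) L : 0 <= eta -> is_L s chi eta L -> cmod L <= l + 2.
Proof.
move=> e0 HL; apply: (@le_add_inv _ _ _ (4 * s%:R)) => [|N N0]; first by rewrite mulr_ge0 ?ler0n.
have := HL N.-1; rewrite prednK// => h; apply: le_trans (lerD (chi_tail_log N e0 (ltn0Sn 0)) h).
rewrite -{1}[L](subKr (L_partial chi eta N.-1)) (le_trans (cmodB _ _))// lerD//.
by rewrite /L_partial prednK.
Qed.

Lemma L_tail_log (eta : R) L n : 0 <= eta -> is_L s chi eta L ->
  cmod (L_partial chi eta n - L) <= 2 * (l + 2).
Proof.
move=> e0 HL; apply: le_trans (cmodB _ _) _; rewrite mulr2n mulrDl mul1r lerD//.
  exact: chi_tail_log.
exact: cmod_L_le HL.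
Qed.

(** Split at s: below, the logarithmic tail bound meets a harmonic sum, giving l (l + 2); above,
    2s/(n (n + 1)) telescopes to at most 2. *)
Lemma sum_min_le (N : nat) :
  \sum_(1 <= n < N) n%:R^-1 * Num.min (2 * s%:R / n.+1%:R) (l + 2) <= 5 * l ^+ 2.
Proof.
have m0 n : 0 <= Num.min (2 * s%:R / n.+1%:R) (l + 2).
  by rewrite le_min divr_ge0 ?mulr_ge0 ?ler0n//=; move: l1; lra.
have A M : (M <= s.+1)%N ->
    \sum_(1 <= n < M) n%:R^-1 * Num.min (2 * s%:R / n.+1%:R) (l + 2) <= l * (l + 2).
  move=> Ms; apply: (@le_trans _ _ ((\sum_(1 <= n < s.+1) n%:R^-1) * (l + 2))); last first.
    by rewrite ler_wpM2r ?sum_inv_le//; move: l1; lra.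
  rewrite big_distrl/=.
  have [M1|M1] := leqP M 1.
    rewrite big_geq// sumr_ge0// => n _; rewrite mulr_ge0 ?invr_ge0 ?ler0n//; move: l1; lra.
  rewrite [leRHS](@big_cat_nat _ _ _ M)//=; last exact: ltnW.
  rewrite ler_wpDr//; last first.
    by rewrite ler_sum_nat// => n _; rewrite ler_wpM2l ?invr_ge0 ?ler0n// ge_min lexx orbT.
  by rewrite sumr_ge0// => n _; rewrite mulr_ge0 ?invr_ge0 ?ler0n//; move: l1; lra.
have B M : (s < M)%N ->
    \sum_(s.+1 <= n < M) n%:R^-1 * Num.min (2 * s%:R / n.+1%:R) (l + 2) <= 2.
  move=> sM; apply: (@le_trans _ _ (2 * s%:R * \sum_(s.+1 <= n < M) (- n.+1%:R^-1 - - n%:R^-1))).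
    rewrite big_distrr/= ler_sum_nat// => n /andP[sn _].
    have n0 : 0 < n%:R :> R by rewrite ltr0n (leq_trans _ sn).
    apply: (@le_trans _ _ (n%:R^-1 * (2 * s%:R / n.+1%:R))).
      by rewrite ler_wpM2l ?invr_ge0 ?(ltW n0)// ge_min lexx.
    rewrite le_eqVlt; apply/orP; left; apply/eqP; rewrite -natr1; field.
    by rewrite (gt_eqF n0) nat1r pnatr_eq0.
  rewrite (telescope_sumr (fun n => - n%:R^-1))// opprK -mulrA.
  rewrite ler_piMr// mulrDr mulrN addrC lerBlDr -[leLHS]addr0 lerD ?mulr_ge0 ?invr_ge0 ?ler0n//.
  by rewrite ler_pdivrMr ?ltr0n// mul1r ler_nat.
have [Ns|sN] := leqP N s.+1; first by apply: le_trans (A _ Ns) _; move: l1; nra.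
rewrite (@big_cat_nat _ _ _ s.+1)//= 1?ltnW//.
apply: le_trans (lerD (A _ (leqnn _)) (B N _)) _; first exact: ltnW.
by move: l1; nra.
Qed.

(** Writing c as the sum of its increments and exchanging summations turns the sum into increments
    times tails of the L-series at 1; both tail bounds enter through their minimum. It is applied to
    c n = 1 - n^(-eta) with kappa = eta, and to c n = log n with kappa = 1. *)
Lemma chi_weighted (c : nat -> R) (kappa : R) N :
  0 <= kappa -> c 1%N = 0 ->
  (forall n, (0 < n)%N -> 0 <= c n.+1 - c n <= kappa / n%:R) ->
  cmod (\sum_(1 <= n < N) toC (c n / n%:R) * chi n) <= kappa * (5 * l ^+ 2).
Proof.
move=> k0 c1 cn; pose z n := toC (n%:R `^ (- (1 + 0))) * chi n.
rewrite (eq_big_nat _ _ (F2 := fun n => toC (c n) * z n)); last first.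
  by move=> n _; rewrite /z addr0 powR_inv1 ?ler0n// (rmorphM (@toC R)) mulrA.
case: N => [|N].
  by rewrite big_geq// cmod0 mulr_ge0// mulr_ge0// exprn_ge0//; move: l1; lra.
have -> : \sum_(1 <= n < N.+1) toC (c n) * z n =
    \sum_(1 <= n < N.+1) toC (c n.+1 - c n) * \sum_(n.+1 <= k < N.+1) z k.
  rewrite abel_identity//.
  have -> : toC (c N.+1) = \sum_(1 <= n < N.+1) toC (c n.+1 - c n).
    by rewrite -(rmorph_sum (@toC R)) telescope_sumr// c1 subr0.
  rewrite big_distrl/= -big_split/=; apply: eq_big_nat => n /andP[n1 nN].
  rewrite [\sum_(1 <= _ < N.+1) _](@big_cat_nat _ _ _ n.+1)//=.
  rewrite -opprB (rmorphN (@toC R)); ring.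
apply: le_trans (cmod_sum _ _ _) _.
apply: le_trans _ (ler_wpM2l k0 (sum_min_le N.+1)).
rewrite big_distrr/= ler_sum_nat// => n /andP[n1 nN].
have /andP[h0 h1] := cn n n1.
rewrite cmod_toCM ger0_norm// mulrA ler_pM ?cmod_ge0//.
by rewrite le_min chi_tail_inv//= chi_tail_log.
Qed.

(* The coefficients [1 - n^-eta] increase slowly, so summation by parts against
   the tails of the L-series at 1 applies. *)
Lemma L_continuity (eta : R) L0 L : 0 < eta ->
  is_L s chi 0 L0 -> is_L s chi eta L -> cmod (L - L0) <= eta * (5 * l ^+ 2).
Proof.
move=> e0 H0 He; apply: (@le_add_inv _ _ _ (8 * s%:R)) => [|N N0]; first by rewrite mulr_ge0 ?ler0n.
have := H0 N.-1; have := He N.-1; rewrite prednK// => h1 h2.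
have h3 : cmod (L_partial chi 0 N.-1 - L_partial chi eta N.-1) <= eta * (5 * l ^+ 2).
  have -> : L_partial chi 0 N.-1 - L_partial chi eta N.-1 =
      \sum_(1 <= n < N) toC ((1 - n%:R `^ (- eta)) / n%:R) * chi n.
    rewrite /L_partial prednK// -sumrB; apply: eq_big_nat => n /andP[n0 _].
    rewrite -mulrBl -(rmorphB (@toC R)) addr0; congr (toC _ * _).
    have nn : n%:R != 0 :> R by rewrite pnatr_eq0 -lt0n.
    by rewrite opprD powRD ?nn ?implybT// powR_inv1 ?ler0n// mulrBl mul1r mulrC.
  apply: (@chi_weighted (fun n => 1 - n%:R `^ (- eta))) => [||n n0]; first exact: ltW.
    by rewrite powR1 subrr.
  have := powR_diff_le e0 n0; have := powR_diff_ge e0 n0.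
  have : 0 <= eta * n.+1%:R `^ (- (1 + eta)) by rewrite mulr_ge0 ?powR_ge0// ltW.
  move: (n%:R `^ _) (n.+1%:R `^ (- eta)) (n.+1%:R `^ _) (_ / _) => a b c d; lra.
have -> : L - L0 = - (L_partial chi eta N.-1 - L) - (L_partial chi 0 N.-1 - L_partial chi eta N.-1) + (L_partial chi 0 N.-1 - L0) by ring.
apply: le_trans (cmodD _ _) _.
apply: le_trans (lerD (cmodB _ _) h2) _; rewrite cmodN.
apply: le_trans (lerD (lerD h1 h3) (lexx _)) _.
by move: (eta * _) => x; rewrite -mulrA -mulrA; move: (s%:R / _) => y; lra.
Qed.

(* From [ln = Lam * 1]: the sum of [ln n/n chi n] is the sum over [m] of
   [Lam m/m chi m] times the partial sum of the L-series up to [N/m], which is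
   compared with [L0]; both bounds for the tail are needed, below and above
   [m = N/s]. *)
Lemma L_mangoldt_twist_le L0 N : (0 < N)%N ->
  is_L s chi 0 L0 -> cmod L0 * cmod (mangoldt_twist chi N) <= 133 * l ^+ 2.
Proof.
move=> N0 H0; have [chi1 chiM chib _] := Hchi.
have N0' : 0 < N%:R :> R by rewrite ltr0n.
pose logsum := \sum_(1 <= n < N.+1) toC (ln n%:R / n%:R) * chi n.
have HW : cmod logsum <= 1 * (5 * l ^+ 2).
  apply: (@chi_weighted (fun n => ln n%:R)) => // [|n n0]; first by rewrite ln1.
  rewrite mul1r ln_succ_le// andbT subr_ge0 ler_ln ?posrE ?ltr0n//.
  by rewrite ler_nat.
have E : logsum = \sum_(1 <= m < N.+1) toC (Lam m / m%:R) * chi m * L_partial chi 0 (N %/ m).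
  transitivity (\sum_(1 <= m < N.+1) \sum_(1 <= k < (N %/ m).+1)
      toC (Lam m / m%:R) * chi m * (toC (k%:R `^ (- (1 + 0))) * chi k)).
    rewrite -(sum_dirichlet (fun m k => toC (Lam m / m%:R) * chi m * (toC (k%:R `^ (- (1 + 0))) * chi k))).
    apply: eq_big_nat => n /andP[n0 _].
    rewrite -(sum_mangoldt_divisors R n0) big_distrl/= (rmorph_sum (@toC R)) big_distrl/=.
    apply: eq_big_seq => d; rewrite -dvdn_divisors// => /dvdnP[k nE].
    have d0 : (0 < d)%N by move: n0; rewrite nE muln_gt0 => /andP[].
    rewrite nE mulnK// addr0 powR_inv1 ?ler0n// chiM natrM invfM.
    rewrite !(rmorphM (@toC R)); ring.
  by apply: eq_bigr => m _; rewrite big_distrr.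
have E2 : L0 * mangoldt_twist chi N = logsum - \sum_(1 <= m < N.+1) toC (Lam m / m%:R) * chi m * (L_partial chi 0 (N %/ m) - L0).
  by rewrite E -sumrB /mangoldt_twist big_distrr/=; apply: eq_bigr => m _; ring.
rewrite -cmodM E2; apply: le_trans (cmodB _ _) _.
apply: le_trans (lerD HW (cmod_sum _ _ _)) _.
have Q (m : nat) : (0 < m)%N -> cmod (toC (Lam m / m%:R) * chi m * (L_partial chi 0 (N %/ m) - L0)) <=
    Lam m / m%:R * cmod (L_partial chi 0 (N %/ m) - L0).
  move=> m0; rewrite cmodM cmod_toCM ler_wpM2r ?cmod_ge0//.
  have h : 0 <= Lam m / m%:R by rewrite divr_ge0 ?mangoldt_ge0.
  by rewrite ger0_norm// ler_piMr.
pose M := (N %/ s)%N.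
have MN : (M <= N)%N by exact: leq_div.
rewrite (@big_cat_nat _ _ _ M.+1)//=.
(* For m <= N/s the tail bound 4s/([N/m] + 1) is at most 4 s m/N, and psi(M) <= 6M with M s <= N
   gives 24. *)
have S1 : \sum_(1 <= m < M.+1) cmod (toC (Lam m / m%:R) * chi m * (L_partial chi 0 (N %/ m) - L0)) <= 24.
  apply: (@le_trans _ _ (4 * s%:R / N%:R * chebyshev_psi R M)).
    rewrite big_distrr/= ler_sum_nat// => m /andP[m0 _].
    apply: le_trans (Q m m0) _.
    have m0' : 0 < m%:R :> R by rewrite ltr0n.
    rewrite [leRHS]mulrC -mulrA ler_wpM2l ?mangoldt_ge0// ler_pdivrMl//.
    apply: le_trans (H0 _) _; rewrite ler_pdivrMr ?ltr0n// mulrAC [m%:R * _]mulrC -mulrA.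
    have -> : (N %/ m).+1%:R * m%:R * (4 * (s%:R / N%:R)) =
        4 * s%:R * ((N %/ m).+1%:R * m%:R / N%:R) :> R by ring.
    rewrite ler_peMr ?mulr_ge0 ?ler0n// ler_pdivlMr// mul1r.
    by rewrite -natrM ler_nat ltnW// ltn_ceil.
  have := chebyshev_psi_le R M => h.
  apply: (@le_trans _ _ (4 * s%:R / N%:R * (6 * M%:R))).
    by rewrite ler_wpM2l// divr_ge0// mulr_ge0.
  rewrite mulrAC ler_pdivrMr//.
  have : (M * s)%:R <= N%:R :> R by rewrite ler_nat leq_trunc_div.
  by rewrite natrM; nra.
(* For m > N/s the tail is only logarithmic, but Mertens' estimate at N and at M bounds the sum of
   Lambda(m)/m by log N - log M + 12, and log N - log M <= log s + 1. *)
have S2 : \sum_(M.+1 <= m < N.+1) cmod (toC (Lam m / m%:R) * chi m * (L_partial chi 0 (N %/ m) - L0)) <=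
    2 * (l + 2) * (l + 12).
  apply: (@le_trans _ _ (2 * (l + 2) * \sum_(M.+1 <= m < N.+1) Lam m / m%:R)).
    rewrite big_distrr/= ler_sum_nat// => m /andP[Mm _].
    apply: le_trans (Q m (leq_trans _ Mm)) _ => //.
    by rewrite mulrC ler_wpM2r ?divr_ge0 ?mangoldt_ge0// L_tail_log.
  rewrite ler_wpM2l ?mulr_ge0//; first by move: l1; lra.
  have MT := mertens1 R N0; have [M0|M0] := posnP M.
    have Ns : (N <= s)%N by apply/ltnW; rewrite ltnNge -divn_gt0// -/M M0.
    have : ln N%:R <= ln s%:R :> R by rewrite ler_ln ?posrE ?ler_nat.
    by move: MT; rewrite M0 ler_norml => /andP[_]; move: l1; lra.
  have MT2 := mertens1 R M0.
  move: MT MT2; rewrite !ler_norml => /andP[_].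
  rewrite (@big_cat_nat _ _ _ M.+1)//= => H1 /andP[H2 _].
  have H3 : ln N%:R <= ln M%:R + ln s%:R + 1 :> R.
    have : ln N%:R <= ln (2 * (M%:R * s%:R)) :> R.
      rewrite ler_ln ?posrE ?mulr_gt0 ?ltr0n//.
      have : (N <= 2 * (M * s))%N.
        apply: leq_trans (ltnW (ltn_ceil N s0)) _; rewrite -/M mulnA leq_mul2r.
        by apply/orP; right; lia.
      by rewrite -(ler_nat R) !natrM.
    rewrite !lnM ?posrE ?mulr_gt0 ?ltr0n//.
    have : ln 2 <= 1 :> R by have := @le_ln1Dx R 1 (lt_trans (ltrN10 _) ltr01); rewrite -[1+1]/2%:R.
    lra.
  move: H1 H2 H3 l1; move: (\sum_(_ <= _ < _) _) (\sum_(_ <= _ < _) _) => a b; lra.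
apply: le_trans (lerD (lexx _) (lerD S1 S2)) _.
by move: l1; nra.
Qed.

End FixedCharacter.
End LSeries.

(** * Lower bound for complex characters *)

Section EulerProduct.
Variable R : realType.
Local Notation C := R[i].

Definition ctends (u : nat -> C) (L : C) :=
  forall e : R, 0 < e -> exists N0, forall N, (N0 <= N)%N -> cmod (u N - L) <= e.

Definition prime_to (ps : seq nat) (n : nat) := all (fun p => ~~ (p %| n)%N) ps.

Definition L_sifted (g : nat -> C) (ps : seq nat) (N : nat) : C :=
  \sum_(1 <= n < N.+1 | prime_to ps n) g n.

Lemma L_sifted_cons (g : nat -> C) q ps N :
  (forall m n, g (m * n)%N = g m * g n) ->
  prime q -> all prime ps -> q \notin ps ->
  L_sifted g (q :: ps) N = L_sifted g ps N - g q * L_sifted g ps (N %/ q).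
Proof.
move=> gM pq pps qps; apply/eqP; rewrite eq_sym subr_eq; apply/eqP.
rewrite /L_sifted (bigID (fun n => (q %| n)%N)) addrC /=; congr (_ + _); last first.
  by apply: eq_bigl => n; rewrite /prime_to/= andbC.
rewrite big_distrr/= [RHS]big_mkcond/=.
rewrite -(big_multiples (fun k => if prime_to ps k then g q * g k else 0)) ?prime_gt0//.
rewrite [LHS]big_mkcond [RHS]big_mkcond; apply: eq_bigr => n _.
case: (boolP (q %| n)%N) => [|_]; last by rewrite andbF.
case/dvdnP => k ->; rewrite mulnK ?prime_gt0// andbT.
have -> : prime_to ps (k * q) = prime_to ps k.
  apply: eq_in_all => p pin; have pp : prime p by exact: (allP pps).
  rewrite Euclid_dvdM// [X in _ || X]dvdn_prime2//.
  have /negbTE -> : p != q by apply: contraNneq qps => <-.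
  by rewrite orbF.
by rewrite gM mulrC.
Qed.

(** Complete multiplicativity makes the terms divisible by q equal to g q times the sifted sum up to
    N/q, so each prime multiplies the limit by 1 - g q. The primes are removed one at a time, which
    is compatible with conditional convergence. *)
Lemma L_sifted_tends (g : nat -> C) L ps :
  (forall m n, g (m * n)%N = g m * g n) -> uniq ps -> all prime ps ->
  ctends (L_sifted g [::]) L -> ctends (L_sifted g ps) (L * \prod_(p <- ps) (1 - g p)).
Proof.
move=> gM; elim: ps => [|q ps IH] /=; first by rewrite big_nil mulr1.
case/andP => qps ups /andP[pq pps] HL e e0.
have {}IH := IH ups pps HL.
have B0 : 0 < 1 + cmod (g q) by rewrite ltr_pwDl// cmod_ge0.
have [N0 HN0] := IH (e / (1 + cmod (g q))) (divr_gt0 e0 B0).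
exists (N0 * q)%N => N NN; rewrite big_cons L_sifted_cons//.
set Pi := \prod_(_ <- _) _ in HN0 *.
have -> : L_sifted g ps N - g q * L_sifted g ps (N %/ q) - L * ((1 - g q) * Pi) =
   (L_sifted g ps N - L * Pi) - g q * (L_sifted g ps (N %/ q) - L * Pi) by ring.
apply: le_trans (cmodB _ _) _; rewrite cmodM.
apply: le_trans (lerD (HN0 N _) (ler_wpM2l (cmod_ge0 _) (HN0 (N %/ q)%N _))) _.
- by apply: leq_trans NN; rewrite leq_pmulr ?prime_gt0.
- by rewrite leq_divRL ?prime_gt0.
by rewrite -[X in X + _]mul1r -mulrDl mulrCA divff ?mulr1// gt_eqF.
Qed.

Definition L_term (psi : nat -> C) (eta : R) (n : nat) : C :=
  toC (n%:R `^ (- (1 + eta))) * psi n.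

(* [P] is chosen so that the [n > 1] free of primes up to [P] contribute at most
   1/2; only finite Euler products are then needed. *)
Lemma euler_lower (psi : nat -> C) (eta : R) (L : C) (P : nat) :
  (forall m n, psi (m * n)%N = psi m * psi n) -> psi 1%N = 1 ->
  (forall n, cmod (psi n) <= 1) -> 0 < eta -> (0 < P)%N ->
  P%:R `^ (- eta) / eta <= 2^-1 ->
  ctends (L_partial psi eta) L ->
  4^-1 <= cmod L * \prod_(p <- iota 1 P | prime p) cmod (1 - L_term psi eta p).
Proof.
move=> psiM psi1 psib e0 P0 HP HL.
have gM m n : L_term psi eta (m * n) = L_term psi eta m * L_term psi eta n.
  by rewrite /L_term natrM powRM ?ler0n// psiM (rmorphM (@toC R)); ring.
have g1 : L_term psi eta 1 = 1 by rewrite /L_term powR1 psi1 mulr1 (rmorph1 (@toC R)).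
pose ps := [seq p <- iota 1 P | prime p].
have HD : ctends (L_sifted (L_term psi eta) ps) (L * \prod_(p <- ps) (1 - L_term psi eta p)).
  apply: L_sifted_tends => //; first by rewrite filter_uniq ?iota_uniq.
  by apply/allP => p; rewrite mem_filter => /andP[].
(* At this N the sifted sum is within 1/4 of L times the product and within 1/2 of 1, hence the
   bound 1/4. Taking N >= 1 keeps the term n = 1. *)
have [N0 /(_ (maxn N0 1) (leq_maxl _ _))] := HD 4^-1 (ltac:(lra)).
set N := maxn N0 1 => HN.
have N1 : (0 < N)%N by rewrite leq_max orbT.
have H1 : cmod (L_sifted (L_term psi eta) ps N - 1) <= 2^-1.
  rewrite /L_sifted big_mkcond big_ltn//=.
  have -> : prime_to ps 1.
    apply/allP => p; rewrite mem_filter => /andP[pp _]; rewrite dvdn1.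
    by apply: contraL pp => /eqP ->.
  rewrite g1 [X in cmod X]addrAC subrr add0r.
  apply: le_trans (cmod_sum _ _ _) _.
  have small n : (1 < n)%N -> (n <= P)%N -> prime_to ps n = false.
    move=> n1 nP; apply/negbTE/negP => /allP /(_ (pdiv n)); rewrite pdiv_dvd => H.
    suff : ~~ true by [].
    apply: H; rewrite mem_filter pdiv_prime// mem_iota pdiv_gt0/= add1n ltnS.
    by apply: leq_trans nP; rewrite pdiv_leq// ltnW.
  apply: (@le_trans _ _ (\sum_(2 <= n < N.+1 | (P < n)%N) n%:R `^ (- (1 + eta)))).
    rewrite [leRHS]big_mkcond/= ler_sum_nat// => n /andP[n1 _].
    have [Pn|nP] := ltnP P n; last by rewrite small// cmod0.
    case: ifP => _; last by rewrite cmod0 powR_ge0.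
    by rewrite cmod_toCM ger0_norm ?powR_ge0// ler_piMr ?powR_ge0.
  have -> : \sum_(2 <= n < N.+1 | (P < n)%N) n%:R `^ (- (1 + eta)) =
     \sum_(P.+1 <= n < N.+1) n%:R `^ (- (1 + eta)).
    by rewrite [RHS](big_nat_widenl _ 2).
  by apply: le_trans (sum_powR_tail _ e0 P0) HP.
rewrite -big_filter -cmod_prod -cmodM -/ps.
set Y := L * _ in HN *.
have := cmodD (- (L_sifted (L_term psi eta) ps N - 1)) (L_sifted (L_term psi eta) ps N - Y).
rewrite cmodN.
have -> : - (L_sifted (L_term psi eta) ps N - 1) + (L_sifted (L_term psi eta) ps N - Y) = 1 - Y by ring.
have := cmodD (1 - Y) Y; rewrite subrK cmod1; lra.
Qed.

Lemma exists_cutoff (eta : R) : 0 < eta ->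
  exists P, (0 < P)%N /\ P%:R `^ (- eta) / eta <= 2^-1.
Proof.
move=> e0; have he : 0 < eta / 2 by rewrite divr_gt0.
exists (Num.truncn (expR (- ln (eta / 2) / eta))).+1; split=> //.
set P := _.+1; rewrite ler_pdivrMr// powR_natE// [leRHS]mulrC.
have <- : expR (ln (eta / 2)) = eta / 2 by rewrite lnK.
rewrite ler_expR mulNr lerNl -ler_pdivrMl// mulrC.
rewrite -[leLHS]expRK ler_ln ?posrE ?expR_gt0 ?ltr0n// ltW// /P.
exact: truncnS_gt.
Qed.

(* The 3-4-1 inequality, squared: the exponents 6, 8, 2 come from
   [6 + 8 cos t + 2 cos (2 t) = 4 (1 + cos t)^2 >= 0], and working with finite
   products avoids complex logarithms. *)
Lemma euler_factor_ineq (r : R) (z : C) : 0 <= r <= 1 -> cmod z <= 1 ->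
  (1 - r) ^+ 6 * cmod (1 - toC r * z) ^+ 8 * cmod (1 - toC r * z ^+ 2) ^+ 2 <=
  expR (8 * r ^+ 2).
Proof.
move=> /andP[r0 r1]; case: z => x y z1.
have xy : x ^+ 2 + y ^+ 2 <= 1.
  have := cmod_ge0 (Complex x y); move: z1; rewrite /cmod/= => z1 z0.
  by rewrite -[leLHS]sqr_sqrtr ?addr_ge0 ?sqr_ge0// expr_le1.
have sq (u v : R) : cmod (Complex u v) ^+ 2 = u ^+ 2 + v ^+ 2.
  by rewrite /cmod/= sqr_sqrtr// addr_ge0 ?sqr_ge0.
set A := (1 - r) ^+ 2; set B := cmod (1 - toC r * (Complex x y)) ^+ 2.
have -> : (1 - r) ^+ 6 = A ^+ 3 by rewrite -exprM.
have -> : cmod (1 - toC r * (Complex x y)) ^+ 8 = B ^+ 4 by rewrite -exprM.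
set D := cmod (1 - toC r * (Complex x y) ^+ 2) ^+ 2.
have BE : B = (1 - r * x) ^+ 2 + (r * y) ^+ 2.
  by rewrite /B -[1 - _]/(Complex _ _) sq/= !mul0r subr0 addr0; ring.
have DE : D = (1 - r * (x ^+ 2 - y ^+ 2)) ^+ 2 + (r * (2 * x * y)) ^+ 2.
  by rewrite /D -[1 - _]/(Complex _ _) sq/= !mul0r subr0 addr0; ring.
(* This bound replaces logarithms: the claim reduces to 3 (A - 1) + 4 (B - 1) + (D - 1) <= 8 r^2, a
   polynomial inequality. *)
have h (w : R) : w <= expR (w - 1) by have := expR_ge1Dx (w - 1); rewrite addrC subrK.
have A0 : 0 <= A by exact: sqr_ge0.
have B0 : 0 <= B by exact: sqr_ge0.
have D0 : 0 <= D by exact: sqr_ge0.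
apply: (@le_trans _ _ (expR (A - 1) ^+ 3 * expR (B - 1) ^+ 4 * expR (D - 1))).
  have pw n (w : R) : 0 <= w -> w ^+ n <= expR (w - 1) ^+ n.
    by move=> w0; rewrite lerXn2r ?nnegrE ?expR_ge0.
  apply: (ler_pM _ D0 _ (h D)).
    exact: mulr_ge0 (exprn_ge0 _ A0) (exprn_ge0 _ B0).
  exact: ler_pM (exprn_ge0 _ A0) (exprn_ge0 _ B0) (pw _ _ A0) (pw _ _ B0).
rewrite -!expRM_natl -!expRD ler_expR BE DE /A.
(* Put rho = x^2 + y^2. The part linear in r is -4 r (1 + x)^2 - 2 r (1 - rho), and the quadratic
   part is r^2 (3 + 4 rho + rho^2) <= 8 r^2. *)
have S2 : (x ^+ 2 + y ^+ 2) ^+ 2 <= 1 by rewrite expr_le1 ?addr_ge0 ?sqr_ge0.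
have k1 : 0 <= r * (1 - (x ^+ 2 + y ^+ 2)) by rewrite mulr_ge0// subr_ge0.
have k2 : 0 <= r ^+ 2 * (1 - (x ^+ 2 + y ^+ 2)) by rewrite mulr_ge0 ?sqr_ge0// subr_ge0.
have k3 : 0 <= r ^+ 2 * (1 - (x ^+ 2 + y ^+ 2) ^+ 2) by rewrite mulr_ge0 ?sqr_ge0// subr_ge0.
have k4 : 0 <= r * (1 + x) ^+ 2 by rewrite mulr_ge0 ?sqr_ge0.
have k5 := sqr_ge0 r.
lra.
Qed.

Lemma ctends_is_L s chi (eta : R) L : is_L s chi eta L -> ctends (L_partial chi eta) L.
Proof.
move=> HL e e0; exists (Num.truncn (4 * s%:R / e)) => N NN; apply: le_trans (HL N) _.
rewrite ler_pdivrMr ?ltr0n// [leRHS]mulrC -ler_pdivrMr// ltW//.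
by apply: lt_le_trans (truncnS_gt _) _; rewrite ler_nat ltnS.
Qed.

(** The principal factor of the 3-4-1 product is the zeta function. Its coefficient sums are
    unbounded, so convergence comes from absolute convergence at 1 + eta; the bound 1 + 1/eta
    reflects the pole. *)
Lemma zeta_bound (eta : R) : 0 < eta ->
  exists2 Z, ctends (L_partial (fun=> 1) eta) Z & cmod Z <= 1 + eta^-1.
Proof.
move=> e0; pose u N := L_partial (fun=> 1 : C) eta N.+1.
have tail n m : (n <= m)%N -> cmod (u m - u n) <= n.+1%:R `^ (- eta) / eta.
  move=> nm; rewrite /u /L_partial [X in cmod (X - _)](@big_cat_nat _ _ _ n.+2)//=.
  rewrite [X in cmod X]addrAC subrr add0r; apply: le_trans (cmod_sum _ _ _) _.
  apply: le_trans (@sum_powR_tail R eta n.+1 m.+2 e0 isT).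
  by rewrite ler_sum_nat// => k _; rewrite cmod_toCM cmod1 mulr1 ger0_norm ?powR_ge0.
have [Z HZ] := complex_nested tail.
have TZ : ctends (L_partial (fun=> 1) eta) Z.
  move=> e ee; have he : 0 < eta * e / 2 by rewrite divr_gt0// mulr_gt0.
  exists (Num.truncn (expR (- ln (eta * e / 2) / eta))).+2; case=> // N NN.
  apply: le_trans (HZ N) _; rewrite mulrC -ler_pdivlMr// ler_pdivrMr//.
  rewrite powR_natE// [leRHS]mulrC mulrA.
  have <- : expR (ln (eta * e / 2)) = eta * e / 2 by rewrite lnK.
  rewrite ler_expR mulNr lerNl -ler_pdivrMl// mulrC.
  rewrite -[leLHS]expRK ler_ln ?posrE ?expR_gt0 ?ltr0n// ltW//.
  by apply: lt_le_trans (truncnS_gt _) _; rewrite ler_nat ltnW.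
exists Z => //; apply/ler_addgt0Pr => e ee; have [N /(_ N (leqnn N)) HN] := TZ e ee.
have := cmodB (L_partial (fun=> 1) eta N) (L_partial (fun=> 1) eta N - Z).
rewrite subKr => /le_trans; apply; apply: lerD HN.
apply: le_trans (cmod_sum _ _ _) _; apply: le_trans (@sum_powR_le R eta N.+1 e0).
by rewrite ler_sum_nat// => k _; rewrite cmod_toCM cmod1 mulr1 ger0_norm ?powR_ge0.
Qed.

(** The lower bounds of [euler_lower] for zeta, chi and chi^2 are multiplied with exponents 6, 8 and
    2, and the finite Euler products disappear by [euler_factor_ineq]. The assumption on chi^2 keeps
    its L-value of size log s; zeta contributes the factor eta^6. *)
Lemma L_lower_341 : exists2 c : R, 0 < c <= 1 &
  forall s (chi : nat -> C) (eta : R) L1 L2, (0 < s)%N -> 0 < eta <= 1 ->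
  almost_periodic s chi -> almost_periodic s (fun n => chi n ^+ 2) ->
  is_L s chi eta L1 -> is_L s (fun n => chi n ^+ 2) eta L2 ->
  c * eta ^+ 6 <= cmod L1 ^+ 8 * (1 + ln s%:R) ^+ 2.
Proof.
pose E : R := expR 16.
have E0 : 0 < E by exact: expR_gt0.
have E1 : 1 <= E by rewrite -expR0 ler_expR.
(* 16 = 6 + 8 + 2 factors 1/4; 64 and 9 come from (2/eta)^6 and (3 l)^2; E = exp 16 because the sum
   of 8 p^(-2) is at most 16. *)
exists ((4^-1) ^+ 16 / (64 * 9 * E)).
  have q0 : 0 <= (4^-1 : R) ^+ 16 <= 1 by rewrite exprn_ge0//= exprn_ile1//; lra.
  rewrite divr_gt0 ?exprn_gt0 ?mulr_gt0//= ler_pdivrMr ?mulr_gt0// mul1r.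
  by case/andP: q0 => _ /le_trans; apply; lra.
move=> s chi eta L1 L2 s0 /andP[e0 e1] H1 H2 HL1 HL2.
have l1 : 1 <= 1 + ln s%:R :> R by rewrite lerDl ln_nat_ge0.
set l := 1 + _ in l1 *.
have [P [P0 HP]] := exists_cutoff e0.
have [Z TZ ZB] := zeta_bound e0.
have [c1 cM cb _] := H1; have [c21 c2M c2b _] := H2.
have l2B : cmod L2 <= 3 * l.
  by apply: le_trans (cmod_L_le s0 H2 (ltW e0) HL2) _; rewrite -/l; lra.
have ZB2 : cmod Z <= 2 / eta.
  apply: le_trans ZB _; rewrite mulrDl mul1r lerD2r.
  by rewrite invf_ge1.
have I0 : 4^-1 <= cmod Z * \prod_(p <- iota 1 P | prime p) cmod (1 - L_term (fun=> 1) eta p).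
  by apply: euler_lower => // [_ _|_]; rewrite ?mulr1 ?cmod1.
have I1 := @euler_lower chi eta L1 P cM c1 cb e0 P0 HP (ctends_is_L HL1).
have I2 := @euler_lower (fun n => chi n ^+ 2) eta L2 P c2M c21 c2b e0 P0 HP (ctends_is_L HL2).
move: I0 I1 I2; set Pi0 := \prod_(_ <- _ | _) _; set Pi1 := \prod_(_ <- _ | _) _.
set Pi2 := \prod_(_ <- _ | _) _ => I0 I1 I2.
have PP : Pi0 ^+ 6 * Pi1 ^+ 8 * Pi2 ^+ 2 <= E.
  rewrite /Pi0 /Pi1 /Pi2 -!prodrXl -!big_split/=.
  apply: (@le_trans _ _ (\prod_(p <- iota 1 P | prime p) expR (8 * (p%:R `^ (- (1 + 1)))))).
    rewrite [leLHS]big_mkcond [leRHS]big_mkcond !big_seq.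
    apply: ler_prod => p; rewrite mem_iota => /andP[p1 _]; case: ifP => pp.
      apply/andP; split.
        by rewrite ?mulr_ge0 ?exprn_ge0 ?cmod_ge0.
      set r := p%:R `^ (- (1 + eta)).
      have r0 : 0 <= r by exact: powR_ge0.
      have rp : r <= p%:R^-1 by exact: powR_le_inv (ltW e0) p1.
      have r1 : r <= 1.
        by apply: le_trans rp _; rewrite invf_le1 ?ler1n ?ltr0n.
      have -> : cmod (1 - L_term (fun=> 1) eta p) = 1 - r.
        rewrite /L_term mulr1 -/r -(rmorph1 (@toC R)) -(rmorphB (@toC R)) cmod_toC.
        by rewrite ger0_norm// subr_ge0.
      have r01 : 0 <= r <= 1 by rewrite r0 r1.
      apply: le_trans (euler_factor_ineq r01 (cb p)) _.
      rewrite ler_expR ler_pM2l// opprD powRD ?powR_inv1 ?ler0n//; last first.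
        by rewrite pnatr_eq0 -lt0n p1 implybT.
      by rewrite expr2 ler_pM.
    by rewrite ler01 lexx.
  rewrite -expR_sum ler_expR -big_distrr/=.
  have S : \sum_(1 <= p < P.+1) (p%:R : R) `^ (- (1 + 1)) <= 1 + 1^-1 by exact: sum_powR_le.
  have : \sum_(p <- iota 1 P | prime p) (p%:R : R) `^ (- (1 + 1)) <= \sum_(1 <= p < P.+1) (p%:R : R) `^ (- (1 + 1)).
    rewrite /index_iota subn1/= [leRHS](bigID prime)/= lerDl.
    by apply: sumr_ge0 => p _; apply: powR_ge0.
  by move: S; rewrite invr1; lra.
have pos F (r : seq nat) : 0 <= \prod_(p <- r | prime p) cmod (F p : C).
  by apply: prodr_ge0 => p _; exact: cmod_ge0.
have q0 : 0 <= 4^-1 :> R by rewrite invr_ge0.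
have J : (4^-1) ^+ 16 <= (cmod Z * Pi0) ^+ 6 * (cmod L1 * Pi1) ^+ 8 * (cmod L2 * Pi2) ^+ 2.
  have -> : (4^-1 : R) ^+ 16 = 4^-1 ^+ 6 * 4^-1 ^+ 8 * 4^-1 ^+ 2 by rewrite -!exprD.
  have lif n (x : R) : 4^-1 <= x -> 4^-1 ^+ n <= x ^+ n.
    by move=> x4; rewrite lerXn2r ?nnegrE// (le_trans q0).
  apply: (ler_pM _ (exprn_ge0 2 q0) _ (lif 2%N _ I2)).
    exact: mulr_ge0 (exprn_ge0 _ q0) (exprn_ge0 _ q0).
  exact: ler_pM (exprn_ge0 _ q0) (exprn_ge0 _ q0) (lif _ _ I0) (lif _ _ I1).
have J2 : (4^-1) ^+ 16 <= (2 / eta) ^+ 6 * cmod L1 ^+ 8 * (3 * l) ^+ 2 * E.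
  apply: le_trans J _.
  have -> : (cmod Z * Pi0) ^+ 6 * (cmod L1 * Pi1) ^+ 8 * (cmod L2 * Pi2) ^+ 2 =
      (cmod Z ^+ 6 * cmod L1 ^+ 8 * cmod L2 ^+ 2) * (Pi0 ^+ 6 * Pi1 ^+ 8 * Pi2 ^+ 2) by ring.
  have Lp n (z : C) : 0 <= cmod z ^+ n by rewrite exprn_ge0 ?cmod_ge0.
  apply: ler_pM PP.
  - exact: mulr_ge0 (mulr_ge0 (Lp _ _) (Lp _ _)) (Lp _ _).
  - by rewrite mulr_ge0 ?mulr_ge0 ?exprn_ge0 ?pos.
  apply: ler_pM (Lp _ _) _ _; first exact: mulr_ge0 (Lp _ _) (Lp _ _).
    apply: ler_wpM2r => //; rewrite lerXn2r ?nnegrE ?cmod_ge0//.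
    by rewrite divr_ge0// ltW.
  rewrite lerXn2r ?nnegrE ?cmod_ge0//; lra.
have -> : (4^-1) ^+ 16 / (64 * 9 * E) * eta ^+ 6 = (4^-1) ^+ 16 * (eta ^+ 6 / (64 * 9 * E)) by ring.
have h6 : 0 < eta ^+ 6 / (64 * 9 * E) by rewrite divr_gt0 ?exprn_gt0// !mulr_gt0.
apply: le_trans (ler_wpM2r (ltW h6) J2) _.
rewrite le_eqVlt; apply/orP; left; apply/eqP; field.
by rewrite (gt_eqF e0) (gt_eqF E0).
Qed.

(* The bound at [1 + eta] is carried to 1 by [L_continuity], with [eta] of
   order [(1 + ln s)^-9]. *)
Lemma L_lower_complex : exists2 k : R, 0 < k &
  forall s (chi : nat -> C) L, (0 < s)%N ->
  almost_periodic s chi -> almost_periodic s (fun n => chi n ^+ 2) ->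
  is_L s chi 0 L -> k <= cmod L * (1 + ln s%:R) ^+ 7.
Proof.
have [c /andP[c0 c1] H341] := L_lower_341.
(* If |L| l^7 < k, the argument yields c k^6 <= (6k)^8, that is c' <= k^2; this contradicts k = c'/2
   with 0 < c' <= 1. *)
pose c' := c / 6 ^+ 8.
have c'0 : 0 < c' by rewrite divr_gt0// exprn_gt0.
have c'1 : c' <= 1.
  by rewrite ler_pdivrMr ?exprn_gt0// mul1r (le_trans c1)// exprn_ege1//; lra.
pose k := c' / 2.
have k0 : 0 < k by rewrite divr_gt0.
exists k => // s chi L s0 H1 H2 HL.
have l1 : 1 <= 1 + ln s%:R :> R by rewrite lerDl ln_nat_ge0.
set l := 1 + _ in l1 *.
have l0 : 0 < l by lra.
rewrite leNgt; apply/negP => Lk.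
(* With eta of order l^(-a), continuity allows |L1| of order l^(2 - a), and the two sides of the
   3-4-1 bound balance when 6a = 8 (a - 2) - 2, so a = 9. This also produces the exponent 7 = 9 -
   2. *)
pose eta := k / l ^+ 9.
have e0 : 0 < eta by rewrite divr_gt0// exprn_gt0.
have e1 : eta <= 1.
  rewrite ler_pdivrMr ?exprn_gt0// mul1r; apply: (@le_trans _ _ 1); first by rewrite /k; lra.
  by rewrite exprn_ege1.
have [L1 HL1] := L_exists H1 (ltW e0).
have [L2 HL2] := L_exists H2 (ltW e0).
have e01 : 0 < eta <= 1 by rewrite e0.
have M := H341 s chi eta L1 L2 s0 e01 H1 H2 HL1 HL2.
have D := L_continuity s0 H1 e0 HL HL1.
rewrite -/l in M D.
have L1B : cmod L1 * l ^+ 7 <= 6 * k.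
  have := cmodD (L1 - L) L; rewrite subrK => /le_trans /(_ (lerD D (lexx _))) h.
  have l7 : 0 <= l ^+ 7 by rewrite exprn_ge0 ?ltW.
  apply: le_trans (ler_wpM2r l7 h) _; rewrite mulrDl.
  have -> : eta * (5 * l ^+ 2) * l ^+ 7 = 5 * k.
    by rewrite /eta; field; rewrite gt_eqF.
  by move: (cmod L * _) Lk => x; lra.
have M2 : c * k ^+ 6 <= (6 * k) ^+ 8.
  have -> : c * k ^+ 6 = (c * eta ^+ 6) * l ^+ 54 by rewrite /eta; field; rewrite gt_eqF.
  apply: (@le_trans _ _ ((cmod L1 ^+ 8 * l ^+ 2) * l ^+ 54)).
    by rewrite ler_wpM2r// exprn_ge0// ltW.
  have -> : cmod L1 ^+ 8 * l ^+ 2 * l ^+ 54 = (cmod L1 * l ^+ 7) ^+ 8 by ring.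
  have p7 : 0 <= cmod L1 * l ^+ 7.
    exact: mulr_ge0 (cmod_ge0 _) (exprn_ge0 _ (ltW l0)).
  by rewrite lerXn2r ?nnegrE// (le_trans p7).
have k6 : 0 < k ^+ 6 by rewrite exprn_gt0.
have : c <= 6 ^+ 8 * k ^+ 2.
  by rewrite -(ler_pM2r k6); apply: le_trans M2 _; rewrite [leLHS]exprMn -[leRHS]mulrA -[k ^+ 2 * _]exprD.
have cE : c = c' * 6 ^+ 8 by rewrite /c' divfK// expf_neq0// pnatr_eq0.
rewrite {1}cE mulrC ler_pM2l ?exprn_gt0// /k; nra.
Qed.

End EulerProduct.

(** * Lower bound for real characters *)

Section RealCharacters.
Variable R : realType.
Local Notation C := R[i].

Section Divisors.
Variable r : nat -> R.
Hypothesis r1 : r 1%N = 1.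
Hypothesis rM : forall m n, r (m * n)%N = r m * r n.
Hypothesis r3 : forall n, [|| r n == 0, r n == 1 | r n == -1].

Let a n := \sum_(d <- divisors n) r d.

(** The local factor at p^v of the convolution 1 * r. For r p = 0, 1, -1 it is 1, v + 1 and an
    alternating sum; even exponents, as in squares, give at least 1. *)
Lemma geometric_sign n v :
  (if odd v then 0 else 1) <= \sum_(0 <= i < v.+1) r n ^+ i.
Proof.
case/or3P: (r3 n) => /eqP ->.
- rewrite big_nat_recl// expr0 big1 ?addr0; first by case: odd.
  by move=> i _; rewrite expr0n.
- rewrite (eq_bigr (fun=> 1)) => [|i _]; last by rewrite expr1n.
  rewrite sumr_const_nat subn0; case: odd; first by rewrite ler0n.
  by rewrite (ler_nat R 1).
- suff -> : \sum_(0 <= i < v.+1) (-1) ^+ i = if odd v then 0 else 1 :> R by [].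
  elim: v => [|v IH]; first by rewrite big_nat1.
  by rewrite big_nat_recr//= IH exprS -signr_odd; case: odd; rewrite ?expr0 ?expr1/=; ring.
Qed.

Lemma divisor_sumE m p v : prime p -> (0 < m)%N -> coprime p m ->
  a (p ^ v * m) = (\sum_(0 <= i < v.+1) r p ^+ i) * a m.
Proof.
move=> pp m0 pm; rewrite /a big_divisors_coprime ?expn_gt0 ?(prime_gt0 pp) ?coprimeXl//.
rewrite big_divisors_pfactor// big_distrl/=; apply: eq_bigr => i _.
rewrite big_distrr/=; apply: eq_bigr => e _; rewrite rM; congr (_ * _).
by elim: i => [|i IH]; rewrite ?expn0 ?r1 ?expr0// expnS rM IH exprS.
Qed.

Lemma divisor_sum1 : a 1 = 1.
Proof. by rewrite /a [divisors 1]/= big_seq1. Qed.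

Lemma divisor_sum_ind (Q : nat -> Prop) : Q 1%N ->
  (forall p v m, prime p -> (0 < m)%N -> coprime p m -> Q m -> Q (p ^ v * m)%N) ->
  forall n, (0 < n)%N -> Q n.
Proof.
move=> Q1 QS; elim/ltn_ind => n IH n0.
have [n1|n1] := leqP n 1.
  by have -> : n = 1%N by apply/eqP; rewrite eqn_leq n1 n0.
have pp := pdiv_prime n1; have [m pm nE] := pfactor_coprime pp n0.
have m0 : (0 < m)%N by move: n0; rewrite nE muln_gt0 => /andP[].
have v0 : (0 < logn (pdiv n) n)%N by rewrite logn_gt0 mem_primes pp n0 pdiv_dvd.
have mn : (m < n)%N.
  rewrite [X in (_ < X)%N]nE -[X in (X < _)%N]muln1 ltn_pmul2l//.
  by rewrite -(expn0 (pdiv n)) ltn_exp2l ?prime_gt1.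
by rewrite nE mulnC; apply: QS => //; apply: IH.
Qed.

Lemma divisor_sum_ge0 n : (0 < n)%N -> 0 <= a n.
Proof.
move: n; apply: divisor_sum_ind => [|p v m pp m0 pm IH]; first by rewrite divisor_sum1.
rewrite divisor_sumE// mulr_ge0//; apply: le_trans (geometric_sign p v).
by case: odd.
Qed.

Lemma divisor_sum_sqr n : (0 < n)%N -> 1 <= a (n ^ 2).
Proof.
move: n; apply: divisor_sum_ind => [|p v m pp m0 pm IH]; first by rewrite exp1n divisor_sum1.
rewrite expnMn -expnM divisor_sumE ?expn_gt0 ?m0 ?coprimeXr//.
have := geometric_sign p (v * 2); rewrite muln2 odd_double => H.
by rewrite -[leLHS]mulr1; apply: ler_pM.
Qed.

(** The arithmetic-geometric mean inequality for 1, u^2, ..., u^(2n - 2), by pairing the first and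
    the last term and inducting in steps of two. *)
Lemma geometric_ge (u : R) n : 0 <= u -> n%:R * u ^+ n.-1 <= \sum_(i < n) (u ^+ 2) ^+ i.
Proof.
move=> u0; have [m] := ubnP n; elim: m n => // m IH [|[|n]] nm.
- by rewrite mul0r big_ord0.
- by rewrite mul1r big_ord_recl big_ord0 !expr0 addr0.
have := IH n (leq_trans (leqnSn _) nm) => {}IH.
rewrite big_ord_recr big_ord_recl/= expr0.
have -> : \sum_(i < n) (u ^+ 2) ^+ bump 0 i = u ^+ 2 * \sum_(i < n) (u ^+ 2) ^+ i.
  by rewrite big_distrr/=; apply: eq_bigr => i _; rewrite -exprS.
have E : n%:R * u ^+ n.+1 = u ^+ 2 * (n%:R * u ^+ n.-1).
  by case: (n) => [|k]; rewrite ?mul0r ?mulr0//= -[k.+2]addn2 exprD; ring.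
have : u ^+ 2 * (n%:R * u ^+ n.-1) <= u ^+ 2 * \sum_(i < n) (u ^+ 2) ^+ i.
  by rewrite ler_wpM2l ?sqr_ge0.
rewrite -E -exprM mulnC exprM => H.
have := sqr_ge0 (1 - u ^+ n.+1).
rewrite -[n.+2%:R]natr1 -[n.+1%:R]natr1; move: H; move: (u ^+ n.+1) (\sum_(i < n) _) => x S; nra.
Qed.

End Divisors.

(* Monsky's comparison of [t^n/(1 - t^n)] with [1/(n (1 - t))]: the difference
   decreases in [n], so it is harmless against bounded character sums. *)
Definition monsky_b (t : R) n : R := (n%:R * (1 - t))^-1 - t ^+ n / (1 - t ^+ n).

(** With G k = 1 + t + ... + t^(k-1), the difference of consecutive terms times 1 - t is 1/(n (n+1))
    - t^n/(G n G(n+1)). By [geometric_ge] with u = sqrt t, the product G n G(n+1) is at least n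
    (n+1) t^(n - 1/2). *)
Lemma monsky_b_decreasing t n : 0 < t < 1 -> (0 < n)%N ->
  0 <= monsky_b t n.+1 <= monsky_b t n.
Proof.
move=> /andP[t0 t1] n0.
have T0 : 0 < 1 - t by rewrite subr_gt0.
pose G k := \sum_(i < k) t ^+ i.
have GE k : 1 - t ^+ k = (1 - t) * G k.
  by rewrite -opprB subrX1 -mulNr opprB.
have u0 : 0 <= Num.sqrt t by exact: sqrtr_ge0.
have uu : Num.sqrt t ^+ 2 = t by rewrite sqr_sqrtr// ltW.
have u1 : Num.sqrt t <= 1 by rewrite -sqrtr1 ler_wsqrtr// ltW.
have Gge k : k%:R * Num.sqrt t ^+ k.-1 <= G k by rewrite /G -{2}uu geometric_ge.
have Gpos k : (0 < k)%N -> 0 < G k.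
  move=> k0; apply: lt_le_trans (Gge k); rewrite mulr_gt0 ?ltr0n// exprn_gt0// sqrtr_gt0//.
have bE k : (0 < k)%N -> monsky_b t k = (k%:R^-1 - t ^+ k / G k) / (1 - t).
  move=> k0; rewrite /monsky_b GE; field.
  by rewrite (gt_eqF T0) (gt_eqF (Gpos k k0)) pnatr_eq0 -lt0n k0.
rewrite !bE// divr_ge0 ?(ltW T0)//=; last first.
  rewrite subr_ge0 ler_pdivrMr ?Gpos// mulrC ler_pdivlMr ?ltr0n//.
  rewrite mulr_natr -[leLHS]mulr_natl.
  have -> : n.+1%:R * t ^+ n.+1 = \sum_(i < n.+1) t ^+ n.+1.
    by rewrite sumr_const card_ord mulr_natl.
  by apply: ler_sum => i _; apply: ler_wiXn2l; rewrite ?(ltW t0) ?(ltW t1)// ltnW.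
rewrite ler_wpM2r ?invr_ge0 ?(ltW T0)//.
have Gn := Gpos n n0; have Gn1 := Gpos n.+1 isT.
have GS : G n.+1 = 1 + t * G n.
  by rewrite /G big_ord_recl expr0 big_distrr/=; congr (_ + _); apply: eq_bigr => i _; rewrite -exprS.
have key : n%:R * n.+1%:R * t ^+ n <= G n * G n.+1.
  apply: le_trans (ler_pM _ _ (Gge n) (Gge n.+1)); rewrite ?mulr_ge0 ?exprn_ge0//.
  rewrite /= mulrACA ler_wpM2l// -exprD -{1}uu -exprM ler_wiXn2l//; lia.
have n0' : 0 < n%:R :> R by rewrite ltr0n.
have n1' : 0 < n.+1%:R :> R by rewrite ltr0n.
have : t ^+ n / (G n * G n.+1) <= (n%:R * n.+1%:R)^-1.
  by rewrite ler_pdivrMr ?mulr_gt0// mulrC ler_pdivlMr ?mulr_gt0// mulrC.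
have -> : (n%:R * n.+1%:R)^-1 = n%:R^-1 - n.+1%:R^-1 :> R.
  rewrite -natr1; field.
  by rewrite natr1 (gt_eqF n0') (gt_eqF n1').
have -> : t ^+ n / (G n * G n.+1) = t ^+ n / G n - t ^+ n.+1 / G n.+1.
  have := Gn1; rewrite GS exprS => g1; field.
  by rewrite (gt_eqF Gn) (gt_eqF g1).
move: (_ / G n) (_ / G n.+1) (n%:R^-1) (n.+1%:R^-1) => A B D E; lra.
Qed.

Lemma bernoulli (u : R) n : 0 <= u <= 1 -> 1 - n%:R * u <= (1 - u) ^+ n.
Proof.
move=> /andP[u0 u1]; elim: n => [|n IH]; first by rewrite mul0r subr0.
rewrite exprS; have v0 : 0 <= 1 - u by rewrite subr_ge0.
apply: le_trans (ler_wpM2l v0 IH); rewrite -natr1.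
have : 0 <= n%:R * (u * u) by rewrite !mulr_ge0.
move: (n%:R : R) => m; lra.
Qed.

Lemma expn_decay (u : R) n : 0 < u < 1 -> (0 < n)%N -> (1 - u) ^+ n <= 4 / (n%:R * u) ^+ 2.
Proof.
move=> /andP[u0 u1] n0; have n0' : 0 < n%:R :> R by rewrite ltr0n.
have nu : 0 < n%:R * u by rewrite mulr_gt0.
have h : 1 - u <= expR (- u) by have := expR_ge1Dx (- u).
apply: (@le_trans _ _ (expR (- u) ^+ n)).
  by rewrite lerXn2r ?nnegrE ?expR_ge0// subr_ge0 ltW.
rewrite -expRM_natl mulrN expRN -[leRHS]invrK lef_pV2 ?posrE ?expR_gt0 ?invr_gt0 ?divr_gt0 ?exprn_gt0//.
rewrite invf_div; set w := n%:R * u in nu *.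
have -> : w = 2%:R * (w / 2) by field.
rewrite expRM_natl exprMn mulrAC [2%:R ^+ 2](_ : _ = 4) ?divff ?mul1r//; last by rewrite -natrX.
rewrite lerXn2r ?nnegrE ?expR_ge0 ?divr_ge0 ?(ltW nu)//.
by have := expR_ge1Dx (w / 2); lra.
Qed.

(* With [1 - t = 1/x] the Lambert series of [r] equals [x L + O(s)], while its
   power series has nonnegative coefficients, at least 1 on squares, hence is at
   least a constant times [sqrt x]; [x = 256 s^2] makes the latter win. *)
Lemma L_lower_real s (r : nat -> R) (L : C) : (0 < s)%N ->
  (forall n, [|| r n == 0, r n == 1 | r n == -1]) ->
  almost_periodic s (fun n => toC (r n)) -> is_L s (fun n => toC (r n)) 0 L ->
  1 <= cmod L * (128 * s%:R).
Proof.
move=> s0 r3 [c1 cM cb cS] HL.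
have r1 : r 1%N = 1 by case: c1.
have rM m n : r (m * n)%N = r m * r n by have := cM m n; rewrite -(rmorphM (@toC R)) => -[].
have rb n : `|r n| <= 1 by rewrite -cmod_toC.
have s0' : 1 <= s%:R :> R by rewrite ler1n.
have [x xs] : exists x, x = (256 * s ^ 2)%N by eexists.
have xE : x%:R = 256 * s%:R ^+ 2 :> R by rewrite xs natrM natrX.
have x0 : 0 < x%:R :> R by rewrite ltr0n xs muln_gt0 expn_gt0 s0.
have x1 : 256 <= x%:R :> R by rewrite xE ler_peMr ?ler0n ?exprn_ege1.
pose u : R := x%:R^-1.
have u01 : 0 < u < 1 by rewrite invr_gt0 x0 invf_lt1//; lra.
have [u0 u1] := andP u01.
pose t := 1 - u.
have t01 : 0 < t < 1 by rewrite /t; lra.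
have [t0 t1] := andP t01.
have tx : 1 - t = u by rewrite /t; lra.
have tk n : (0 < n)%N -> 0 < 1 - t ^+ n.
  by move=> n0; rewrite subr_gt0 exprn_ilt1// ?ltW// -lt0n.
have tk2 n : (0 < n)%N -> u <= 1 - t ^+ n.
  move=> n0; rewrite /t; suff : t ^+ n <= t by rewrite /t; lra.
  by rewrite -[leRHS]expr1; apply: ler_wiXn2l; rewrite // ltW.
pose a n := \sum_(d <- divisors n) r d.
have a0 n : (0 < n)%N -> 0 <= a n by exact: divisor_sum_ge0.
have ten n : 0 <= t ^+ n by rewrite exprn_ge0// ltW.
have lower N : (x <= N)%N -> 4 * s%:R <= \sum_(1 <= m < N.+1) a m * t ^+ m.
  (* The squares k^2 with k <= 16 s do not exceed x = 256 s^2, and each contributes at least t^x >=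
     1/4 (Bernoulli's inequality at x/2, squared), in all 4s. *)
  move=> xN; pose K := (16 * s)%N.
  have KN k : (k <= K)%N -> (k ^ 2 <= x)%N.
    by move=> kK; rewrite xs -[256%N]/(16 ^ 2)%N -expnMn leq_exp2r.
  have tx4 : 4^-1 <= t ^+ x.
    have -> : x = (128 * s ^ 2 * 2)%N by rewrite xs; lia.
    have h : 2^-1 <= t ^+ (128 * s ^ 2).
      apply: le_trans (bernoulli _ _); last by rewrite !ltW.
      rewrite /u xE natrM natrX.
      have -> : 128 * s%:R ^+ 2 / (256 * s%:R ^+ 2) = 2^-1 :> R.
        by field; rewrite pnatr_eq0 -lt0n.
      lra.
    by rewrite exprM (_ : 4^-1 = 2^-1 ^+ 2) ?lerXn2r ?nnegrE//; field.
  apply: (@le_trans _ _ (\sum_(1 <= m < N.+1) \sum_(1 <= k < K.+1 | (k ^ 2 == m)%N) 4^-1)).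
    rewrite (exchange_big_dep_nat xpredT)//=.
    apply: (@le_trans _ _ (\sum_(1 <= k < K.+1) 4^-1)).
      by rewrite sumr_const_nat subn1/= -[leRHS]mulr_natr /K natrM; lra.
    rewrite ler_sum_nat// => k /andP[k1 kK].
    rewrite big_mkcond (bigD1_seq (k ^ 2)%N) ?iota_uniq//=; last first.
      by rewrite mem_index_iota expn_gt0 k1 ltnS (leq_trans (KN k kK)).
    by rewrite eqxx lerDl sumr_ge0// => m _; case: ifP.
  rewrite ler_sum_nat// => m /andP[m1 mN].
  have [/hasP[k kin /eqP km]|/hasPn no] := boolP (has (fun k => (k ^ 2 == m)%N) (index_iota 1 K.+1)).
    rewrite -km big_mkcond (bigD1_seq k) ?iota_uniq//= eqxx big1 ?addr0; last first.
      by move=> j jk; rewrite eqn_exp2r// (negbTE jk).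
    move: kin; rewrite mem_index_iota ltnS => /andP[k1 kK].
    rewrite -[leLHS]mul1r ler_pM//; first exact: divisor_sum_sqr.
    apply: le_trans tx4 _; apply: ler_wiXn2l; rewrite ?(ltW t0) ?(ltW t1)//.
    exact: KN.
  rewrite big_seq_cond big_pred0 ?mulr_ge0 ?a0// => k.
  by apply/negbTE/negP => /andP[/no] /negbTE ->.
have upper N : (0 < N)%N -> \sum_(1 <= m < N.+1) a m * t ^+ m <=
   x%:R * (cmod L + 4 * s%:R / N%:R) + 2 * s%:R + 4 * x%:R ^+ 3 / N%:R.
  move=> N0; have N0' : 0 < N%:R :> R by rewrite ltr0n.
  have geo d K : (0 < d)%N -> \sum_(1 <= k < K.+1) t ^+ (d * k) =
      t ^+ d / (1 - t ^+ d) - t ^+ (d * K.+1) / (1 - t ^+ d).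
    move=> d0; have := tk d d0 => td.
    elim: K => [|K IH]; first by rewrite big_geq// muln1 subrr.
    rewrite big_nat_recr//= IH [(d * K.+2)%N]mulnS exprD; field.
    by rewrite gt_eqF.
  (* A full geometric series in t^d is x/d minus [monsky_b t d]. The three sums are the main term x
     L, the monotone remainder treated by Abel's inequality, and the effect of truncating at N. *)
  have -> : \sum_(1 <= m < N.+1) a m * t ^+ m =
     \sum_(1 <= d < N.+1) r d * (x%:R / d%:R)
     - \sum_(1 <= d < N.+1) r d * monsky_b t d
     - \sum_(1 <= d < N.+1) r d * (t ^+ (d * (N %/ d).+1) / (1 - t ^+ d)).
    transitivity (\sum_(1 <= d < N.+1) \sum_(1 <= k < (N %/ d).+1) r d * t ^+ (d * k)).
      rewrite -(sum_dirichlet (fun d k => r d * t ^+ (d * k))).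
      apply: eq_big_nat => n /andP[n0 _]; rewrite /a big_distrl/=.
      apply: eq_big_seq => d; rewrite -dvdn_divisors// => /divnK dn.
      by rewrite mulnC dn.
    rewrite -!sumrB; apply: eq_big_nat => d /andP[d0 _].
    rewrite -big_distrr/= geo// /monsky_b tx /u.
    have d0' : d%:R != 0 :> R by rewrite pnatr_eq0 -lt0n.
    rewrite invfM invrK; ring.
  have B1 : \sum_(1 <= d < N.+1) r d * (x%:R / d%:R) <= x%:R * (cmod L + 4 * s%:R / N%:R).
    have -> : \sum_(1 <= d < N.+1) r d * (x%:R / d%:R) = x%:R * \sum_(1 <= d < N.+1) r d / d%:R.
      by rewrite big_distrr/=; apply: eq_bigr => d _; rewrite mulrCA.
    rewrite ler_pM2l//; apply: le_trans (ler_norm _) _; rewrite -cmod_toC.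
    have -> : toC (\sum_(1 <= d < N.+1) r d / d%:R) = L_partial (fun n => toC (r n)) 0 N.
      rewrite (rmorph_sum (@toC R)); apply: eq_bigr => d _.
      by rewrite addr0 powR_inv1 ?ler0n// -(rmorphM (@toC R)) mulrC.
    have := cmodD (L_partial (fun n => toC (r n)) 0 N - L) L; rewrite subrK => /le_trans; apply.
    rewrite addrC lerD2l; apply: le_trans (HL N) _.
    by rewrite ler_wpM2l ?mulr_ge0 ?ler0n// lef_pV2 ?posrE ?ltr0n// ler_nat.
  have B2 : - \sum_(1 <= d < N.+1) r d * monsky_b t d <= 2 * s%:R.
    apply: le_trans (ler_norm _) _; rewrite normrN -cmod_toC (rmorph_sum (@toC R)).
    rewrite (eq_bigr (fun n => toC (monsky_b t n) * toC (r n))); last first.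
      by move=> d _; rewrite mulrC (rmorphM (@toC R)).
    have b1 : monsky_b t 1 = 1.
      rewrite /monsky_b mul1r expr1; have := tk 1%N isT; rewrite expr1 => h; field.
      by rewrite gt_eqF.
    have -> : 2 * s%:R = 2 * s%:R * monsky_b t 1 by rewrite b1 mulr1.
    apply: abel_bound.
    - by move=> n n1; exact: monsky_b_decreasing.
    - by move=> n; exact: cS.
    - by rewrite b1.
  have B3 : - \sum_(1 <= d < N.+1) r d * (t ^+ (d * (N %/ d).+1) / (1 - t ^+ d)) <= 4 * x%:R ^+ 3 / N%:R.
    rewrite -sumrN.
    apply: (@le_trans _ _ (\sum_(1 <= d < N.+1) t ^+ N * x%:R)).
      rewrite ler_sum_nat// => d /andP[d0 dN]; apply: le_trans (ler_norm _) _.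
      rewrite normrN normrM -[leRHS]mul1r ler_pM//.
      have q0 : 0 <= t ^+ (d * (N %/ d).+1) / (1 - t ^+ d) by rewrite divr_ge0// ltW// tk.
      rewrite ger0_norm// ler_pM ?invr_ge0 ?(ltW (tk _ d0))//.
        by apply: ler_wiXn2l; rewrite ?(ltW t0) ?(ltW t1)// mulnC ltnW// ltn_ceil.
      by rewrite -[leRHS]invrK lef_pV2 ?posrE ?tk// tk2.
    rewrite sumr_const_nat subn1/= -[leLHS]mulr_natr.
    apply: (@le_trans _ _ (4 / (N%:R * u) ^+ 2 * x%:R * N%:R)).
      rewrite ler_wpM2r ?ler0n// ler_wpM2r ?ler0n//.
      exact: expn_decay.
    rewrite le_eqVlt; apply/orP; left; apply/eqP; rewrite /u; field.
    by rewrite (gt_eqF x0) (gt_eqF N0').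
  by apply: lerD B3; apply: lerD B1 B2.
(* As N grows only x |L| + 2s remains above 4s; with x = 256 s^2 this reads 1 <= 128 s |L|. *)
have : 4 * s%:R <= x%:R * cmod L + 2 * s%:R.
  apply: (@le_add_inv _ _ _ (x%:R * (4 * s%:R) + 4 * x%:R ^+ 3)) => [|N N0].
    by rewrite addr_ge0 ?mulr_ge0 ?exprn_ge0 ?ler0n.
  apply: le_trans (lower (N + x)%N (leq_addl _ _)) _.
  apply: le_trans (upper (N + x)%N _) _; first by rewrite addn_gt0 N0.
  have Ni : (N + x)%:R^-1 <= N%:R^-1 :> R.
    by rewrite lef_pV2 ?posrE ?ltr0n ?addn_gt0 ?N0// ler_nat leq_addr.
  have B0 : 0 <= x%:R * (4 * s%:R) + 4 * x%:R ^+ 3 :> R.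
    by rewrite addr_ge0 ?mulr_ge0 ?exprn_ge0 ?ler0n.
  have := ler_wpM2l B0 Ni.
  move: ((N + x)%:R^-1) (N%:R^-1) => p q; lra.
rewrite xE => H.
have : 0 <= s%:R * (cmod L * (128 * s%:R) - 1) by lra.
by rewrite pmulr_rge0 ?subr_ge0//; lra.
Qed.

End RealCharacters.

(** * The dual of a finite abelian group *)

Lemma prim_root_exists (F : closedFieldType) n : (0 < n)%N -> n%:R != 0 :> F ->
  exists z : F, n.-primitive_root z.
Proof.
move=> n0 nF; have [r rE] := closed_field_poly_normal ('X^n - 1 : {poly F}).
move: rE; rewrite (monicP (monicXnsubC 1 n0)) scale1r => rE.
have ur : uniq r by rewrite -separable_prod_XsubC -rE separable_Xn_sub_1.
have sr : (n <= size r)%N by rewrite -ltnS -(size_prod_XsubC r id) -rE size_XnsubC.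
have ar : all n.-unity_root r by apply/allP => z; rewrite -root_prod_XsubC -rE.
by have [z _ pz] := hasP (has_prim_root n0 ar ur sr); exists z.
Qed.

Section DualGroup.
Variable gT : finGroupType.
Hypothesis abT : abelian [set: gT].
Local Notation N := (#|gT|.-1.+1).

Let NE : N = #|gT|. Proof. by rewrite prednK//; apply/card_gt0P; exists 1%g. Qed.

(* Additive homomorphisms into [Z/#|gT|]; composing with powers of a primitive
   [#|gT|]-th root of unity gives the complex characters. *)
Definition dual : {set {ffun gT -> 'I_N}} :=
  [set h : {ffun gT -> 'I_N} | [forall x, forall y, h (x * y)%g == h x + h y]].

Lemma dualP (h : {ffun gT -> 'I_N}) :
  reflect (forall x y, h (x * y)%g = h x + h y) (h \in dual).
Proof.
rewrite inE; apply: (iffP 'forall_forallP) => H x y; exact/eqP/H.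
Qed.

Lemma expg_card (g : gT) : (g ^+ #|gT| = 1)%g.
Proof. by rewrite -cardsT expg_cardG ?inE. Qed.

(** Characters over [algC] of an abelian group are linear and their kernels intersect trivially.
    Only the exponents of their values are kept, so that they can be evaluated at a root of unity of
    any other field. *)
Lemma dual_separates (g : gT) : g != 1%g -> exists2 h, h \in dual & h g != 0.
Proof.
move=> g1; pose G := [set: gT]%G.
have [i gi] : exists i : Iirr G, 'chi_i g != 1.
  apply/existsP; rewrite -negb_forall; apply: contra g1 => /forallP H.
  have : g \in \bigcap_i cfker 'chi[G]_i; last by rewrite TI_cfker_irr inE.
  apply/bigcapP => i _; rewrite cfkerEirr inE (eqP (H i)) lin_char1//.
  exact/char_abelianP.
have lin : 'chi_i \is a linear_char by exact/char_abelianP.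
have [e pe] := C_prim_root_exists (ltn0Sn #|gT|.-1).
have root x : ('chi_i x) ^+ N = 1 by rewrite -lin_charX ?inE// NE expg_card lin_char1.
pose h := [ffun x => sval (prim_rootP pe (root x))].
have hE x : 'chi_i x = e ^+ h x by rewrite ffunE; case: (prim_rootP pe (root x)).
exists h; last by apply: contra gi => /eqP h0; rewrite hE h0 expr0.
apply/dualP => x y; apply/val_inj/eqP => /=.
have : e ^+ h (x * y)%g == e ^+ (h x + h y)%N.
  by rewrite exprD -!hE lin_charM ?inE.
by rewrite (eq_prim_root_expr pe) modn_small.
Qed.

Lemma dual0 : 0 \in dual.
Proof. by apply/dualP => x y; rewrite !ffunE addr0. Qed.

Lemma dualD h k : h \in dual -> k \in dual -> h + k \in dual.
Proof.
by move=> /dualP H /dualP K; apply/dualP => x y; rewrite !ffunE H K addrACA.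
Qed.

Lemma dualN h : h \in dual -> - h \in dual.
Proof. by move=> /dualP H; apply/dualP => x y; rewrite !ffunE H opprD. Qed.

Variables (F : fieldType) (w : F).
Hypothesis pw : N.-primitive_root w.

Definition dual_eval (h : {ffun gT -> 'I_N}) (g : gT) : F := w ^+ h g.
Local Notation ev := dual_eval.

Lemma dual_evalM h x y : h \in dual -> ev h (x * y)%g = ev h x * ev h y.
Proof. by move=> /dualP H; rewrite /ev H -exprD -[RHS](prim_expr_mod pw). Qed.

Lemma dual_evalD h k x : ev (h + k) x = ev h x * ev k x.
Proof. by rewrite /ev ffunE -exprD -[RHS](prim_expr_mod pw). Qed.

Lemma dual_eval_eq1 h x : (ev h x == 1) = (h x == 0).
Proof.
rewrite /ev -(expr0 w) (eq_prim_root_expr pw) mod0n modn_small//.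
Qed.

Lemma dual_eval1 h : h \in dual -> ev h 1%g = 1.
Proof.
move=> /dualP H; apply/eqP; rewrite dual_eval_eq1.
by have /eqP := H 1%g 1%g; rewrite mulg1 -subr_eq subrr eq_sym.
Qed.

Lemma sum_dual_group h : h \in dual ->
  \sum_g ev h g = if h == 0 then #|gT|%:R else 0.
Proof.
move=> hd; case: eqP => [->|/eqP h0].
  by rewrite (eq_bigr (fun=> 1)) ?sumr_const// => g _; rewrite /ev ffunE expr0.
have [g hg] : exists g, h g != 0.
  apply/existsP; rewrite -negb_forall; apply: contra h0 => /forallP H.
  by apply/eqP/ffunP => g; rewrite ffunE; apply/eqP.
have : (ev h g - 1) * \sum_g ev h g == 0.
  rewrite mulrBl mul1r subr_eq0; apply/eqP.
  rewrite big_distrr/= [RHS](reindex_inj (mulgI g))/=.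
  by apply: eq_bigr => k _; rewrite dual_evalM.
by rewrite mulf_eq0 subr_eq0 dual_eval_eq1 (negbTE hg) => /eqP.
Qed.

Lemma sum_subdual (X : {set {ffun gT -> 'I_N}}) g : X \subset dual ->
  (forall h k, h \in X -> k \in X -> h + k \in X) ->
  (forall h, h \in X -> - h \in X) ->
  \sum_(h in X) ev h g = if [forall h in X, h g == 0] then #|X|%:R else 0.
Proof.
move=> Xd XD XN; case: ifP => [/forallP H|/negbT].
  rewrite (eq_bigr (fun=> 1)) ?sumr_const// => h hX.
  by apply/eqP; rewrite dual_eval_eq1; exact: (implyP (H h)).
rewrite negb_forall => /existsP[k]; rewrite negb_imply => /andP[kX kg].
have : (ev k g - 1) * \sum_(h in X) ev h g == 0.
  rewrite mulrBl mul1r subr_eq0; apply/eqP.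
  rewrite big_distrr/= [RHS](reindex_inj (addrI k))/=.
  apply: eq_big => [h|h _]; last by rewrite dual_evalD.
  apply/idP/idP => [hX|hX]; first exact: XD.
  by rewrite -[h](addKr k) XD ?XN.
by rewrite mulf_eq0 subr_eq0 dual_eval_eq1 (negbTE kg) => /eqP.
Qed.

Lemma sum_dual g : \sum_(h in dual) ev h g = if g == 1%g then #|dual|%:R else 0.
Proof.
rewrite sum_subdual//; [|exact: dualD|exact: dualN].
congr (if _ then _ else _); apply/idP/idP => [/forallP H|/eqP ->].
  apply/negPn/negP => /dual_separates[h hd]; apply/negP/negPn.
  exact: (implyP (H h)).
apply/forallP => h; apply/implyP => hd.
by rewrite -dual_eval_eq1 dual_eval1.
Qed.

Hypothesis char0 : forall n, (n%:R == 0 :> F) = (n == 0%N).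

Lemma natr_injF : injective (fun n => n%:R : F).
Proof.
suff H m n : (m <= n)%N -> m%:R = n%:R :> F -> m = n.
  by move=> m n; case: (leqP m n) => [/H//|/ltnW/H h /esym/h].
move=> mn /eqP; rewrite eq_sym -subr_eq0 -natrB// char0 subn_eq0 => nm.
by apply/eqP; rewrite eqn_leq mn.
Qed.

(** The double sum of [ev h g] in its two orders gives both cardinalities as elements of F; [char0]
    brings the equality back to [nat]. *)
Lemma card_dual : #|dual| = #|gT|.
Proof.
apply: natr_injF => /=.
have : \sum_g \sum_(h in dual) ev h g = #|dual|%:R.
  rewrite (bigD1 1%g)//= sum_dual eqxx big1 ?addr0// => g /negbTE g1.
  by rewrite sum_dual g1.
move=> <-; rewrite exchange_big/= (bigD1 (0 : {ffun gT -> 'I_N})) ?dual0//= sum_dual_group ?dual0// eqxx.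
by rewrite big1 ?addr0// => h /andP[hd /negbTE h0]; rewrite sum_dual_group// h0.
Qed.

Definition real_dual := [set h in dual | h + h == 0].

(** Let K be the common kernel of the real characters. Orthogonality gives |real_dual| |K| = |G|;
    squares lie in K, and each fibre of squaring is a translate of a set of solutions of g^2 = 1, so
    |G| <= |K| times the number of those. *)
Lemma card_real_dual : (#|real_dual| <= #|[set g : gT | (g ^+ 2 == 1)%g]|)%N.
Proof.
pose X := real_dual.
have Xd : X \subset dual by apply/fintype.subsetP => h; rewrite inE => /andP[].
have XE h : (h \in X) = (h \in dual) && (h + h == 0) by rewrite finset.in_set.
have XD h k : h \in X -> k \in X -> h + k \in X.
  rewrite !XE => /andP[hd /eqP h2] /andP[kd /eqP k2].
  by rewrite dualD//= addrACA h2 k2 addr0.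
have XN h : h \in X -> - h \in X.
  by rewrite !XE => /andP[hd /eqP h2]; rewrite dualN//= -opprD h2 oppr0.
pose K := [set g : gT | [forall h in X, h g == 0]].
have cardK : (#|X| * #|K| = #|gT|)%N.
  apply: natr_injF => /=; rewrite natrM.
  have : \sum_g \sum_(h in X) ev h g = #|gT|%:R.
    rewrite exchange_big/= (bigD1 (0 : {ffun gT -> 'I_N}))/=; last by rewrite XE dual0 addr0 eqxx.
    rewrite sum_dual_group ?dual0// eqxx big1 ?addr0// => h /andP[hX /negbTE h0].
    by rewrite sum_dual_group ?h0// (fintype.subsetP Xd).
  move=> <-; rewrite (eq_bigr (fun g => if g \in K then #|X|%:R else 0)).
    by rewrite -big_mkcond/= sumr_const mulr_natr.
  by move=> g _; rewrite inE sum_subdual.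
have sqK : [set (g ^+ 2)%g | g : gT] \subset K.
  apply/fintype.subsetP => _ /imsetP[g _ ->]; rewrite inE; apply/forallP => h; apply/implyP.
  by rewrite XE => /andP[/dualP H /eqP /ffunP/(_ g)]; rewrite !ffunE expgS expg1 H => ->.
have cardsq : (#|gT| <= #|[set (g ^+ 2)%g | g : gT]| * #|[set g : gT | (g ^+ 2 == 1)%g]|)%N.
  rewrite -[X in (X <= _)%N]sum1_card (partition_big (fun g => (g ^+ 2)%g) (mem [set (g ^+ 2)%g | g : gT]))/=; last first.
    by move=> g _; apply: imset_f.
  rewrite -sum_nat_const; apply: leq_sum => _ /imsetP[g0 _ ->].
  rewrite sum1_card -(card_imset _ (mulgI g0^-1%g)); apply/subset_leq_card/fintype.subsetP.
  move=> _ /imsetP[g gg0 ->]; move: gg0; rewrite !inE => /eqP gg0.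
  have cg : commute (g0^-1)%g g by apply: (centsP abT); rewrite inE.
  by rewrite expgMn// gg0 expVgn mulVg.
have K0 : (0 < #|K|)%N.
  by move: cardK; case: #|K| => //; rewrite muln0 => E; move: NE; rewrite -E.
rewrite -(leq_pmul2r K0) cardK (leq_trans cardsq)// mulnC leq_mul2l.
by rewrite (subset_leq_card sqK) orbT.
Qed.

End DualGroup.

(** * Roots of unity and characters modulo a prime power *)

Section RootsOfUnityMod.

Lemma card_Ldiv_cyclic (gT : finGroupType) (A : {group gT}) d : (0 < d)%N ->
  cyclic A -> (#|'Ldiv_d(A)%g| <= d)%N.
Proof.
move=> d0 cA; pose H := group (group_Ldiv d (cyclic_abelian cA)).
have /cyclicP[y Hy] : cyclic H by apply: (cyclicS _ cA); rewrite subsetIl.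
have yH : y \in H by rewrite Hy cycle_id.
rewrite -[('Ldiv_d(A))%g]/(gval H) Hy -orderE dvdn_leq// order_dvdn.
by have /LdivP[_ ->] := yH.
Qed.

(** If (y z)^d = 1 with y in <x> and z in <t>, then y^d lies in the trivial intersection; so y is
    d-torsion and z has two choices. *)
Lemma card_Ldiv_dprod2 (gT : finGroupType) (A : {group gT}) (x t : gT) d :
  (0 < d)%N -> #[t]%g = 2%N -> (<[x]> \x <[t]> = A)%g ->
  (#|'Ldiv_d(A)%g| <= 2 * d)%N.
Proof.
move=> d0 ot; case/dprodP => _ mA cxt tI.
have sub : ('Ldiv_d(A) \subset 'Ldiv_d(<[x]>) * <[t]>)%g.
  apply/fintype.subsetP => a /LdivP[]; rewrite -mA => /mulsgP[y z yx zt ->] E.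
  apply: mem_mulg => //; apply/LdivP; split=> //.
  have cyz : commute y z by apply/commute_sym/(centsP cxt).
  move: E; rewrite expgMn// => /eqP; rewrite -eq_invg_mul => /eqP E.
  have : ((y ^+ d)^-1 \in <[x]> :&: <[t]>)%g.
    by rewrite inE groupV groupX// E groupX.
  by rewrite tI => /set1gP /(canRL invgK); rewrite invg1.
apply: leq_trans (subset_leq_card sub) _.
apply: leq_trans (dvdn_leq _ (dvdn_cardMg (group (group_Ldiv d (cycle_abelian x))) <[t]>)) _.
  by rewrite muln_gt0 !cardG_gt0.
by rewrite -orderE ot mulnC leq_mul2l card_Ldiv_cyclic ?cycle_cyclic.
Qed.

(** The units are identified with the automorphisms of a cyclic group of order p^k, whose structure
    is known. The case d = 2 also bounds the number of real characters by 4. *)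
Lemma nb_roots_le p k d : prime p -> (0 < k)%N -> (0 < d)%N ->
  (nb_roots (p ^ k) d <= 2 * d)%N.
Proof.
move=> pp k0 d0; set s := (p ^ k)%N.
have s1 : (1 < s)%N by rewrite -(expn0 p) ltn_exp2l ?prime_gt1.
pose a : 'Z_s := Zp1.
have oa : #[a]%g = s by rewrite orderE -Zp_cycle cardsT card_ord Zp_cast.
have isoA : (units_Zp s \isog Aut <[a]>)%g by have := Zp_unit_isog a; rewrite oa.
have -> : nb_roots s d = #|'Ldiv_d(Aut <[a]>)%g|.
  case/isogP: isoA => f fi <-; rewrite -injm_Ldiv// card_injm//; last exact: subsetIl.
  by rewrite /nb_roots finset.setTI.
have pG : (p.-group <[a]>)%g by rewrite /pgroup -orderE oa pnatX pnat_id.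
have nt : (<[a]> != 1)%g by rewrite cycle_eq1 -order_eq1 oa gtn_eqF.
have dd : (d <= 2 * d)%N by rewrite leq_pmull.
have [m [_ [_ cF _ _]]] := cyclic_pgroup_Aut_structure pG (cycle_cyclic a) nt.
(* The cases are k = 1, p odd, modulus 4, and 2^k with k >= 3; only the last needs the product with
   a group of order 2. *)
case: ifP => _ => [AF|[t [_ ot _]]].
  have cA : cyclic (Aut <[a]>%G) by rewrite AF.
  by apply: leq_trans dd; apply: card_Ldiv_cyclic.
case: ifP => _ => [[[cA _] _ _]|].
  by apply: leq_trans dd; apply: card_Ldiv_cyclic.
case: ifP => _ => [At|[x [_ _ _ xt _]]].
  have cA : cyclic (Aut <[a]>%G) by rewrite At cycle_cyclic.
  by apply: leq_trans dd; apply: card_Ldiv_cyclic.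
exact: card_Ldiv_dprod2 xt.
Qed.

End RootsOfUnityMod.

(** * Dirichlet characters modulo s *)

Section DirichletCharacters.
Variable R : realType.
Local Notation C := R[i].
Variable s : nat.
Hypothesis s1 : (1 < s)%N.
Local Notation gT := ({unit 'Z_s} : finGroupType).
Local Notation N := (#|gT|.-1.+1).

Let abT : abelian [set: gT]. Proof. exact: units_Zp_abelian. Qed.

Lemma card_unitZ : #|gT| = totient s.
Proof. by rewrite -cardsT -card_units_Zp// (ltn_trans _ s1). Qed.

Variable w : C.
Hypothesis pw : N.-primitive_root w.

Definition zunit (n : nat) : option gT := insub (n%:R : 'Z_s).

Definition dchar (h : {ffun gT -> 'I_N}) (n : nat) : C :=
  oapp (dual_eval w h) 0 (zunit n).

Lemma zunit_coprime n : zunit n = coprime s n :> bool.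
Proof.
rewrite -unitZpE// /zunit; case: insubP => [u -> _//|/negbTE ->//].
Qed.

Lemma zunit_some n u : zunit n = Some u -> val u = n%:R.
Proof. by rewrite /zunit; case: insubP => // v _ <- [->]. Qed.

Lemma zunit_val (n : nat) (u : gT) : val u = n%:R -> zunit n = Some u.
Proof. by move=> un; rewrite /zunit -un valK. Qed.

Lemma zunitM m n : zunit (m * n) =
  if zunit m is Some u then if zunit n is Some v then Some (u * v)%g else None else None.
Proof.
have := zunit_coprime (m * n); rewrite coprimeMr -!zunit_coprime.
case Em: (zunit m) => [u|] /=; last by case: zunit.
case En: (zunit n) => [v|] /=; last by case: zunit.
by move=> _; apply: zunit_val; rewrite /= (zunit_some Em) (zunit_some En) natrM.
Qed.

Lemma zunit1 : zunit 1 = Some 1%g.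
Proof. exact: zunit_val. Qed.

Lemma zunit_mod m n : (m = n %[mod s])%N -> zunit m = zunit n.
Proof.
move=> mn; rewrite /zunit; congr insub.
by apply/ord_inj; rewrite !val_Zp_nat.
Qed.

Lemma dchar1 h : h \in dual gT -> dchar h 1 = 1.
Proof. by move=> hd; rewrite /dchar zunit1/= dual_eval1. Qed.

Lemma dcharM h m n : h \in dual gT -> dchar h (m * n) = dchar h m * dchar h n.
Proof.
move=> hd; rewrite /dchar zunitM.
case: (zunit m) => [u|] /=; last by rewrite mul0r.
case: (zunit n) => [v|] /=; last by rewrite mulr0.
by rewrite dual_evalM.
Qed.

Lemma dcharD h k n : dchar (h + k) n = dchar h n * dchar k n.
Proof. by rewrite /dchar; case: zunit => [u|] /=; rewrite ?mul0r ?dual_evalD. Qed.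

Lemma cmod_w : cmod w = 1.
Proof.
apply/eqP; rewrite -(@pexpr_eq1 _ _ N)// ?cmod_ge0//.
by rewrite -cmodX (prim_expr_order pw) cmod1.
Qed.

Lemma cmod_eval (h : {ffun gT -> 'I_N}) x : cmod (dual_eval w h x) = 1.
Proof. by rewrite cmodX cmod_w expr1n. Qed.

Lemma cmod_dchar h n : cmod (dchar h n) <= 1.
Proof. by rewrite /dchar; case: zunit => [u|] /=; rewrite ?cmod0// cmod_eval. Qed.

Lemma dchar_period h : h \in dual gT -> h != 0 -> \sum_(0 <= n < s) dchar h n = 0.
Proof.
move=> hd h0; have := sum_dual_group pw hd; rewrite (negbTE h0) => S; rewrite -[RHS]S.
rewrite -[X in \sum_(0 <= _ < X) _](Zp_cast s1) big_mkord.
pose F (x : 'Z_s) := oapp (dual_eval w h) 0 (insub x : option gT).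
rewrite (eq_bigr F) => [|i _]; last by rewrite /F /dchar /zunit natr_Zp.
rewrite (bigID (fun x : 'Z_s => x \is a GRing.unit))/= [X in _ + X]big1 ?addr0; last first.
  by move=> x xu; rewrite /F insubN.
rewrite (reindex_omap (fun u : gT => val u) (insub : 'Z_s -> option gT)) /=; last first.
  by move=> x xu; rewrite insubT.
apply: eq_big => [u|u _]; first by rewrite (valP u) valK eqxx.
by rewrite /F valK.
Qed.

Lemma dchar_sum_prefix h b : h \in dual gT -> h != 0 ->
  cmod (\sum_(0 <= n < b) dchar h n) <= s%:R.
Proof.
move=> hd h0; have s0 : (0 < s)%N by apply: ltn_trans s1.
elim/ltn_ind: b => b IH; have [bs|sb] := leqP b s.
  apply: le_trans (cmod_sum _ _ _) _.
  apply: (@le_trans _ _ (\sum_(0 <= n < b) 1)).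
    by apply: ler_sum => n _; exact: cmod_dchar.
  by rewrite sumr_const_nat subn0 ler_nat.
rewrite (@big_cat_nat _ _ _ s)//= 1?ltnW// dchar_period// add0r.
rewrite -{1}[s]add0n big_addn.
rewrite (eq_bigr (dchar h)); first by apply: IH; rewrite ltn_subrL s0 (ltn_trans s0).
by move=> i _; rewrite /dchar (@zunit_mod (i + s) i)// modnDr.
Qed.

Lemma dchar_almost_periodic h : h \in dual gT -> h != 0 -> almost_periodic s (dchar h).
Proof.
move=> hd h0; split; [exact: dchar1|by move=> m n; exact: dcharM|exact: cmod_dchar|].
move=> a b; have [ba|ab] := leqP b a.
  by rewrite big_geq// cmod0 mulr_ge0.
have -> : \sum_(a <= n < b) dchar h n = \sum_(0 <= n < b) dchar h n - \sum_(0 <= n < a) dchar h n.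
  by rewrite [X in X - _](@big_cat_nat _ _ _ a)//= ?(ltnW ab)// [RHS]addrAC subrr add0r.
apply: le_trans (cmodB _ _) _; rewrite mulr2n mulrDl mul1r.
by apply: lerD; exact: dchar_sum_prefix.
Qed.

Lemma dchar_orthogonality a n ua : zunit a = Some ua ->
  \sum_(h in dual gT) dual_eval w h (ua^-1)%g * dchar h n =
  if (n == a %[mod s])%N then (totient s)%:R else 0.
Proof.
move=> Ea; rewrite /dchar; case En: (zunit n) => [un|] /=; last first.
  rewrite big1 => [|h _]; last by rewrite mulr0.
  case: eqP => // /zunit_mod; rewrite En Ea => //.
rewrite (eq_bigr (fun h => dual_eval w h (ua^-1 * un)%g)); last by move=> h hd; rewrite dual_evalM.
rewrite (sum_dual abT pw) (card_dual abT pw (@pnatr_eq0 C)) card_unitZ.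
congr (if _ then _ else _); apply/idP/idP => [|/eqP/zunit_mod].
  rewrite -eq_mulVg1 => /eqP E; move: En Ea => /zunit_some En /zunit_some Ea.
  by have := congr1 (@nat_of_ord _) En; rewrite -E Ea !val_Zp_nat// => ->.
by rewrite En Ea => -[->]; rewrite mulVg.
Qed.

Lemma dchar_real h n : h + h = 0 -> h \in dual gT ->
  [|| dchar h n == 0, dchar h n == 1 | dchar h n == -1].
Proof.
move=> h2 hd; have : dchar h n = 0 \/ dchar h n ^+ 2 = 1.
  rewrite /dchar; case: zunit => [u|] /=; last by left.
  by right; rewrite expr2 -(dual_evalD pw) h2 /dual_eval ffunE expr0.
case=> [->|/eqP]; first by rewrite eqxx.
by rewrite sqrf_eq1 => /orP[->|->]; rewrite ?orbT.
Qed.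

End DirichletCharacters.

(** * Mertens estimates in progressions *)

Section MertensAP.
Variable R : realType.
Local Notation C := R[i].
Local Notation Lam := (mangoldt R).
Local Notation unitZ s := ({unit 'Z_s} : finGroupType).

Lemma add1_ln_ge1 (s : nat) : 1 <= 1 + ln s%:R :> R.
Proof. by rewrite lerDl ln_nat_ge0. Qed.

(* [h + h = 0] singles out the real characters. *)
Lemma dchar_mangoldt_twist_le : exists2 K : R, 0 < K & forall s (w : C)
    (h : {ffun unitZ s -> 'I_#|unitZ s|.-1.+1}) N, (1 < s)%N ->
  #|unitZ s|.-1.+1.-primitive_root w -> h \in dual _ -> h != 0 -> (0 < N)%N ->
  cmod (mangoldt_twist (dchar w h) N) <= K * (1 + ln s%:R) ^+ 9 +
    (if h + h == 0 then K * s%:R * (1 + ln s%:R) ^+ 2 else 0).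
Proof.
have [k k0 Hk] := L_lower_complex R.
(* One summand for each kind of character: the bound 133 l^2 of [L_mangoldt_twist_le] divided by the
   lower bound k/l^7, respectively 1/(128 s). *)
pose K := 133 / k + 133 * 128.
have ik : 0 < 133 / k by rewrite divr_gt0.
have K0 : 0 < K by rewrite addr_gt0.
exists K => // s w h N s1 pw hd h0 N0.
have s0 : (0 < s)%N by exact: ltn_trans s1.
have s0' : 0 < s%:R :> R by rewrite ltr0n.
have AP := dchar_almost_periodic s1 pw hd h0.
have [L HL] := L_exists AP (lexx 0).
have LT := L_mangoldt_twist_le s0 AP N0 HL.
have l1 := add1_ln_ge1 s; set l := 1 + _ in l1 LT *.
have lp n : 0 <= l ^+ n by rewrite exprn_ge0//; lra.
set T := cmod (mangoldt_twist _ _) in LT *.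
have T0 : 0 <= T by exact: cmod_ge0.
case: eqP => h2.
  have rE : (fun n => toC (complex.Re (dchar w h n))) = dchar w h.
    apply/funext => n; have := dchar_real pw n h2 hd.
    case/or3P => /eqP ->; first exact: (rmorph0 (@toC R)).
      exact: (rmorph1 (@toC R)).
    exact: (rmorphN1 (@toC R)).
  have := @L_lower_real R s (fun n => complex.Re (dchar w h n)) L s0.
  rewrite rE => /(_ _ AP HL) H.
  have {}H : 1 <= cmod L * (128 * s%:R).
    apply: H => n; have := dchar_real pw n h2 hd.
    by case/or3P => /eqP ->; rewrite ?eqxx ?orbT//= oppr0 eqxx ?orbT.
  have : T <= 133 * 128 * s%:R * l ^+ 2.
    have := ler_wpM2l T0 H; rewrite mulr1 => /le_trans; apply.
    have := ler_wpM2r (mulr_ge0 (ler0n R 128) (ltW s0')) LT.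
    move: (cmod L) (l ^+ 2) => x y; lra.
  have : 133 * 128 * s%:R * l ^+ 2 <= K * s%:R * l ^+ 2.
    by rewrite ler_wpM2r// ler_wpM2r ?ler0n// /K; lra.
  have : 0 <= K * l ^+ 9 by rewrite mulr_ge0// ltW.
  lra.
have AP2 : almost_periodic s (fun n => dchar w h n ^+ 2).
  have -> : (fun n => dchar w h n ^+ 2) = dchar w (h + h).
    by apply/funext => n; rewrite (dcharD pw) expr2.
  by apply: (dchar_almost_periodic s1 pw); [exact: dualD|exact/eqP].
have H := Hk s _ L s0 AP AP2 HL; rewrite -/l in H.
rewrite addr0; apply: (@le_trans _ _ (133 / k * l ^+ 9)); last first.
  by rewrite ler_wpM2r// /K; lra.
rewrite -ler_pdivrMl// invf_div mulrAC ler_pdivrMr// mulrC.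
have := ler_wpM2l T0 H; have := ler_wpM2r (lp 7%N) LT.
have -> : l ^+ 9 = l ^+ 2 * l ^+ 7 by rewrite -exprD.
move: (cmod L) (l ^+ 2) (l ^+ 7) => x y z; lra.
Qed.

Lemma totient_ge p k : prime p -> (0 < k)%N -> (p ^ k <= 2 * totient (p ^ k))%N.
Proof.
move=> pp k0; rewrite totient_pfactor//; case: k k0 => // k _ /=.
rewrite expnS mulnA leq_mul2r; apply/orP; right.
by have := prime_gt1 pp; lia.
Qed.

(** Orthogonality expresses phi(s) times the sum as a sum over characters; the trivial one gives log
    N + O(1). The real ones cost O(s log^2 s) altogether, and s <= 2 phi(s) for a prime power. *)
Lemma mertens_ap : exists2 K : R, 0 < K & forall p k a N, prime p -> (0 < k)%N ->
  coprime (p ^ k) a -> (0 < N)%N ->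
  `|\sum_(1 <= n < N.+1 | prime n && (n == a %[mod p ^ k])%N) ln n%:R / n%:R
    - ln N%:R / (totient (p ^ k))%:R| <= K * (1 + ln (p ^ k)%:R) ^+ 9.
Proof.
have [K K0 HK] := dchar_mangoldt_twist_le.
have [C2 C20 HC2] := sum_mangoldt_nonprime_bounded R.
exists (K + C2 + (8 * K + 4 * C2) + (7 + C2)); first by lra.
move=> p k a N pp k0 sa N0; set s := (p ^ k)%N in sa *.
have s1 : (1 < s)%N by rewrite -(expn0 p) ltn_exp2l ?prime_gt1.
have s0 : (0 < s)%N by exact: ltn_trans s1.
have s0' : 0 < s%:R :> R by rewrite ltr0n.
pose gT : finGroupType := {unit 'Z_s}.
have cT : #|gT| = totient s by exact: card_unitZ.
have phi0 : (0 < totient s)%N by rewrite totient_gt0.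
have phi1 : 1 <= (totient s)%:R :> R by rewrite ler1n.
have [w pw] : exists w : C, #|gT|.-1.+1.-primitive_root w.
  by apply: prim_root_exists => //; rewrite pnatr_eq0.
have [ua Ea] : exists ua, zunit s a = Some ua :> option gT.
  by have := zunit_coprime s1 a; rewrite sa; case: (zunit s a) => // ua _; exists ua.
set phi := (totient s)%:R in phi1 *.
have phip : 0 < phi by lra.
have l1 := add1_ln_ge1 s; set l := 1 + _ in l1 *.
have l9 : 1 <= l ^+ 9 by rewrite exprn_ege1.
have l29 : l ^+ 2 <= l ^+ 9 by rewrite ler_weXn2l.
pose T' (h : {ffun gT -> 'I_#|gT|.-1.+1}) := \sum_(1 <= n < N.+1 | prime n) toC (ln n%:R / n%:R) * dchar w h n.
(* Passing from prime powers to primes costs C2 per character, which the final division by phi(s)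
   absorbs. *)
have T'T h : cmod (T' h) <= cmod (mangoldt_twist (dchar w h) N) + C2.
  have -> : T' h = mangoldt_twist (dchar w h) N -
      \sum_(1 <= n < N.+1 | ~~ prime n) toC (Lam n / n%:R) * dchar w h n.
    rewrite /mangoldt_twist [X in X - _](bigID prime)/= addrK.
    by apply: eq_bigr => n pn; rewrite mangoldt_prime.
  apply: le_trans (cmodB _ _) _; rewrite lerD2l; apply: le_trans (HC2 N).
  apply: le_trans (cmod_sum _ _ _) _; apply: ler_sum => n _.
  have q0 : 0 <= Lam n / n%:R by rewrite divr_ge0 ?mangoldt_ge0.
  by rewrite cmod_toCM ger0_norm// ler_piMr// (cmod_dchar pw).
set M := \sum_(_ <= _ < _ | _) _.
have ME : toC (phi * M) = \sum_(h in dual gT) dual_eval w h (ua^-1)%g * T' h.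
  rewrite /M big_distrr/= (rmorph_sum (@toC R)) big_mkcondr/=.
  under [RHS]eq_bigr do rewrite big_distrr/=.
  rewrite [RHS]exchange_big/=; apply: eq_bigr => n pn.
  transitivity (toC (ln n%:R / n%:R) * \sum_(h in dual gT) dual_eval w h (ua^-1)%g * dchar w h n).
    rewrite (dchar_orthogonality s1 pw n Ea); case: ifP => _; last by rewrite mulr0.
    by rewrite mulrC (rmorphM (@toC R)) /phi (rmorph_nat (@toC R)).
  by rewrite big_distrr/=; apply: eq_bigr => h _; rewrite mulrCA.
pose S0 := \sum_(1 <= n < N.+1 | prime n && coprime s n) ln n%:R / n%:R : R.
have T0E : T' 0 = toC S0.
  rewrite /T' /S0 (rmorph_sum (@toC R)) big_mkcondr/=; apply: eq_bigr => n _.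
  rewrite /dchar -(zunit_coprime s1); case: zunit => [u|] /=; last by rewrite mulr0.
  by rewrite /dual_eval ffunE expr0 mulr1.
have S0B : `|S0 - ln N%:R| <= 7 + C2.
  have := mertens1 R N0; rewrite (bigID prime)/= (bigID (fun n => coprime s n))/=.
  set A := \sum_(_ <= _ < _ | _ && coprime _ _) _.
  set B := \sum_(_ <= _ < _ | _ && ~~ _) _; set D := \sum_(_ <= _ < _ | ~~ _) _.
  have -> : A = S0 by apply: eq_bigr => n /andP[pn _]; rewrite mangoldt_prime.
  have B0 : 0 <= B by apply: sumr_ge0 => n _; rewrite divr_ge0 ?mangoldt_ge0.
  have D0 : 0 <= D by apply: sumr_ge0 => n _; rewrite divr_ge0 ?mangoldt_ge0.
  have D1 : D <= C2 by exact: HC2.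
  (* The only prime not coprime to s = p^k is p itself, and log p/p <= 1. *)
  have B1 : B <= 1.
    apply: (@le_trans _ _ (\sum_(1 <= n < N.+1) if n == p then ln p%:R / p%:R else 0)).
      rewrite /B big_mkcond/=; apply: ler_sum => n _.
      have pp0 : 0 <= ln p%:R / p%:R :> R by rewrite divr_ge0 ?ln_nat_ge0.
      case: ifP => [/andP[pn]|_]; last by case: ifP.
      rewrite /s coprime_pexpl// prime_coprime// negbK.
      by rewrite dvdn_prime2// => /eqP <-; rewrite eqxx mangoldt_prime.
    rewrite -big_mkcond/= big_const_seq.
    have : (count (fun n => n == p) (index_iota 1 N.+1) <= 1)%N.
      by rewrite (count_uniq_mem p (iota_uniq _ _)) leq_b1.
    have pl : ln p%:R / p%:R <= 1 :> R.
      by rewrite ler_pdivrMr ?ltr0n ?prime_gt0// mul1r ln_nat_le.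
    by case: count => [|[|]]//= _; rewrite ?ler01 ?addr0.
  by rewrite !ler_norml => /andP[U V]; apply/andP; split; clear -B0 D0 D1 B1 U V; lra.
have ev1 (h : {ffun gT -> 'I_#|gT|.-1.+1}) x : cmod (dual_eval w h x) = 1 by exact: cmod_eval.
have l0 : 0 <= l by exact: le_trans ler01 l1.
have P2 : 0 <= K * s%:R * l ^+ 2.
  exact: mulr_ge0 (mulr_ge0 (ltW K0) (ltW s0')) (exprn_ge0 _ l0).
have P9 : 0 <= K * l ^+ 9 by exact: mulr_ge0 (ltW K0) (exprn_ge0 _ l0).
(* Every nontrivial character is charged l^9; the real ones, at most [nb_roots s 2] <= 4 in number,
   are charged s l^2 in addition. *)
have rest : cmod (\sum_(h in dual gT | h != 0) dual_eval w h (ua^-1)%g * T' h) <=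
    phi * (K * l ^+ 9 + C2) + 4 * (K * s%:R * l ^+ 2 + C2).
  apply: le_trans (cmod_sum _ _ _) _.
  apply: (@le_trans _ _ (\sum_(h in dual gT) (K * l ^+ 9 + C2) +
      \sum_(h in real_dual gT) (K * s%:R * l ^+ 2 + C2))); last first.
    have cD : #|dual gT| = totient s.
      by rewrite -cT; exact: (card_dual (units_Zp_abelian s) pw (@pnatr_eq0 C)).
    rewrite !sumr_const cD.
    rewrite -[X in X + _ <= _]mulr_natl -[X in _ + X <= _]mulr_natl lerD2l.
    apply: ler_wpM2r; first exact: addr_ge0 P2 (ltW C20).
    have := card_real_dual (units_Zp_abelian s) pw (@pnatr_eq0 C).
    by rewrite (ler_nat R _ 4) => /leq_trans; apply; exact: (@nb_roots_le p k 2).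
  rewrite big_mkcondr [X in _ <= _ + X]big_mkcond/=.
  rewrite [X in _ <= _ + X](_ : _ = \sum_(h in dual gT) if h + h == 0 then K * s%:R * l ^+ 2 + C2 else 0); last first.
    by rewrite [RHS]big_mkcond/=; apply: eq_bigr => h _; rewrite finset.in_set; case: (h \in dual gT).
  rewrite -big_split/=; apply: ler_sum => h hd.
  case: ifP => h0; last first.
    apply: addr_ge0; first exact: addr_ge0 P9 (ltW C20).
    by case: ifP => // _; exact: addr_ge0 P2 (ltW C20).
  rewrite cmodM ev1 mul1r; apply: le_trans (T'T h) _.
  have := HK s w h N s1 pw hd h0 N0; rewrite -/l.
  move: (cmod _) => m; clear -C20 P2 P9; case: ifP => _; lra.
have main : `|phi * M - ln N%:R| <= phi * (K * l ^+ 9 + C2) + 4 * (K * s%:R * l ^+ 2 + C2) + (7 + C2).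
  have toCB (x y : R) : toC (x - y) = toC x - toC y by exact: (rmorphB (@toC R)).
  rewrite -cmod_toC toCB ME (bigD1 (0 : {ffun gT -> 'I_#|gT|.-1.+1}))/=; last exact: dual0.
  have -> : dual_eval w 0 (ua^-1)%g = 1 by rewrite /dual_eval ffunE expr0.
  rewrite mul1r T0E addrAC -toCB addrC.
  by apply: le_trans (cmodD _ _) (lerD rest _); rewrite cmod_toC.
rewrite -(ler_pM2l phip) -{1}[phi]gtr0_norm// -normrM mulrBr [phi * (_ / phi)]mulrC divfK ?gt_eqF//.
apply: le_trans main _.
have s2 : s%:R <= 2 * phi by rewrite -(natrM _ 2) ler_nat totient_ge.
have E1 : K * s%:R * l ^+ 2 <= K * (2 * phi) * l ^+ 9.
  apply: ler_pM => //; first by rewrite mulr_ge0 ?ler0n// ltW.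
    exact: exprn_ge0.
  by rewrite ler_pM2l.
have E2 : 1 <= phi * l ^+ 9 by rewrite -[leLHS]mulr1 ler_pM.
have E3 : phi <= phi * l ^+ 9 by rewrite ler_peMr// ltW.
have E4 : C2 * phi <= C2 * (phi * l ^+ 9) by rewrite ler_pM2l.
have E5 : C2 * 1 <= C2 * (phi * l ^+ 9) by rewrite ler_pM2l.
move: E1 E2 E4 E5; clear; move: (l ^+ 9) (l ^+ 2) phi (s%:R) => y z f t; lra.
Qed.

End MertensAP.

(** * Reciprocals of primes in progressions *)

Section ReciprocalsAP.
Variable R : realType.

(** Compares the integral of 1/t from u to v with the rectangle at its right end. The error is at
    most (v - u) (1/u - 1/v), and v - u <= 1 makes it telescope. *)
Lemma ln_ln_diff (n : nat) : (2 <= n)%N ->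
  let u : R := ln n%:R in let v : R := ln n.+1%:R in
  0 <= ln v - ln u - (v - u) / v <= u^-1 - v^-1.
Proof.
move=> n2 /=; have n0 : (0 < n)%N by exact: ltn_trans n2.
have d1 : ln n.+1%:R - ln n%:R <= 1 :> R.
  apply: le_trans (ln_succ_le R n0) _; by rewrite invf_le1 ?ltr0n ?ler1n.
have u0 : 0 < ln n%:R :> R by rewrite ln_gt0// ltr1n.
have uv : ln n%:R <= ln n.+1%:R :> R by rewrite ler_ln ?posrE ?ltr0n// ler_nat.
move: d1 u0 uv; move: (ln n%:R) (ln n.+1%:R) => u v d1 u0 uv.
have v0 : 0 < v by lra.
have H1 : ln u - ln v <= u / v - 1.
  rewrite -ln_div ?posrE//; have := @le_ln1Dx R (u / v - 1).
  by rewrite addrCA subrr addr0; apply; rewrite ltrBrDr addNr divr_gt0.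
have H2 : ln v - ln u <= v / u - 1.
  rewrite -ln_div ?posrE//; have := @le_ln1Dx R (v / u - 1).
  by rewrite addrCA subrr addr0; apply; rewrite ltrBrDr addNr divr_gt0.
have E1 : (v - u) / v = 1 - u / v by rewrite mulrBl divff ?gt_eqF.
have E2 : v / u - 1 - (1 - u / v) = (v - u) * (u^-1 - v^-1).
  by field; rewrite !gt_eqF.
have H3 : (v - u) * (u^-1 - v^-1) <= u^-1 - v^-1.
  by rewrite ler_piMl// subr_ge0 lef_pV2.
by rewrite E1; apply/andP; split; lra.
Qed.

(** The increments of g are those of c log n plus those of the error [e]. The latter meet the
    decreasing weights 1/log n through Abel's inequality, with 2E for the two ends; the former give
    log log up to 1/log y. *)
Lemma partial_summation (g : nat -> R) (E c : R) y N : (2 <= y)%N -> (y <= N)%N ->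
  0 <= c ->
  (forall n, (0 < n)%N -> `|\sum_(1 <= m < n.+1) g m - c * ln n%:R| <= E) ->
  `|\sum_(y.+1 <= n < N.+1) g n / ln n%:R - c * (ln (ln N%:R) - ln (ln y%:R))|
    <= (2 * E + c) / ln y%:R.
Proof.
move=> y2 yN c0 HE; have y0 : (0 < y)%N by exact: ltn_trans y2.
pose e n := \sum_(1 <= m < n.+1) g m - c * ln n%:R.
have gE n : (y < n)%N -> g n = (e n - e n.-1) + c * (ln n%:R - ln n.-1%:R).
  move=> yn; have n1 : (0 < n.-1)%N by rewrite -ltnS prednK ?(ltn_trans y0)// (leq_trans y2)// ltnW.
  rewrite /e prednK ?(leq_ltn_trans (leq0n y))//.
  by rewrite [\sum_(1 <= _ < n.+1) _]big_nat_recr/= ?(ltn_trans y0)//; ring.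
rewrite (eq_big_nat _ _ (F2 := fun n => (ln n%:R)^-1 * (e n - e n.-1) +
   c * ((ln n%:R - ln n.-1%:R) / ln n%:R))); last first.
  by move=> n /andP[yn _]; rewrite [in LHS](gE n yn); ring.
rewrite big_split/= -big_distrr/=.
have ly : 0 < ln y%:R :> R by rewrite ln_gt0// ltr1n.
have P1 : `|\sum_(y.+1 <= n < N.+1) (ln n%:R)^-1 * (e n - e n.-1)| <= 2 * E / ln y%:R.
  rewrite -cmod_toC (rmorph_sum (@toC R)).
  rewrite (eq_bigr (fun n => toC (ln n%:R)^-1 * toC (e n - e n.-1))); last first.
    by move=> n _; rewrite (rmorphM (@toC R)).
  have E0 : 0 <= E by apply: le_trans (HE 1%N isT).
  have lpos n : (y < n)%N -> 0 < ln n%:R :> R.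
    by move=> yn; rewrite ln_gt0// ltr1n (leq_trans y2)// ltnW.
  apply: (@le_trans _ _ (2 * E * (ln y.+1%:R)^-1)).
    apply: abel_bound.
    - move=> n yn; have l1 := lpos n yn; have l2 := lpos n.+1 (ltnW yn).
      by rewrite invr_ge0 ltW//= lef_pV2 ?posrE// ler_ln ?posrE ?ltr0n ?ler_nat// (ltn_trans y0).
    - move=> n; rewrite -(rmorph_sum (@toC R)) cmod_toC.
      have [ny|yn] := leqP n y.+1; first by rewrite big_geq// normr0 mulr_ge0.
      have -> : \sum_(y.+1 <= k < n) (e k - e k.-1) = e n.-1 - e y.
        case: n yn => // n; rewrite ltnS => yn.
        by rewrite big_add1/= (telescope_sumr e)// ltnW.
      apply: le_trans (ler_normB _ _) _; rewrite mulr2n mulrDl mul1r.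
      by apply: lerD; apply: HE => //; case: n yn => // n; rewrite ltnS => /(leq_ltn_trans (leq0n _)).
    - by rewrite invr_ge0 ltW// lpos.
  apply: ler_wpM2l; first by rewrite mulr_ge0.
  have l2 : 0 < ln y.+1%:R :> R by exact: lpos.
  by rewrite lef_pV2 ?posrE// ler_ln ?posrE ?ltr0n ?ler_nat.
have P2 : `|\sum_(y.+1 <= n < N.+1) (ln n%:R - ln n.-1%:R) / ln n%:R - (ln (ln N%:R) - ln (ln y%:R))| <= (ln y%:R)^-1 :> R.
  rewrite big_add1/= distrC.
  rewrite -(telescope_sumr (fun n => ln (ln n%:R)) yN) -sumrB.
  have term n : (y <= n)%N -> (2 <= n)%N by exact: leq_trans.
  rewrite ger0_norm; last first.
    rewrite big_nat sumr_ge0// => n /andP[yn _].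
    by have /andP[] := ln_ln_diff (term n yn).
  apply: (@le_trans _ _ (\sum_(y <= n < N) (- (ln n.+1%:R)^-1 - - (ln n%:R)^-1))).
    rewrite ler_sum_nat// => n /andP[yn _].
    by have /andP[_ h] := ln_ln_diff (term n yn); rewrite opprK [leRHS]addrC.
  rewrite (telescope_sumr (fun n => - (ln n%:R)^-1))// opprK addrC gerBl invr_ge0.
  exact: ln_nat_ge0.
rewrite -addrA -mulrBr mulrDl; apply: le_trans (ler_normD _ _) _.
by rewrite normrM ger0_norm// lerD// ler_wpM2l.
Qed.

(** For n > s one has n = q s + (a mod s) with q >= 1, hence 1/n <= 1/(q s). Starting above s
    excludes the possibly tiny least representative. *)
Lemma sum_inv_ap_le s a N : (0 < s)%N -> (0 < N)%N ->
  \sum_(s.+1 <= n < N.+1 | (n == a %[mod s])%N) n%:R^-1 <= (1 + ln N%:R) / s%:R :> R.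
Proof.
move=> s0 N0; have s0' : 0 < s%:R :> R by rewrite ltr0n.
apply: (@le_trans _ _ (\sum_(1 <= q < N.+1) (s%:R * q%:R)^-1)); last first.
  rewrite (eq_bigr (fun q => s%:R^-1 * q%:R^-1)) => [|q _]; last by rewrite invfM.
  by rewrite -big_distrr/= mulrC ler_wpM2r ?invr_ge0 ?ler0n// sum_inv_le.
apply: (@le_trans _ _ (\sum_(s.+1 <= n < N.+1) \sum_(1 <= q < N.+1 | (q * s + a %% s == n)%N) (s%:R * q%:R)^-1)).
  rewrite big_mkcond/= ler_sum_nat// => n /andP[sn nN].
  have S0 : 0 <= \sum_(1 <= q < N.+1 | (q * s + a %% s == n)%N) (s%:R * q%:R)^-1 :> R.
    by apply: sumr_ge0 => q _; rewrite invr_ge0 mulr_ge0.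
  case: ifP => // /eqP na.
  have nE : (n %/ s * s + a %% s = n)%N by rewrite -na -divn_eq.
  have q0 : (0 < n %/ s)%N by rewrite divn_gt0// ltnW.
  rewrite (big_rem (n %/ s)%N)/=; last first.
    by rewrite mem_index_iota q0 ltnS (leq_trans (leq_div _ _)).
  rewrite nE eqxx -[leLHS]addr0 lerD//; last first.
    by apply: sumr_ge0 => q _; rewrite invr_ge0 mulr_ge0.
  rewrite lef_pV2 ?posrE ?mulr_gt0 ?ltr0n ?(leq_ltn_trans _ sn)//.
  by rewrite -natrM ler_nat mulnC leq_trunc_div.
rewrite (exchange_big_dep_nat xpredT)//=; apply: ler_sum => q _.
rewrite big_mkcond.
have q0 : 0 <= (s%:R * q%:R)^-1 :> R by rewrite invr_ge0 mulr_ge0.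
have [kN|kN] := boolP (q * s + a %% s \in index_iota s.+1 N.+1)%N.
  rewrite (bigD1_seq (q * s + a %% s)%N) ?iota_uniq//= eqxx big1 ?addr0// => i ik.
  by rewrite eq_sym (negbTE ik).
rewrite big1_seq// => i /andP[_ iN]; case: eqP => // E; rewrite -E in iN.
by rewrite iN in kN.
Qed.

Lemma recip_primes_ap : exists2 K : R, 0 < K & forall p k a N, prime p -> (0 < k)%N ->
  coprime (p ^ k) a -> (4 <= N)%N ->
  `|\sum_((p ^ k).+1 <= n < N.+1 | prime n && (n == a %[mod p ^ k])%N) n%:R^-1
    - ln (ln N%:R) / (totient (p ^ k))%:R|
  <= K * (1 + ln (p ^ k)%:R) ^+ 9 / Num.sqrt (p ^ k)%:R.
Proof.
have [K K0 HK] := mertens_ap R; exists (8 + 2 * K); first by lra.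
move=> p k a N pp k0 sa N4.
have N0 : (0 < N)%N by exact: leq_trans N4.
have HA n : (0 < n)%N -> _ := HK p k a n pp k0 sa.
have := totient_ge pp k0.
have s1 : (1 < p ^ k)%N by rewrite -(expn0 p) ltn_exp2l ?prime_gt1.
move: (p ^ k)%N s1 sa HA => s s1 sa HA s2.
have s0 : (0 < s)%N by exact: ltn_trans s1.
have s0' : 1 <= s%:R :> R by rewrite ler1n.
have sp : 0 < s%:R :> R by lra.
set q := Num.sqrt s%:R; have q1 : 1 <= q by rewrite -sqrtr1 ler_wsqrtr.
have q0 : 0 < q by lra.
have qq : q * q = s%:R by rewrite -expr2 sqr_sqrtr// ler0n.
have l1 := add1_ln_ge1 R s; set l := 1 + _ in l1 HA *.
have l9 : 1 <= l ^+ 9 by rewrite exprn_ege1.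
have phi0 : 0 < (totient s)%:R :> R by rewrite ltr0n totient_gt0.
have iphi : (totient s)%:R^-1 <= 2 / s%:R :> R.
  rewrite ler_pdivlMr// mulrC ler_pdivrMr// -natrM ler_nat//.
set c := (totient s)%:R^-1 in iphi *.
have c0 : 0 <= c by rewrite invr_ge0 ltW.
have qs : q / s%:R = q^-1 by rewrite -qq; field; rewrite gt_eqF.
have s_le : s%:R^-1 <= q^-1 by rewrite lef_pV2 ?posrE// -qq ler_peMl// ltW.
have iq0 : 0 < q^-1 by rewrite invr_gt0.
(* The factor 2 in the threshold exp(2 q) ensures, by this inequality, that the threshold lies
   beyond s. *)
have lnsq : ln s%:R <= 2 * q.
  by rewrite -qq lnM ?posrE//; have := ln_sublinear q0; lra.
have lnln_le (M : nat) : 1 <= ln M%:R :> R -> ln M%:R <= 2 * q ->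
    0 <= ln (ln M%:R) * c <= 4 * q^-1.
  move=> M1 M2; rewrite mulr_ge0 ?ln_ge0//=.
  have h1 : ln (ln M%:R) <= 2 * q by apply: le_trans M2; rewrite ltW// ln_sublinear//; lra.
  have := ler_pM (ln_ge0 M1) c0 h1 iphi => /le_trans; apply.
  by rewrite -qs le_eqVlt; apply/orP; left; apply/eqP; ring.
have triv (M : nat) : (0 < M)%N -> ln M%:R <= 2 * q ->
    (0 : R) <= \sum_(s.+1 <= n < M.+1 | prime n && (n == a %[mod s])%N) n%:R^-1 <= 3 * q^-1.
  move=> M0 M2; rewrite sumr_ge0//=.
  apply: (@le_trans _ _ ((1 + ln M%:R) / s%:R)).
    apply: le_trans (sum_inv_ap_le a s0 M0).
    rewrite big_mkcondl/= ; apply: ler_sum => n _.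
    by case: ifP => // _; rewrite invr_ge0.
  apply: (@le_trans _ _ ((3 * q) / s%:R)); last by rewrite -mulrA qs.
  by rewrite ler_wpM2r ?invr_ge0 ?(ltW sp)//; lra.
have ln4 : 1 <= ln 4%:R :> R.
  have -> : 4%:R = 2 * 2 :> R by rewrite -natrM.
  rewrite lnM ?posrE//; have := @ln_succ_ge R 1 isT; rewrite ln1; lra.
have lnN1 : 1 <= ln N%:R :> R.
  by apply: le_trans ln4 _; rewrite ler_ln ?posrE ?ltr0n// ler_nat.
(* 8 = 3 + 4 + 1: the primes up to y, the term log log y/phi(s), and c/log y from partial summation;
   the Mertens error supplies 2 K l^9/q. *)
have rhs : 8 * q^-1 + 2 * K * l ^+ 9 / q <= (8 + 2 * K) * l ^+ 9 / q.
  have : 8 * q^-1 * 1 <= 8 * q^-1 * l ^+ 9 by rewrite ler_wpM2l// mulr_ge0// ltW.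
  by move: (q^-1) (l ^+ 9) => u v; lra.
have l90 : 0 <= l ^+ 9 by exact: le_trans ler01 l9.
have Kl : 0 <= 2 * (K * l ^+ 9) by exact: mulr_ge0 (ler0n _ 2) (mulr_ge0 (ltW K0) l90).
have Kq : 0 <= 2 * K * l ^+ 9 / q.
  by rewrite -(mulrA 2); exact: mulr_ge0 Kl (ltW iq0).
have [NA|NB] := leP (ln N%:R) (2 * q).
  have /andP[A1 A2] := lnln_le N lnN1 NA; have /andP[B1 B2] := triv N N0 NA.
  apply: le_trans rhs; rewrite ler_norml; apply/andP; split; lra.
pose y := Num.truncn (expR (2 * q)).
have y_le : y%:R <= expR (2 * q) by rewrite truncn_le// expR_ge0.
have y_gt : expR (2 * q) < y.+1%:R by exact: truncnS_gt.
have e3 : 3 <= expR (2 * q) by have := expR_ge1Dx (2 * q); lra.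
have y2 : (2 <= y)%N by rewrite -ltnS -(ltr_nat R) (le_lt_trans _ y_gt)//; lra.
have y0 : (0 < y)%N by exact: leq_trans y2.
have y0' : 0 < y%:R :> R by rewrite ltr0n.
have lny : ln y%:R <= 2 * q by rewrite -[leRHS]expRK ler_ln ?posrE ?expR_gt0.
have lny2 : 2 * q < ln y.+1%:R by rewrite -[ltLHS]expRK ltr_ln ?posrE ?expR_gt0 ?ltr0n.
have lny3 : q <= ln y%:R.
  have := ln_succ_le R y0.
  have : y%:R^-1 <= 2^-1 :> R by rewrite lef_pV2 ?posrE// ler_nat.
  move: (y%:R^-1) => u; lra.
have sy : (s <= y)%N.
  rewrite -ltnS -(ltr_nat R) (le_lt_trans _ y_gt)//.
  by rewrite -[leLHS]lnK ?posrE// ler_expR.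
have yN : (y <= N)%N.
  rewrite -(ler_nat R) (le_trans y_le)// -[leRHS]lnK ?posrE ?ltr0n// ler_expR ltW//.
rewrite (@big_cat_nat _ _ _ y.+1)//=.
pose g n : R := if prime n && (n == a %[mod s])%N then ln n%:R / n%:R else 0.
have gE : \sum_(y.+1 <= n < N.+1 | prime n && (n == a %[mod s])%N) n%:R^-1 =
    \sum_(y.+1 <= n < N.+1) g n / ln n%:R.
  rewrite big_mkcond/=; apply: eq_big_nat => n /andP[yn _].
  rewrite /g; case: ifP => _; last by rewrite mul0r.
  have ln0 : 0 < ln n%:R :> R by rewrite ln_gt0// ltr1n (leq_trans y2)// ltnW.
  by rewrite mulrAC divff ?mul1r ?gt_eqF.
have HE n : (0 < n)%N -> `|\sum_(1 <= m < n.+1) g m - c * ln n%:R| <= K * l ^+ 9.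
  by move=> n0; rewrite /g -big_mkcond/= mulrC; exact: HA.
have PS := partial_summation y2 yN c0 HE.
rewrite gE.
have y1 : 1 <= ln y%:R :> R by lra.
have /andP[A1 A2] := lnln_le y y1 lny; have /andP[B1 B2] := triv y y0 lny.
have c1 : c <= 1.
  by rewrite invf_le1// ler1n totient_gt0.
have PB : (2 * (K * l ^+ 9) + c) / ln y%:R <= 2 * K * l ^+ 9 / q + q^-1.
  apply: (@le_trans _ _ ((2 * (K * l ^+ 9) + c) / q)).
    apply: ler_wpM2l; first exact: addr_ge0 Kl c0.
    by rewrite lef_pV2 ?posrE//; exact: lt_le_trans ltr01 y1.
  rewrite mulrDl mulrA lerD2l ler_piMl// ltW//.
have := le_trans PS PB; rewrite !ler_norml => /andP[P1 P2].
have rhs2 := rhs.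
apply/andP; split.
  rewrite lerNl; apply: le_trans rhs; lra.
apply: le_trans rhs; lra.
Qed.

End ReciprocalsAP.

(** * Counting roots of unity *)

Section RootCounting.

Lemma nb_roots_gcd s d : (0 < d)%N ->
  nb_roots s (gcdn (carmichael s) d) = nb_roots s d.
Proof.
move=> d0; apply: eq_card => y; rewrite !inE -!order_dvdn dvdn_gcd.
by rewrite dvdn_exponent ?inE.
Qed.

Definition is_root (s d m : nat) : bool := (m ^ d == 1 %[mod s])%N.

Lemma is_root_coprime s d m : (0 < s)%N -> (0 < d)%N -> is_root s d m -> coprime s m.
Proof.
move=> s0 d0 /eqP E; rewrite -(coprime_pexpr _ _ d0) -coprime_modr E coprime_modr.
exact: coprimen1.
Qed.

Lemma is_root_mod s d m : is_root s d (m %% s) = is_root s d m.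
Proof. by rewrite /is_root modnXm. Qed.

Lemma is_root_dvdn s d m : (0 < m)%N -> is_root s d m = (s %| m ^ d - 1)%N.
Proof. by move=> m0; rewrite /is_root eqn_mod_dvd// expn_gt0 m0. Qed.

Lemma nb_roots_count s d : (1 < s)%N -> (0 < d)%N ->
  nb_roots s d = (\sum_(0 <= m < s) is_root s d m)%N.
Proof.
move=> s1 d0; have s0 : (0 < s)%N by exact: ltn_trans s1.
rewrite -[X in (\sum_(0 <= _ < X) _)%N](Zp_cast s1) big_mkord.
rewrite -[LHS]sum1_card big_mkcond/=.
rewrite [RHS](bigID (fun x : 'Z_s => x \is a GRing.unit))/= [X in _ = (_ + X)%N]big1 ?addn0; last first.
  move=> x xu; apply/eqP; rewrite eqb0; apply: contra xu => /(is_root_coprime s0 d0).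
  by rewrite -unitZpE// natr_Zp.
rewrite [RHS](reindex_omap (fun u : {unit 'Z_s} => val u) (insub : 'Z_s -> option {unit 'Z_s})) /=; last first.
  by move=> x xu; rewrite insubT.
apply: eq_big => [u|u _]; first by rewrite (valP u) valK eqxx.
rewrite inE /is_root; have -> : (u ^+ d == 1)%g = (val u ^+ d == 1).
  by rewrite -val_eqE FinRing.val_unitX FinRing.val_unit1.
have -> : (val u ^+ d == 1) = (nat_of_ord (val u) ^ d == 1 %[mod s])%N.
  rewrite -[val u in LHS]natr_Zp -natrX -[1 in LHS]/(1%:R) -val_eqE /=.
  by rewrite val_Zp_nat// [X in (1 %% X)%N](Zp_cast s1).
by case: eqP.
Qed.

Lemma window_count s d a : (0 < s)%N ->
  (\sum_(a <= m < a + s) is_root s d m = \sum_(0 <= m < s) is_root s d m)%N.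
Proof.
move=> s0; elim: a => [|a IH]; first by rewrite add0n.
rewrite -IH addSn big_nat_recr/= ?leq_addl//; last by rewrite -addn1 leq_add2l.
rewrite [RHS]big_ltn; last by rewrite -[X in (X < _)%N]addn0 ltn_add2l.
by rewrite addnC -(is_root_mod s d (a + s)) modnDr is_root_mod.
Qed.

End RootCounting.

(** * Integers and primes that are roots of unity modulo s *)

Section RootPrimes.
Variable R : realType.
Local Notation Lam := (mangoldt R).

(** Any s consecutive integers contain exactly f(s) roots, so complete windows are removed without
    error; in the remaining piece both quantities lie between 0 and f(s). *)
Lemma count_roots_le s d y : (1 < s)%N -> (0 < d)%N ->
  `|(\sum_(1 <= m < y.+1) is_root s d m)%N%:R - (nb_roots s d)%:R * y%:R / s%:R|
   <= (nb_roots s d)%:R :> R.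
Proof.
move=> s1 d0; have s0 : (0 < s)%N by exact: ltn_trans s1.
have s0' : 0 < s%:R :> R by rewrite ltr0n.
set f := (nb_roots s d)%:R.
have f0 : 0 <= f by rewrite ler0n.
elim/ltn_ind: y => y IH; have [ys|sy] := ltnP y s.
  have h1 : (\sum_(1 <= m < y.+1) is_root s d m)%N%:R <= f.
    rewrite ler_nat nb_roots_count// -(window_count d 1 s0) add1n.
    by rewrite [X in (_ <= X)%N](@big_cat_nat _ _ _ y.+1)//= ?leq_addr// ltnW.
  have h2 : 0 <= f * y%:R / s%:R <= f.
    rewrite divr_ge0 ?mulr_ge0//= ler_pdivrMr//.
    by rewrite ler_wpM2l// ler_nat ltnW.
  have h3 : 0 <= (\sum_(1 <= m < y.+1) is_root s d m)%N%:R :> R by rewrite ler0n.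
  by rewrite ler_norml; apply/andP; split; lra.
have ys : (y - s < y)%N by rewrite ltn_subrL s0 (leq_trans s0).
have := IH _ ys; rewrite natrB// mulrBr mulrBl mulfK ?gt_eqF//.
rewrite [in X in _ -> X](@big_cat_nat _ _ _ (y - s).+1)//= ?ltnS ?leq_subr//.
have -> : y.+1 = ((y - s).+1 + s)%N by rewrite addSn subnK.
rewrite window_count// -nb_roots_count// natrD -/f.
move: (f * y%:R / s%:R) => z.
by move: (_%:R) => c; have -> : c - (z - f) = c + f - z by ring.
Qed.

Lemma root_primes_recip : exists2 K : R, 0 < K & forall p k d N, prime p -> (0 < k)%N ->
  (0 < d)%N -> (4 <= N)%N ->
  `|\sum_((p ^ k).+1 <= n < N.+1 | prime n && is_root (p ^ k) d n) n%:R^-1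
    - (nb_roots (p ^ k) d)%:R * (ln (ln N%:R) / (totient (p ^ k))%:R)|
  <= (nb_roots (p ^ k) d)%:R * (K * (1 + ln (p ^ k)%:R) ^+ 9 / Num.sqrt (p ^ k)%:R).
Proof.
have [K K0 HK] := recip_primes_ap R; exists K => // p k d N pp k0 d0 N4.
have {}HK a : coprime (p ^ k) a -> _ := fun sa => HK p k a N pp k0 sa N4.
have s1 : (1 < p ^ k)%N by rewrite -(expn0 p) ltn_exp2l ?prime_gt1.
move: (p ^ k)%N s1 HK => s s1 HK.
have s0 : (0 < s)%N by exact: ltn_trans s1.
have -> : \sum_(s.+1 <= n < N.+1 | prime n && is_root s d n) n%:R^-1 =
  \sum_(0 <= a < s | is_root s d a) \sum_(s.+1 <= n < N.+1 | prime n && (n == a %[mod s])%N) n%:R^-1 :> R.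
  rewrite (exchange_big_dep_nat (fun n => prime n)) /=; last by move=> a n _ _ _ /andP[].
  rewrite big_mkcondr/=; apply: eq_bigr => n pn; rewrite pn /=.
  rewrite big_mkcond/= (bigD1_seq (n %% s)%N) ?iota_uniq ?mem_index_iota ?ltn_mod//=.
  rewrite is_root_mod modn_mod eqxx andbT big1_seq ?addr0// => a /andP[an].
  rewrite mem_index_iota => /andP[_ asl]; case: ifP => // /andP[_ /eqP E].
  by move: an; rewrite E modn_small// eqxx.
have cE : (nb_roots s d)%:R = \sum_(0 <= a < s | is_root s d a) 1 :> R.
  rewrite nb_roots_count// natr_sum [RHS]big_mkcond/=; apply: eq_bigr => a _.
  by case: is_root.
rewrite cE !big_distrl/= -sumrB; apply: le_trans (ler_norm_sum _ _ _) _.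
apply: ler_sum => a ra; rewrite !mul1r; apply: HK.
exact: is_root_coprime ra.
Qed.

End RootPrimes.

(** * The sum of log H *)

Section LogSum.
Variable R : realType.
Local Notation Lam := (mangoldt R).
Local Notation ll x := (ln (ln x)).

Lemma sum_mangoldt_dvd m M : (0 < m < M)%N ->
  \sum_(1 <= s < M | (s %| m)%N) Lam s = ln m%:R.
Proof.
case: M => [|M]; first by rewrite ltn0 andbF.
by rewrite ltnS => mM; rewrite -big_divisors// sum_mangoldt_divisors//; case/andP: mM.
Qed.

(** These s are the divisors of p^d - 1, so the sum is log(p^d - 1). It is the source of one of the
    two factors d in the error. *)
Lemma sum_mangoldt_root p d M : (1 < p)%N -> (0 < d)%N -> (p ^ d < M)%N ->
  \sum_(1 <= s < M | is_root s d p) Lam s <= d%:R * ln p%:R.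
Proof.
move=> p1 d0 pM; have p0 : (0 < p)%N by exact: ltn_trans p1.
have pd : (1 < p ^ d)%N by rewrite -(expn0 p) ltn_exp2l.
rewrite (eq_bigl (fun s => (s %| p ^ d - 1)%N)) => [|s]; last by rewrite is_root_dvdn.
rewrite sum_mangoldt_dvd; last by rewrite subn_gt0 pd (leq_ltn_trans (leq_subr _ _)).
rewrite mulr_natl -lnXn ?ltr0n// -natrX ler_ln ?posrE ?ltr0n ?subn_gt0 ?(ltnW pd)//.
by rewrite ler_nat leq_subr.
Qed.

(** The cutoff M exceeds every divisor of the gcds involved; it is otherwise free, so that it can
    later go to infinity with N fixed. *)
Lemma ln_Hfun d n N M : (0 < d)%N -> (0 < n <= N)%N -> (N ^ d < M)%N ->
  ln (Hfun d n)%:R =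
  \sum_(1 <= p < N.+1 | prime p && (p %| n)%N)
    \sum_(1 <= s < M | is_root s d p && is_root s d n) Lam s.
Proof.
move=> d0 /andP[n0 nN] NM.
transitivity (\sum_(p <- primes n) \sum_(1 <= s < M | is_root s d p && is_root s d n) Lam s); last first.
  rewrite -[RHS]big_filter; apply: perm_big; apply: uniq_perm; rewrite ?primes_uniq ?filter_uniq ?iota_uniq// => p.
  rewrite mem_filter mem_primes n0 /= mem_index_iota ltnS.
  case: (boolP (prime p)) => //= pp; case: (boolP (p %| n)%N) => //= pn.
  by rewrite prime_gt0// (leq_trans (dvdn_leq n0 pn)).
rewrite /Hfun natr_prod.
(* Generalised to sublists of [primes n] for the induction; positivity of the product is carried
   along because [ln] is additive only on positive factors. *)
have H (r : seq nat) : {subset r <= primes n} ->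
    ln (\prod_(p <- r) (gcdn (p ^ d - 1) (n ^ d - 1))%:R) =
    \sum_(p <- r) \sum_(1 <= s < M | is_root s d p && is_root s d n) Lam s :> R /\
    0 < \prod_(p <- r) (gcdn (p ^ d - 1) (n ^ d - 1))%:R :> R.
  elim: r => [|p r IH] sr; first by rewrite !big_nil ln1 ltr01.
  have [|E P] := IH; first by move=> q qr; apply: sr; rewrite inE qr orbT.
  have : p \in primes n by apply: sr; rewrite inE eqxx.
  rewrite mem_primes => /and3P[pp _ pn].
  have p1 := prime_gt1 pp; have p0 := prime_gt0 pp.
  have pd : (1 < p ^ d)%N by rewrite -(expn0 p) ltn_exp2l.
  have g0 : (0 < gcdn (p ^ d - 1) (n ^ d - 1))%N by rewrite gcdn_gt0 subn_gt0 pd.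
  rewrite !big_cons; split; last by rewrite mulr_gt0 ?ltr0n.
  rewrite lnM ?posrE ?ltr0n// E; congr (_ + _).
  rewrite -(@sum_mangoldt_dvd _ M).
    by apply: eq_bigl => s; rewrite dvdn_gcd !is_root_dvdn.
  rewrite g0 (leq_ltn_trans _ NM)//; apply: leq_trans (dvdn_leq _ (dvdn_gcdl _ _)) _.
    by rewrite subn_gt0.
  apply: leq_trans (leq_subr _ _) _; rewrite leq_exp2r//.
  by apply: leq_trans (dvdn_leq n0 pn) nN.
by have [] := H (primes n) (fun _ => id).
Qed.

Lemma sum_ln_Hfun d N M : (0 < d)%N -> (N ^ d < M)%N ->
  \sum_(1 <= n < N.+1) ln (Hfun d n)%:R =
  \sum_(1 <= p < N.+1 | prime p) \sum_(1 <= s < M | is_root s d p)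
     Lam s * (\sum_(1 <= m < (N %/ p).+1) is_root s d m)%N%:R.
Proof.
move=> d0 NM.
rewrite (eq_big_nat _ _ (F2 := fun n => \sum_(1 <= p < N.+1 | prime p && (p %| n)%N)
    \sum_(1 <= s < M | is_root s d p && is_root s d n) Lam s)); last first.
  by move=> n nN; apply: ln_Hfun.
rewrite (exchange_big_dep_nat (fun p => prime p)) /=; last by move=> n p _ _ _ /andP[].
apply: eq_bigr => p pp; rewrite pp /=.
have p0 := prime_gt0 pp.
pose G m := \sum_(1 <= s < M | is_root s d p && is_root s d (p * m)) Lam s.
rewrite (eq_bigr (fun n => G (n %/ p)%N)); last first.
  by move=> n pn; rewrite /G mulnC divnK.
rewrite (big_multiples G)//.
rewrite (eq_bigr (fun m => \sum_(1 <= s < M | is_root s d p)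
  if is_root s d (p * m) then Lam s else 0)) => [|m _]; last by rewrite /G big_mkcondr.
rewrite exchange_big/=; apply: eq_bigr => s rs.
rewrite natr_sum big_distrr/=; apply: eq_bigr => m _.
(* Here p is itself a root modulo s, so multiplication by p preserves being a root. *)
have -> : is_root s d (p * m) = is_root s d m.
  by rewrite /is_root expnMn -modnMml (eqP rs) modnMml mul1n.
by case: is_root; rewrite ?mulr1 ?mulr0.
Qed.

Definition prime_recip_root s d N : R :=
  \sum_(1 <= p < N.+1 | prime p && is_root s d p) p%:R^-1.

Lemma mangoldt_nb_roots s d : (0 < d)%N ->
  Lam s != 0 -> (nb_roots s d)%:R <= 2 * d%:R :> R.
Proof.
move=> d0 /mangoldt_neq0[p [k [pp k0 ->]]].
by rewrite -natrM ler_nat nb_roots_le.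
Qed.

(** For each pair p, s the count errs by f(s), and replacing [N/p] by x/p errs by another f(s),
    together at most 4d. Summing Lambda over s gives d log p, and Chebyshev's 6x over p completes 24
    d^2 x. *)
Lemma sum_ln_Hfun_approx d (x : R) N M : (0 < d)%N -> (0 < N)%N ->
  N%:R <= x < N.+1%:R -> (N ^ d < M)%N ->
  `|\sum_(1 <= n < N.+1) ln (Hfun d n)%:R -
    x * \sum_(1 <= s < M) Lam s * (nb_roots s d)%:R / s%:R * prime_recip_root s d N|
  <= 24 * d%:R ^+ 2 * x.
Proof.
move=> d0 N0 /andP[Nx xN] NM.
have N0' : 0 < N%:R :> R by rewrite ltr0n.
have x0 : 0 < x by exact: lt_le_trans Nx.
rewrite (sum_ln_Hfun d0 NM).
have -> : x * (\sum_(1 <= s < M) Lam s * (nb_roots s d)%:R / s%:R * prime_recip_root s d N) =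
   \sum_(1 <= p < N.+1 | prime p) \sum_(1 <= s < M | is_root s d p)
     Lam s * ((nb_roots s d)%:R * (x / p%:R) / s%:R).
  rewrite big_distrr/= (exchange_big_dep_nat xpredT)//=; apply: eq_bigr => s _.
  rewrite /prime_recip_root [in LHS]mulrA big_distrr/=; apply: eq_big => [p|p _].
    by [].
  by ring.
rewrite -sumrB; apply: le_trans (ler_norm_sum _ _ _) _.
have d0' : 0 < d%:R :> R by rewrite ltr0n.
apply: (@le_trans _ _ (\sum_(1 <= p < N.+1 | prime p) 4 * d%:R * (d%:R * Lam p))).
  rewrite big_nat_cond [leRHS]big_nat_cond; apply: ler_sum => p /andP[/andP[_ pN] pp].
  have p0' : 0 < p%:R :> R by rewrite ltr0n prime_gt0.
  rewrite -sumrB; apply: le_trans (ler_norm_sum _ _ _) _.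
  apply: (@le_trans _ _ (\sum_(1 <= s < M | is_root s d p) 4 * d%:R * Lam s)).
    rewrite big_nat_cond [leRHS]big_nat_cond; apply: ler_sum => s /andP[/andP[s0 _] _].
    rewrite -mulrBr normrM ger0_norm ?mangoldt_ge0// [leRHS]mulrC.
    have [->|Ls] := eqVneq (Lam s) 0; first by rewrite !mul0r.
    apply: ler_wpM2l; first exact: mangoldt_ge0.
    have f2 := mangoldt_nb_roots d0 Ls.
    have s1 : (1 < s)%N.
      by case: s s0 Ls {f2} => [|[|]]//; rewrite mangoldt1 eqxx.
    have C := count_roots_le R (N %/ p) s1 d0.
    have s0' : 1 <= s%:R :> R by rewrite ler1n.
    set y := (N %/ p)%N in C *.
    have y1 : y%:R <= x / p%:R.
      rewrite ler_pdivlMr// (le_trans _ Nx)// -natrM ler_nat.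
      exact: leq_trunc_div.
    have y2 : x / p%:R <= y%:R + 1.
      rewrite ler_pdivrMr// natr1 -natrM ltW// (lt_le_trans xN)// ler_nat.
      exact: ltn_ceil (prime_gt0 pp).
    have f0 : 0 <= (nb_roots s d)%:R :> R by rewrite ler0n.
    have D : `|(nb_roots s d)%:R * y%:R / s%:R - (nb_roots s d)%:R * (x / p%:R) / s%:R| <= (nb_roots s d)%:R.
      have si : `|s%:R^-1 : R| <= 1 by rewrite ger0_norm ?invr_ge0 ?ler0n// invf_le1//; lra.
      rewrite -mulrBl -mulrBr !normrM (ger0_norm f0).
      rewrite -[leRHS]mulr1; apply: ler_pM; rewrite ?mulr_ge0//.
      rewrite -[leRHS]mulr1; apply: ler_wpM2l => //.
      by rewrite ler_norml; apply/andP; split; lra.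
    have := ler_normD (((\sum_(1 <= m < y.+1) is_root s d m)%N%:R : R) - (nb_roots s d)%:R * y%:R / s%:R)
      ((nb_roots s d)%:R * y%:R / s%:R - (nb_roots s d)%:R * (x / p%:R) / s%:R).
    rewrite addrA subrK => /le_trans; apply; lra.
  rewrite -big_distrr/=; apply: ler_wpM2l; first by rewrite mulr_ge0// ltW.
  rewrite mangoldt_prime//; apply: sum_mangoldt_root => //; first exact: prime_gt1.
  by apply: leq_ltn_trans NM; rewrite leq_exp2r// -ltnS.
rewrite -!big_distrr/=.
have ps : \sum_(1 <= p < N.+1 | prime p) Lam p <= 6 * x.
  apply: (@le_trans _ _ (chebyshev_psi R N)).
    rewrite /chebyshev_psi [leRHS](bigID prime)/= lerDl sumr_ge0// => p _.
    exact: mangoldt_ge0.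
  by apply: le_trans (chebyshev_psi_le R N) _; rewrite ler_pM2l.
have : 4 * d%:R * (d%:R * \sum_(1 <= p < N.+1 | prime p) Lam p) <= 4 * d%:R * (d%:R * (6 * x)).
  by apply: ler_wpM2l; [rewrite mulr_ge0// ltW|apply: ler_wpM2l => //; exact: ltW].
by move=> /le_trans; apply; rewrite le_eqVlt; apply/orP; left; apply/eqP; ring.
Qed.

Definition c3_term d s : R :=
  (nb_roots s d)%:R ^+ 2 * Lam s / (s%:R * (totient s)%:R).

Lemma c3_term_ge0 d s : 0 <= c3_term d s.
Proof. by rewrite divr_ge0 ?mulr_ge0 ?exprn_ge0 ?mangoldt_ge0. Qed.

End LogSum.

(** * Summation over the moduli *)

Section MainEstimate.
Variable R : realType.
Local Notation Lam := (mangoldt R).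
Local Notation ll x := (ln (ln x)).

(** From f(s) <= 2d and phi(s) >= s/2 each term is at most 8 d^2 log s/s^2. *)
Lemma sum_c3_term_bounded : exists2 C : R, 0 < C & forall d M, (0 < d)%N ->
  \sum_(1 <= s < M) c3_term R d s <= C * d%:R ^+ 2.
Proof.
have [C C0 H] := sum_ln_sqr_bounded R.
exists (8 * C) => [|d M d0]; first by rewrite mulr_gt0.
apply: (@le_trans _ _ (\sum_(1 <= s < M) 8 * d%:R ^+ 2 * (ln s%:R / s%:R ^+ 2))).
  rewrite big_nat_cond [leRHS]big_nat_cond; apply: ler_sum => s /andP[/andP[s0 _] _].
  have s0' : 0 < s%:R :> R by rewrite ltr0n.
  have t0 : 0 < (totient s)%:R :> R by rewrite ltr0n totient_gt0.
  have l0 : 0 <= ln s%:R :> R by apply: ln_nat_ge0.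
  rewrite /c3_term; have [->|Ls] := eqVneq (Lam s) 0.
    by rewrite mulr0 mul0r mulr_ge0 ?divr_ge0 ?exprn_ge0 ?mulr_ge0.
  have f2 := mangoldt_nb_roots d0 Ls.
  have ts : s%:R <= 2 * (totient s)%:R :> R.
    have [p [k [pp k0 ->]]] := mangoldt_neq0 Ls.
    by rewrite -natrM ler_nat; apply: totient_ge.
  rewrite ler_pdivrMr ?mulr_gt0//.
  have E : 8 * d%:R ^+ 2 * (ln s%:R / s%:R ^+ 2) * (s%:R * (totient s)%:R) =
     (2 * d%:R) ^+ 2 * ln s%:R * ((2 * (totient s)%:R) / s%:R) :> R.
    by field; rewrite gt_eqF.
  rewrite E -[leLHS]mulr1; apply: ler_pM => //.
  - by rewrite mulr_ge0 ?exprn_ge0 ?mangoldt_ge0.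
  - apply: ler_pM; rewrite ?exprn_ge0 ?mangoldt_ge0 ?mangoldt_le//.
    by rewrite lerXn2r ?nnegrE ?mulr_ge0.
  - by rewrite ler_pdivlMr// mul1r.
rewrite -big_distrr/= mulrAC; apply: ler_wpM2r; first exact: exprn_ge0.
by apply: ler_wpM2l.
Qed.

(** For p <= s the factor 1/s is at most 1/p. Extending the inner sum to all s with p^d = 1 mod s
    and using [sum_mangoldt_root] leaves 2 d^2 times the sum of log p/p^2. *)
Lemma sum_small_primes_bounded : exists2 C : R, 0 < C & forall d N M,
  (0 < d)%N -> (N ^ d < M)%N ->
  \sum_(1 <= s < M) Lam s * (nb_roots s d)%:R / s%:R *
    (\sum_(1 <= p < N.+1 | (prime p && is_root s d p) && (p <= s)%N) p%:R^-1)
  <= C * d%:R ^+ 2.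
Proof.
have [C C0 H] := sum_ln_sqr_bounded R.
exists (2 * C) => [|d N M d0 NM]; first by rewrite mulr_gt0.
apply: (@le_trans _ _ (\sum_(1 <= s < M) \sum_(1 <= p < N.+1 | prime p && is_root s d p)
   2 * d%:R / p%:R ^+ 2 * Lam s)).
  rewrite big_nat_cond [leRHS]big_nat_cond; apply: ler_sum => s /andP[/andP[s0 _] _].
  rewrite big_distrr/= big_mkcondr/=; apply: ler_sum => p /andP[pp _].
  have p0 : 0 < p%:R :> R by rewrite ltr0n prime_gt0.
  have s0' : 0 < s%:R :> R by rewrite ltr0n.
  have L0 := mangoldt_ge0 R s.
  case: leqP => ps; last by rewrite mulr_ge0// divr_ge0 ?exprn_ge0 ?mulr_ge0.
  have [->|Ls] := eqVneq (Lam s) 0; first by rewrite !mul0r mulr0.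
  have f2 := mangoldt_nb_roots d0 Ls.
  have -> : 2 * d%:R / p%:R ^+ 2 * Lam s = Lam s * (2 * d%:R) * p%:R^-1 * p%:R^-1.
    by field; rewrite gt_eqF.
  apply: ler_wpM2r; first by rewrite invr_ge0 ltW.
  apply: ler_pM; rewrite ?invr_ge0 ?mulr_ge0//; first exact: ler_wpM2l.
  by rewrite lef_pV2 ?posrE// ler_nat.
rewrite (exchange_big_dep_nat (fun p => prime p))/=; last by move=> s p _ _ _ /andP[].
apply: (@le_trans _ _ (\sum_(1 <= p < N.+1) 2 * d%:R ^+ 2 * (ln p%:R / p%:R ^+ 2))).
  rewrite big_mkcond big_nat_cond [leRHS]big_nat_cond; apply: ler_sum => p /andP[/andP[p0 pN] _].
  case: ifP => pp; last first.
    by rewrite mulr_ge0 ?divr_ge0 ?exprn_ge0 ?mulr_ge0 ?ln_nat_ge0.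
  have p0' : 0 < p%:R :> R by rewrite ltr0n.
  rewrite -big_distrr/=.
  have -> : 2 * d%:R ^+ 2 * (ln p%:R / p%:R ^+ 2) = 2 * d%:R / p%:R ^+ 2 * (d%:R * ln p%:R) :> R.
    by field; rewrite gt_eqF.
  apply: ler_wpM2l; first by rewrite divr_ge0 ?exprn_ge0 ?mulr_ge0.
  rewrite (eq_bigl (fun s => is_root s d p)) => [|s]; last by rewrite pp.
  apply: sum_mangoldt_root => //; first exact: prime_gt1.
  by apply: leq_ltn_trans NM; rewrite leq_exp2r// -ltnS.
rewrite -big_distrr/= mulrAC; apply: ler_wpM2r; first exact: exprn_ge0.
by apply: ler_wpM2l.
Qed.

Lemma sum_prime_recip_root : exists2 C : R, 0 < C & forall d N M,
  (0 < d)%N -> (4 <= N)%N -> (N ^ d < M)%N ->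
  `|\sum_(1 <= s < M) Lam s * (nb_roots s d)%:R / s%:R * prime_recip_root R s d N -
    (\sum_(1 <= s < M) c3_term R d s) * ll N%:R| <= C * d%:R ^+ 2.
Proof.
have [K K0 HK] := root_primes_recip R.
have [C1 C10 H1] := sum_small_primes_bounded.
(* The index 9 stands for the exponent 10: nine logarithms from the sum over primes and one from
   Lambda(s). *)
have [C2 C20 H2] := sum_logpow_bounded R 9.
exists (C1 + 4 * K * C2) => [|d N M d0 N4 NM].
  by rewrite addr_gt0 ?mulr_gt0.
pose P s := \sum_(s.+1 <= n < N.+1 | prime n && is_root s d n) n%:R^-1 : R.
pose A s := \sum_(1 <= p < N.+1 | (prime p && is_root s d p) && (p <= s)%N) p%:R^-1 : R.
have E s : prime_recip_root R s d N = A s + P s.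
  rewrite /prime_recip_root (bigID (fun p => (p <= s)%N))/=; congr (_ + _).
  rewrite /P (@big_nat_widenl _ _ _ s.+1 1)//.
  by apply: eq_bigl => p; rewrite -ltnNge.
pose c s := Lam s * (nb_roots s d)%:R / s%:R.
have -> : \sum_(1 <= s < M) Lam s * (nb_roots s d)%:R / s%:R * prime_recip_root R s d N -
    (\sum_(1 <= s < M) c3_term R d s) * ll N%:R =
  \sum_(1 <= s < M) c s * A s +
  \sum_(1 <= s < M) c s * (P s - (nb_roots s d)%:R * (ll N%:R / (totient s)%:R)).
  rewrite big_distrl/= -sumrB -big_split/=; apply: eq_bigr => s _.
  rewrite E /c /c3_term invfM; ring.
have A0 : 0 <= \sum_(1 <= s < M) c s * A s.
  apply: sumr_ge0 => s _; rewrite mulr_ge0 ?divr_ge0 ?mulr_ge0 ?mangoldt_ge0//.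
  by apply: sumr_ge0 => p _; rewrite invr_ge0.
apply: le_trans (ler_normD _ _) _; rewrite (ger0_norm A0) mulrDl.
apply: lerD; first exact: H1.
apply: le_trans (ler_norm_sum _ _ _) _.
apply: (@le_trans _ _ (\sum_(1 <= s < M) 4 * K * d%:R ^+ 2 *
    ((1 + ln s%:R) ^+ 10 / (s%:R * Num.sqrt s%:R)))); last first.
  rewrite -big_distrr/= mulrAC; apply: ler_wpM2r; first exact: exprn_ge0.
  by apply: ler_wpM2l => //; rewrite mulr_ge0 ?ltW.
rewrite big_nat_cond [leRHS]big_nat_cond; apply: ler_sum => s /andP[/andP[s0 _] _].
have s0' : 0 < s%:R :> R by rewrite ltr0n.
have q0 : 0 < Num.sqrt s%:R :> R by rewrite sqrtr_gt0.
have l1 := add1_ln_ge1 R s.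
have l0 : 0 <= 1 + ln s%:R :> R by apply: le_trans l1.
rewrite /c; have [->|Ls] := eqVneq (Lam s) 0.
  rewrite !mul0r normr0; apply: mulr_ge0.
    by rewrite mulr_ge0 ?exprn_ge0// mulr_ge0 ?ltW.
  by rewrite divr_ge0 ?exprn_ge0 ?mulr_ge0// ltW.
have f2 := mangoldt_nb_roots d0 Ls.
have D : `|P s - (nb_roots s d)%:R * (ll N%:R / (totient s)%:R)| <=
    (nb_roots s d)%:R * (K * (1 + ln s%:R) ^+ 9 / Num.sqrt s%:R).
  have [p [k [pp k0 es]]] := mangoldt_neq0 Ls.
  by rewrite /P es; exact: HK.
have L0 := mangoldt_ge0 R s.
have f0 : 0 <= (nb_roots s d)%:R :> R by [].
have LL : Lam s <= 1 + ln s%:R.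
  by apply: le_trans (mangoldt_le R s) _; rewrite lerDr.
rewrite normrM ger0_norm; last by rewrite divr_ge0 ?mulr_ge0.
have -> : 4 * K * d%:R ^+ 2 * ((1 + ln s%:R) ^+ 10 / (s%:R * Num.sqrt s%:R)) =
  (1 + ln s%:R) * (2 * d%:R) / s%:R * ((2 * d%:R) * (K * (1 + ln s%:R) ^+ 9 / Num.sqrt s%:R)) :> R.
  by field; rewrite !gt_eqF.
apply: ler_pM => //.
- by rewrite divr_ge0 ?mulr_ge0.
- by apply: ler_wpM2r; [rewrite invr_ge0 ltW|apply: ler_pM].
- apply: le_trans D _; apply: ler_wpM2r => //.
  by rewrite divr_ge0 ?mulr_ge0 ?exprn_ge0// ltW.
Qed.

End MainEstimate.

(** * The main term as a series *)

Section Conclusion.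
Variable R : realType.
Local Notation Lam := (mangoldt R).
Local Notation ll x := (ln (ln x)).

Lemma ln_ln_truncn (x : R) : 4 <= x ->
  [/\ (4 <= Num.truncn x)%N, 0 <= ll x & `|ll (Num.truncn x)%:R - ll x| <= 1].
Proof.
move=> x4; have x0 : 0 <= x by apply: le_trans x4.
have N4 : (4 <= Num.truncn x)%N by rewrite truncn_ge_nat.
have /andP[Nx xN] := truncn_itv x0; move: N4 Nx xN; move: (Num.truncn x) => N N4 Nx xN.
have N0 : (0 < N)%N by apply: leq_trans N4.
have N0' : 0 < N%:R :> R by rewrite ltr0n.
have xp : 0 < x by apply: lt_le_trans Nx.
have l2 : 1 <= 2 * ln (2%:R : R).
  have := ln_succ_ge R (ltn0Sn 0); rewrite ln1 subr0; lra.
have l2' : ln (2%:R : R) <= 1.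
  have := ln_succ_le R (ltn0Sn 0); rewrite ln1 subr0; lra.
have ln4 : ln (4%:R : R) = 2 * ln 2%:R.
  have -> : 4%:R = 2%:R * 2%:R :> R by rewrite -natrM.
  by rewrite lnM ?posrE ?ltr0n// mulr_natl mulr2n.
have lnN : 1 <= ln (N%:R : R).
  apply: le_trans (_ : ln 4%:R <= _); first by rewrite ln4.
  by rewrite ler_ln ?posrE ?ltr0n// ler_nat.
have lnx : ln (N%:R : R) <= ln x by rewrite ler_ln ?posrE.
have lx2 : ln x <= 2%:R * ln N%:R.
  have : ln x <= ln (2%:R * N%:R : R).
    rewrite ler_ln ?posrE ?mulr_gt0// ltW// (lt_le_trans xN)//.
    by rewrite -natrM ler_nat; lia.
  rewrite lnM ?posrE//; move: lnN l2'; move: (ln 2%:R) (ln N%:R) (ln x) => u v w; lra.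
have lp : 0 < ln N%:R :> R by apply: lt_le_trans lnN.
have llx : ll N%:R <= ll x by rewrite ler_ln ?posrE// (lt_le_trans lp).
have llx2 : ll x <= ln 2%:R + ll N%:R.
  rewrite -lnM ?posrE// ler_ln ?posrE ?mulr_gt0//; exact: lt_le_trans lnx.
split => //; first by apply: le_trans llx; rewrite ln_ge0.
rewrite distrC ger0_norm ?subr_ge0//; move: llx2 l2'.
move: (ll x) (ll N%:R) (ln 2%:R) => u v w; lra.
Qed.

(** Passing from log log N to log log x costs at most the sum of the [c3_term], again O(d^2). The
    constant depends neither on x nor on M, which permits M to grow for fixed x. *)
Lemma mean_ln_Hfun : exists2 C : R, 0 < C & forall d (x : R) M,
  (0 < d)%N -> 4 <= x -> (Num.truncn x ^ d < M)%N ->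
  `|x^-1 * (\sum_(1 <= n < (Num.truncn x).+1) ln (Hfun d n)%:R) -
    (\sum_(1 <= s < M) c3_term R d s) * ll x| <= C * d%:R ^+ 2.
Proof.
have [C1 C10 H1] := sum_c3_term_bounded R.
have [C2 C20 H2] := sum_prime_recip_root R.
exists (24 + C2 + C1) => [|d x M d0 x4 NM]; first by rewrite !addr_gt0.
have x0 : 0 < x by apply: lt_le_trans x4.
have [N4 l0 ld] := ln_ln_truncn x4.
have Nx := truncn_itv (ltW x0).
set N := Num.truncn x in NM N4 ld Nx *.
have E1 := sum_ln_Hfun_approx d0 (leq_trans (isT : 0 < 4)%N N4) Nx NM.
have E2 := H2 d N M d0 N4 NM.
move: E1 E2; set T := \sum_(1 <= s < M) _ * prime_recip_root R s d N.
set S := \sum_(1 <= n < N.+1) _; set A := \sum_(1 <= s < M) c3_term R d s => E1 E2.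
have A0 : 0 <= A by apply: sumr_ge0 => s _; exact: c3_term_ge0.
have -> : x^-1 * S - A * ll x = x^-1 * (S - x * T) + (T - A * ll N%:R) + A * (ll N%:R - ll x).
  by field; rewrite gt_eqF.
rewrite [leRHS]mulrDl [X in _ <= X + _]mulrDl; apply: le_trans (ler_normD _ _) _; apply: lerD.
  apply: le_trans (ler_normD _ _) _; apply: lerD => //.
  rewrite normrM gtr0_norm ?invr_gt0// [leLHS]mulrC ler_pdivrMr//.
rewrite normrM ger0_norm// -[leRHS]mulr1; apply: ler_pM => //; exact: H1.
Qed.

(** For each s exactly one divisor d1 of d occurs, namely gcd(lambda(s), d), and y^d = 1 is
    equivalent to y^d1 = 1 because the order of y divides lambda(s). *)
Lemma c3_constE d : (0 < d)%N ->
  c3_const R d = (\sum_(1 <= s <oo) (c3_term R d s)%:E)%E.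
Proof.
move=> d0; rewrite /c3_const.
under eq_bigr do rewrite eseries_mkcond.
rewrite -nneseries_sum; last first.
  by move=> d1 s _; case: ifP => // _; rewrite lee_fin divr_ge0 ?mulr_ge0 ?exprn_ge0 ?mangoldt_ge0.
apply: eq_eseriesr => s _.
rewrite (bigD1_seq (gcdn (carmichael s) d)) ?divisors_uniq//=; last first.
  by rewrite -dvdn_divisors// dvdn_gcdr.
rewrite eqxx nb_roots_gcd// big1 ?adde0// => d1.
by rewrite eq_sym => /negbTE ->.
Qed.

(** Returns from extended reals to reals: the series is finite and is the least upper bound of its
    partial sums, the form in which the limit in M is taken. *)
Lemma nneseries_bounded (u : nat -> R) (b : R) : (forall n, 0 <= u n) ->
  (forall M, \sum_(1 <= s < M) u s <= b) ->
  exists2 c : R, (\sum_(1 <= s <oo) (u s)%:E = c%:E)%E &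
    (forall M, \sum_(1 <= s < M) u s <= c) /\
    (forall b' : R, (forall M, \sum_(1 <= s < M) u s <= b') -> c <= b').
Proof.
move=> u0 ub.
have u0' n : (1 <= n)%N -> true -> (0 <= (u n)%:E)%E by rewrite lee_fin.
have leS M : ((\sum_(1 <= s < M) u s)%:E <= \sum_(1 <= s <oo) (u s)%:E)%E.
  rewrite -sumEFin; exact: (nneseries_lim_ge _ u0').
have geS (b' : R) : (forall M, \sum_(1 <= s < M) u s <= b') ->
    (\sum_(1 <= s <oo) (u s)%:E <= b'%:E)%E.
  move=> ub'; apply: lime_le; first exact: is_cvg_nneseries.
  by apply: nearW => M; rewrite sumEFin lee_fin.
have := geS b ub; have := leS 0%N; move: leS geS.
move: (\sum_(1 <= s <oo) (u s)%:E)%E => [c| |] leS geS // _ _.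
by exists c => //; split => [M|b' /geS]; rewrite -lee_fin.
Qed.

End Conclusion.

Theorem theorem3 (R : realType) :
  exists C x0 : R, forall (d : nat) (x : R), (1 <= d)%N -> x0 <= x ->
    (`| (x^-1 * \sum_(1 <= n < (Num.truncn x).+1) ln (Hfun d n)%:R)%:E
        - c3_const R d * (ln (ln x))%:E |
     <= (C * d%:R ^+ 4)%:E)%E.
Proof.
have [C C0 HC] := mean_ln_Hfun R.
have [C1 C10 H1] := sum_c3_term_bounded R.
(* From x >= 4 on, log log x is nonnegative, so multiplying by it preserves inequalities between
   partial sums. *)
exists C, 4 => d x d0 x4.
have [c Ec [lec gec]] := nneseries_bounded (@c3_term_ge0 R d) (fun M => H1 d M d0).
have [_ l0 _] := ln_ln_truncn x4.
have {}HC M := HC d x M d0 x4.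
rewrite c3_constE// Ec -EFinM -EFinB abse_EFin lee_fin.
(* The estimate holds with d^2; the exponent 4 follows from d >= 1. *)
apply: (@le_trans _ _ (C * d%:R ^+ 2)); last first.
  by rewrite ler_pM2l// ler_weXn2l// ler1n.
move: HC; set a := x^-1 * _; set l := ln (ln x) in l0 *; set B := C * _ => HC.
set M0 := (Num.truncn x ^ d).+1.
have := HC M0 (ltnSn _); rewrite !ler_norml => /andP[_ b1].
have b2 : (\sum_(1 <= s < M0) c3_term R d s) * l <= c * l by apply: ler_wpM2r.
apply/andP; split; last by move: b1 b2; lra.
suff : c * l <= a + B by lra.
have [l00|lneq] := eqVneq l 0.
  by have := HC M0 (ltnSn _); rewrite l00 !mulr0 subr0 ler_norml; lra.
have lp : 0 < l by rewrite lt_def lneq.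
(* The least upper bound property carries the bound (a + B)/l from partial sums to c. As the
   estimate is valid only from M0 on, a shorter partial sum is first extended to max(M, M0). *)
rewrite -ler_pdivlMr//; apply: gec => M; rewrite ler_pdivlMr//.
apply: (@le_trans _ _ ((\sum_(1 <= s < maxn M M0) c3_term R d s) * l)).
  apply: ler_wpM2r => //; case: M => [|M]; first by rewrite big_geq// sumr_ge0// => s _; exact: c3_term_ge0.
  rewrite [leRHS](@big_cat_nat _ _ _ M.+1)//= ?leq_maxl// lerDl.
  by apply: sumr_ge0 => s _; exact: c3_term_ge0.
by have := HC (maxn M M0) (leq_maxr _ _); rewrite ler_norml; lra.
Qed.
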